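(* Let $\lambda\in\mathbb{R}$ and let the real valued function $q(x,y)$ satisfy $q_{xx}+q_{yy}-4\lambda q=0$ in the interior $D$ of the equilateral triangle of side $l$, with the Dirichlet boundary conditions $q^{(j)}(s)=f_j(s)$, $s\in[-\frac l2,\frac l2]$, $j=1,2,3$, where the given functions $f_j(s)$ have sufficient smoothness and are continuous at the vertices. Then the Neumann data $q_N^{(j)}(s)$, $j=1,2,3$, can be expressed in terms of the given Dirichlet data by the Fourier series $$q^{(j)}_N(s)=\frac{1}{3l}\sum_{n=-\infty}^{\infty}\left[M(k_{3n})+c_1^{(j)}e^{\frac{2i\pi s}{3l}}M(k_{3n-1})+c_2^{(j)}e^{\frac{4i\pi s}{3l}}M(k_{3n-2})\right]e^{-\frac{2i\pi ns}{l}},$$ where $k_m$ is defined by $$k_m+\frac{\lambda}{k_m}=\frac{2im\pi}{3l},\qquad m\in\mathbb{Z},$$ $$c_1^{(1)}=c_2^{(1)}=1,\qquad c_1^{(2)}=c_2^{(3)}=\bar\alpha,\qquad c_1^{(3)}=c_2^{(2)}=\alpha,$$ $$M(k_m)=\frac{2iX(k_m)}{\bar\alpha^{m}e(\bar\alpha k_m)-e(-\bar\alpha k_m)},$$ and $X(k_m)$ is given, with $k=k_m$, by $$X(k)=\left[e^2(-k)e(\bar\alpha k)+e(-\bar\alpha k)\right]\left[F_1(k)+e^2(-k)F_2(k)+e^2(k)F_3(k)\right]$$ $$+2e^2(k)\left[F_1(\alpha k)+e^2(-k)F_2(\alpha k)+e^2(k)F_3(\alpha k)\right]+2e(-k)\left[F_1(\bar\alpha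 k)+e^2(-k)F_2(\bar\alpha k)+e^2(k)F_3(\bar\alpha k)\right],$$ with $$F_j(k)=\int_{-l/2}^{l/2}\exp\left\{\left(k+\frac{\lambda}{k}\right)s\right\}\left[\frac12\frac{d}{ds}f_j(s)+\frac{\lambda}{k}f_j(s)\right]ds,\qquad j=1,2,3,\quad k\in\mathbb{C}\setminus\{0\}.$$
   Context: Notation: $z=x+iy$, $\alpha=e^{2i\pi/3}$, $\bar\alpha=e^{-2i\pi/3}$, $l>0$, and $e(k)=\exp\left\{\left(k+\frac{\lambda}{k}\right)\frac l2\right\}$ for $k\in\mathbb{C}\setminus\{0\}$; $e^p(k)$ denotes the $p$-th power $(e(k))^p$. $D\subset\mathbb{C}$ is the interior of the equilateral triangle with side length $l$ and vertices $z_1=\frac{l}{\sqrt3}e^{i\pi/3}$, $z_2=\bar z_1$, $z_3=-\frac{l}{\sqrt3}$. The sides $(z_2,z_1)$, $(z_3,z_2)$, $(z_1,z_3)$ are called sides (1), (2), (3) and are parametrized by arclength $s\in[-\frac l2,\frac l2]$ as follows: side (1): $z(s)=\frac{l}{2\sqrt3}+is$; side (2): $z(s)=\left(\frac{l}{2\sqrt3}+is\right)e^{-2i\pi/3}$; side (3): $z(s)=\left(\frac{l}{2\sqrt3}+is\right)e^{2i\pi/3}$. For $j=1,2,3$, $q^{(j)}(s)$ denotes the value of $q$ on side $(j)$ and $q^{(j)}_N(s)$ denotes the derivative of $q$ along the outward normal on side $(j)$, both at the point with parameter $s$. Continuity of the data at the vertices means $f_1(-\frac l2)=f_2(\frac l2)$,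 $f_2(-\frac l2)=f_3(\frac l2)$, $f_3(-\frac l2)=f_1(\frac l2)$.
   Formalization: Proved for λ such that no denominator of M(k_m) vanishes (it does for some λ<0, where the formula is undefined); for λ=0, where k_0 does not exist, M(k_0) is taken as 0; q is C^1 up to the closed triangle, f_j are C^2, and s lies in the open interval (-l/2,l/2). *)

(* Defs.v *)
(* Stdlib reals with Coquelicot; z = x + i y is the pair (x, y) : C. *)
From Stdlib Require Import Reals ZArith.
From Coquelicot Require Export Coquelicot.
Open Scope R_scope.

Definition Cexp (z : C) : C := (exp (Re z) * cos (Im z), exp (Re z) * sin (Im z)).

Definition CpowZ (z : C) (m : Z) : C :=
  match m with
  | Z0 => RtoC 1
  | Zpos p => Cpow z (Pos.to_nat p)
  | Zneg p => Cinv (Cpow z (Pos.to_nat p))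
  end.

Definition alpha : C := Cexp (2 * Ci * PI / 3)%C.
Definition alphab : C := Cexp (- (2 * Ci * PI) / 3)%C.

Definition vertex1 (l : R) : C := ((l / sqrt 3)%R * Cexp (Ci * PI / 3))%C.
Definition vertex2 (l : R) : C := Cconj (vertex1 l).
Definition vertex3 (l : R) : C := RtoC (- (l / sqrt 3)).

Definition open_triangle (l : R) (z : C) : Prop :=
  exists a b c : R, 0 < a /\ 0 < b /\ 0 < c /\ a + b + c = 1 /\
    z = (a * vertex1 l + b * vertex2 l + c * vertex3 l)%C.

Definition closed_triangle (l : R) (z : C) : Prop :=
  exists a b c : R, 0 <= a /\ 0 <= b /\ 0 <= c /\ a + b + c = 1 /\
    z = (a * vertex1 l + b * vertex2 l + c * vertex3 l)%C.

Inductive side : Set := side1 | side2 | side3.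

(* Side (1) lies on the line x = l / (2 sqrt 3), to the right of the triangle,
   so its outward unit normal is 1; sides (2) and (3) are the images of side (1)
   under multiplication by [outward_normal]. *)
Definition outward_normal (j : side) : C :=
  match j with
  | side1 => RtoC 1
  | side2 => Cexp (- (2 * Ci * PI) / 3)%C
  | side3 => Cexp (2 * Ci * PI / 3)%C
  end.

Definition side_point (l : R) (j : side) (s : R) : C :=
  (((l / (2 * sqrt 3))%R + Ci * s) * outward_normal j)%C.

Definition partial_x (q : C -> R) (z : C) : R :=
  Derive (fun x : R => q (x, Im z)) (Re z).
Definition partial_y (q : C -> R) (z : C) : R :=
  Derive (fun y : R => q (Re z, y)) (Im z).

Definition C1_in (D : C -> Prop) (q : C -> R) : Prop :=
  forall z : C, D z ->
    ex_derive (fun x : R => q (x, Im z)) (Re z) /\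
    ex_derive (fun y : R => q (Re z, y)) (Im z) /\
    continuous (partial_x q) z /\ continuous (partial_y q) z.

Definition C2_in (D : C -> Prop) (q : C -> R) : Prop :=
  C1_in D q /\ C1_in D (partial_x q) /\ C1_in D (partial_y q).

(* q and its gradient on the open set D extend continuously to Dbar; the values
   of q off Dbar play no role. *)
Definition C1_up_to_boundary (D Dbar : C -> Prop) (q : C -> R) : Prop :=
  continuous_on Dbar q /\
  exists gx gy : C -> R,
    continuous_on Dbar gx /\ continuous_on Dbar gy /\
    forall z : C, D z -> gx z = partial_x q z /\ gy z = partial_y q z.

Definition C2_on_segment (a b : R) (f : R -> R) : Prop :=
  exists g : R -> R,
    (forall s : R, ex_derive g s /\ ex_derive (Derive g) s /\
                   continuous (Derive (Derive g)) s) /\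
    (forall s : R, a <= s <= b -> f s = g s).

(* For small t < 0 the point side_point + t * outward_normal is inside the triangle. *)
Definition is_normal_derivative (l : R) (q : C -> R) (j : side) (s v : R) : Prop :=
  filterlim
    (fun t : R =>
       (q (side_point l j s + t * outward_normal j)%C - q (side_point l j s)) / t)
    (at_left 0) (locally v).

Definition kfreq (lam : R) (k : C) : C := (k + lam / k)%C.

Definition efun (l lam : R) (k : C) : C := Cexp (kfreq lam k * (l / 2)%R)%C.

Definition Ffun (l lam : R) (f : side -> R -> R) (j : side) (k : C) : C :=
  @RInt C_R_CompleteNormedModule
    (fun s : R => Cexp (kfreq lam k * s)
                  * ((1 / 2 * Derive (f j) s)%R + lam / k * f j s))%C
    (- (l / 2)) (l / 2).

Definition Fcomb (l lam : R) (f : side -> R -> R) (k k' : C) : C :=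
  (Ffun l lam f side1 k'
   + Cpow (efun l lam (- k)) 2 * Ffun l lam f side2 k'
   + Cpow (efun l lam k) 2 * Ffun l lam f side3 k')%C.

Definition Xfun (l lam : R) (f : side -> R -> R) (k : C) : C :=
  ((Cpow (efun l lam (- k)) 2 * efun l lam (alphab * k) + efun l lam (- (alphab * k)))
     * Fcomb l lam f k k
   + 2 * Cpow (efun l lam k) 2 * Fcomb l lam f k (alpha * k)
   + 2 * efun l lam (- k) * Fcomb l lam f k (alphab * k))%C.

Definition Mden (l lam : R) (m : Z) (k : C) : C :=
  (CpowZ alphab m * efun l lam (alphab * k) - efun l lam (- (alphab * k)))%C.

(* For lam = 0 and m = 0 the equation k + lam / k = 0 has no root k <> 0 and the
   quotient defining M degenerates to 0 / 0. Its value is then the limit of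
   M(k_0) as lam -> 0, which is 0 for data continuous at the vertices. *)
Definition degenerate (lam : R) (m : Z) : Prop := lam = 0 /\ m = 0%Z.

Definition Mfun (l lam : R) (f : side -> R -> R) (m : Z) (k : C) : C :=
  if Req_EM_T lam 0 then
    if Z.eq_dec m 0 then RtoC 0
    else (2 * Ci * Xfun l lam f k / Mden l lam m k)%C
  else (2 * Ci * Xfun l lam f k / Mden l lam m k)%C.

Definition c1 (j : side) : C :=
  match j with side1 => RtoC 1 | side2 => alphab | side3 => alpha end.
Definition c2 (j : side) : C :=
  match j with side1 => RtoC 1 | side2 => alpha | side3 => alphab end.

Definition fourier_term (l lam : R) (f : side -> R -> R) (k : Z -> C)
    (j : side) (s : R) (n : Z) : C :=
  let M (m : Z) := Mfun l lam f m (k m) in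
  ((M (3 * n)%Z
    + c1 j * Cexp (2 * Ci * PI * s / (3 * l)) * M (3 * n - 1)%Z
    + c2 j * Cexp (4 * Ci * PI * s / (3 * l)) * M (3 * n - 2)%Z)
   * Cexp (- (2 * Ci * PI * IZR n * s) / l))%C.

(* Symmetric partial sums over -N <= n <= N, as usual for Fourier series. *)
Definition is_bilateral_sum (a : Z -> C) (S : C) : Prop :=
  filterlim
    (fun N : nat => sum_n (fun i : nat => a (Z.of_nat i - Z.of_nat N)%Z) (2 * N))
    eventually (locally S).

(* Main.v *)
(** Write [N_j(k)] for the integral of [exp (kfreq k * s)] against the Neumann data of side (j).
Green's formula against the plane waves [exp (- i k z + i (lam / k) zbar)] and
[exp (i k zbar - i (lam / k) z)], which solve the equation, gives two global relations between
the [N_j] and the [F_j] at k, alpha k and alphab k; replacing k by alpha k and alphab k gives six.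
When [e^2(k)] is a cube root of unity these involve the nine unknowns only through three
combinations, two of which can be eliminated at once; what remains is
[M(k_m) = N_1 + e^2(-k) N_2 + e^2(k) N_3] at [k = k_m].  Laying the three sides end to end on a
segment of length [3 l], this is the m-th Fourier coefficient of the Neumann data.

The Neumann data are merely continuous, so their Fourier series converges a priori only in the
sense of Cesaro (Fejer).  The closed formula for [M], evaluated at the larger root k of
[k + lam / k = 2 i m pi / (3 l)], shows that the coefficients are O(1/m) because the Dirichlet data
are C^2, and Hardy's Tauberian theorem upgrades Cesaro convergence to convergence. *)

Require Import Defs.
From Stdlib Require Import Reals ZArith Lra Lia Psatz FunctionalExtensionality.
From Coquelicot Require Import Coquelicot.
Open Scope R_scope.

(** * Pointwise convergence of Fourier series *)

(** Green's formula cannot be applied on the triangle itself, because the second derivatives of q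
    are controlled only in the open triangle while the boundary terms use the continuous extensions
    of q and its gradient. The formula is therefore obtained through triangles shrunk towards the
    centre. The combination of the Neumann transforms depends on k only through [kfreq], so both
    roots of the equation for k_m give the same M(k_m). The decay can thus be estimated at a root
    chosen for that purpose, whichever root the family [k] contains. At the smaller root lam / k is
    of the order of m and would cancel the gain 1/m of the integration by parts in F_j; at the
    larger root it stays bounded. Real data make the coefficients at m and - m conjugate, so the
    estimate is needed for positive m only. The glued Neumann data may jump at the vertices, which
    confines convergence to interior points of the sides. Grouping the frequencies 3n, 3n-1, 3n-2
    for |n| <= N covers -3N-2 <= m <= 3N, which is symmetric up to two terms; these vanish by the
    same decay. *)

Ltac eq_in_R := match goal with |- @eq _ ?x ?y => change (@eq R x y) end.

Lemma sum_n_Sn_R (u : nat -> R) (n : nat) : sum_n u (S n) = sum_n u n + u (S n).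
Proof. exact (sum_Sn u n). Qed.

(** Over a block of about [th * n] indices after n the sequence moves by at most about [th * K], so
    [S n] is close to the average over that block. This average is a difference of two partial sums
    divided by the block length, hence small because the Cesaro means are. *)
Lemma cesaro_tauberian_0 (S : nat -> R) (K : R) (N0 : nat) :
  (forall n, (N0 <= n)%nat -> Rabs (S (n + 1)%nat - S n) <= K / (INR n + 1)) ->
  is_lim_seq (fun n => sum_n S n / (INR n + 1)) 0 ->
  is_lim_seq S 0.
Proof.
  intros Hslow Hmean.
  assert (HK : 0 <= K).
  { pose proof (Hslow N0 (le_n _)) as H. pose proof (Rabs_pos (S (N0 + 1)%nat - S N0)).
    pose proof (pos_INR N0).
    destruct (Rle_or_lt 0 K) as [|HK]; auto.
    assert (K / (INR N0 + 1) < 0); [|lra].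
    apply Rmult_neg_pos; auto. apply Rinv_0_lt_compat; lra. }
  assert (Hdrift : forall n i, (N0 <= n)%nat ->
            Rabs (S (n + i)%nat - S n) <= INR i * (K / (INR n + 1))).
  { intros n i Hn. pose proof (pos_INR n).
    assert (Hpos : 0 <= K / (INR n + 1)) by (apply Rdiv_le_0_compat; lra).
    induction i as [|i IH].
    - rewrite Nat.add_0_r, Rminus_diag, Rabs_R0. simpl. lra.
    - replace (S (n + Datatypes.S i)%nat - S n)
        with ((S (n + i + 1)%nat - S (n + i)%nat) + (S (n + i)%nat - S n)).
      2:{ replace (n + Datatypes.S i)%nat with (n + i + 1)%nat by lia. ring. }
      eapply Rle_trans; [apply Rabs_triang|].
      rewrite S_INR.
      assert (Rabs (S (n + i + 1)%nat - S (n + i)%nat) <= K / (INR n + 1)); [|lra].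
      eapply Rle_trans; [apply Hslow; lia|].
      apply Rmult_le_compat_l; auto. rewrite plus_INR. pose proof (pos_INR i).
      apply Rinv_le_contravar; lra. }
  assert (Hblock : forall n p, (N0 <= n)%nat ->
     Rabs (sum_n S (n + p) - sum_n S n - INR p * S n)
       <= INR p * (INR p * (K / (INR n + 1)))).
  { intros n p Hn. pose proof (pos_INR n).
    assert (Hpos : 0 <= K / (INR n + 1)) by (apply Rdiv_le_0_compat; lra).
    induction p as [|p IH].
    - rewrite Nat.add_0_r. simpl.
      replace (_ - _ - _) with 0 by ring. rewrite Rabs_R0. lra.
    - rewrite Nat.add_succ_r, sum_n_Sn_R.
      replace (_ - _ - _) with ((sum_n S (n + p) - sum_n S n - INR p * S n)
                                + (S (n + Datatypes.S p)%nat - S n)).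
      2:{ rewrite S_INR, Nat.add_succ_r. ring. }
      eapply Rle_trans; [apply Rabs_triang|].
      pose proof (Hdrift n (Datatypes.S p) Hn) as Hd.
      rewrite S_INR in *. pose proof (pos_INR p). nra. }
  apply is_lim_seq_spec. intros eps.
  apply is_lim_seq_spec in Hmean.
  (* With a block length p between [th * (n + 1)] and twice that, the drift [p * K / (n + 1)] is at
     most [2 * th * K <= eps / 2]. The choice of [de] below makes the two partial sums, divided by
     p, contribute at most [de * (2 / th + 1) = eps / 4]. *)
  set (th := eps / (4 * K + 4)).
  pose proof (cond_pos eps) as Heps.
  assert (Hth : 0 < th) by (apply Rdiv_lt_0_compat; lra).
  set (de := (eps / 4) / (2 / th + 1)).
  assert (H2th : 0 < 2 / th) by (apply Rdiv_lt_0_compat; lra).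
  assert (Hde : 0 < de) by (apply Rdiv_lt_0_compat; lra).
  destruct (Hmean (mkposreal de Hde)) as [N1 HN1]. simpl in HN1.
  destruct (nfloor_ex (/ th)) as [N2 [_ HN2]].
  { left. now apply Rinv_0_lt_compat. }
  exists (N0 + N1 + N2 + 1)%nat. intros n Hn. rewrite Rminus_0_r.
  assert (Hn1 : / th < INR n + 1).
  { eapply Rlt_le_trans; [exact HN2|]. assert (INR N2 <= INR n) by (apply le_INR; lia). lra. }
  pose proof (pos_INR n) as Hn0.
  assert (H1 : 1 < th * (INR n + 1)).
  { apply (Rmult_lt_compat_l th) in Hn1; auto. rewrite Rinv_r in Hn1; lra. }
  (* Rounding up adds at most 1, and [1 < th * (n + 1)], so p is at most twice the intended
     length. *)
  destruct (nfloor_ex (th * (INR n + 1))) as [p0 [Hp1 Hp2]]; [lra|].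
  set (p := Datatypes.S p0).
  assert (Hpl : th * (INR n + 1) <= INR p) by (unfold p; rewrite S_INR; lra).
  assert (Hpu : INR p <= 2 * (th * (INR n + 1))) by (unfold p; rewrite S_INR; lra).
  assert (HT : forall i, (n <= i)%nat -> Rabs (sum_n S i) <= de * (INR i + 1)).
  { intros i Hi. pose proof (pos_INR i).
    assert (Hm := HN1 i ltac:(lia)). rewrite Rminus_0_r in Hm.
    unfold Rdiv in Hm. rewrite Rabs_mult, (Rabs_pos_eq (/ _)) in Hm
      by (left; apply Rinv_0_lt_compat; lra).
    apply (Rmult_lt_compat_r (INR i + 1)) in Hm; [|lra].
    rewrite Rmult_assoc, Rinv_l in Hm; lra. }
  pose proof (HT n ltac:(lia)) as HTn.
  pose proof (HT (n + p)%nat ltac:(lia)) as HTp. rewrite plus_INR in HTp.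
  pose proof (Hblock n p ltac:(lia)) as HB.
  assert (Hpp : 0 < INR p) by lra.
  assert (HpS : INR p * Rabs (S n) <=
     de * (2 * (INR n + 1) + INR p) + INR p * (INR p * (K / (INR n + 1)))).
  { rewrite <- (Rabs_pos_eq (INR p)) at 1 by lra. rewrite <- Rabs_mult.
    replace (INR p * S n) with (sum_n S (n + p) + (- sum_n S n
       + - (sum_n S (n + p) - sum_n S n - INR p * S n))) by ring.
    eapply Rle_trans; [apply Rabs_triang|].
    eapply Rle_trans; [apply Rplus_le_compat_l, Rabs_triang|].
    rewrite !Rabs_Ropp. lra. }
  assert (Hn2 : INR n + 1 <= INR p / th).
  { apply Rle_div_r; auto. lra. }
  assert (Hdiv : INR p * (K / (INR n + 1)) <= INR p * (eps / 2 / INR p)).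
  { apply Rmult_le_compat_l; [lra|].
    apply Rle_div_l; [lra|].
    assert (HKth : 2 * th * K <= eps / 2).
    { unfold th. replace (2 * (eps / (4 * K + 4)) * K) with (eps / 2 * (K / (K + 1))) by (field; lra).
      assert (K / (K + 1) <= 1) by (apply Rle_div_l; lra). nra. }
    assert (eps / 2 / INR p * (INR n + 1) = eps / 2 * ((INR n + 1) / INR p)) by (field; lra).
    assert (/ (2 * th) <= (INR n + 1) / INR p).
    { apply Rle_div_r; auto. apply (Rmult_le_reg_l (2 * th)); [lra|].
      rewrite <- Rmult_assoc, Rinv_r; lra. }
    assert (K <= eps / 2 * / (2 * th)).
    { apply (Rmult_le_reg_r (2 * th)); [lra|]. rewrite Rmult_assoc, Rinv_l; lra. }
    nra. }
  replace (INR p * (eps / 2 / INR p)) with (eps / 2) in Hdiv by (field; lra).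
  assert (Hde2 : de * (2 / th + 1) = eps / 4) by (unfold de; field; split; lra).
  assert (de * (2 * (INR n + 1) + INR p) <= INR p * (eps / 4)).
  { rewrite <- Hde2.
    replace (INR p * (de * (2 / th + 1))) with (de * (2 * (INR p / th) + INR p)) by (field; lra).
    apply Rmult_le_compat_l; lra. }
  apply (Rmult_lt_reg_l (INR p)); auto. nra.
Qed.

Lemma sum_n_minus_const (S : nat -> R) (L : R) (n : nat) :
  sum_n (fun i => S i - L) n = sum_n S n - (INR n + 1) * L.
Proof.
  induction n as [|n IH].
  - rewrite !sum_O. simpl. ring.
  - rewrite !sum_n_Sn_R, IH, S_INR. eq_in_R. ring.
Qed.

Lemma cesaro_tauberian (S : nat -> R) (K L : R) (N0 : nat) :
  (forall n, (N0 <= n)%nat -> Rabs (S (n + 1)%nat - S n) <= K / (INR n + 1)) ->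
  is_lim_seq (fun n => sum_n S n / (INR n + 1)) L ->
  is_lim_seq S L.
Proof.
  intros Hslow Hmean.
  assert (H : is_lim_seq (fun n => S n - L) 0).
  { apply (cesaro_tauberian_0 _ K N0).
    - intros n Hn. replace (_ - _ - _) with (S (n + 1)%nat - S n) by ring. auto.
    - apply is_lim_seq_ext with (fun n => sum_n S n / (INR n + 1) - L).
      + intros n. rewrite sum_n_minus_const. pose proof (pos_INR n). field. lra.
      + replace (Finite 0) with (Rbar_plus L (Rbar_opp L)) by (simpl; apply f_equal; ring).
        apply is_lim_seq_minus'; auto. apply is_lim_seq_const. }
  apply is_lim_seq_ext with (fun n => (S n - L) + L); [intros; ring|].
  replace (Finite L) with (Rbar_plus 0 L) by (simpl; apply f_equal; ring).
  apply is_lim_seq_plus'; auto. apply is_lim_seq_const.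
Qed.

(** * Dirichlet and Fejer kernels *)

Fixpoint dirichlet_kernel (n : nat) (x : R) : R :=
  match n with
  | O => 1
  | S p => dirichlet_kernel p x + 2 * cos (INR (S p) * x)
  end.

Lemma dirichlet_kernel_sin (n : nat) (x : R) :
  dirichlet_kernel n x * sin (x / 2) = sin ((INR n + 1 / 2) * x).
Proof.
  induction n as [|n IH].
  - simpl. replace ((0 + 1 / 2) * x) with (x / 2) by field. ring.
  - cbn [dirichlet_kernel]. rewrite Rmult_plus_distr_r, IH, S_INR.
    replace ((INR n + 1 / 2) * x) with ((INR n + 1) * x - x / 2) by field.
    replace ((INR n + 1 + 1 / 2) * x) with ((INR n + 1) * x + x / 2) by field.
    rewrite sin_minus, sin_plus. ring.
Qed.

(** The Fejer kernel in product form. Multiplied by the squared sine the sum telescopes, since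
    sin^2(a + x/2) - sin^2(a) = sin(2a + x/2) sin(x/2). *)
Lemma sum_dirichlet_kernel_sin (n : nat) (x : R) :
  sum_n (fun i => dirichlet_kernel i x) n * (sin (x / 2))² = (sin ((INR n + 1) * x / 2))².
Proof.
  induction n as [|n IH].
  - rewrite sum_O. simpl. replace ((0 + 1) * x / 2) with (x / 2) by field. ring.
  - rewrite sum_n_Sn_R, Rmult_plus_distr_r, IH. unfold Rsqr at 2.
    rewrite <- Rmult_assoc, dirichlet_kernel_sin, S_INR.
    set (a := (INR n + 1) * x / 2).
    replace ((INR n + 1 + 1 / 2) * x) with (2 * a + x / 2) by (unfold a; field).
    replace ((INR n + 1 + 1) * x / 2) with (a + x / 2) by (unfold a; field).
    rewrite !sin_plus, sin_2a, cos_2a. unfold Rsqr.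
    pose proof (sin2_cos2 a) as Ha. pose proof (sin2_cos2 (x / 2)) as Hb. unfold Rsqr in *.
    replace (cos a * cos a) with (1 - sin a * sin a) by lra.
    replace ((sin a * cos (x / 2) + cos a * sin (x / 2)) * (sin a * cos (x / 2) + cos a * sin (x / 2)))
      with (sin a * sin a * (cos (x / 2) * cos (x / 2)) + 2 * sin a * cos a * cos (x / 2) * sin (x / 2)
        + cos a * cos a * (sin (x / 2) * sin (x / 2))) by ring.
    replace (cos (x / 2) * cos (x / 2)) with (1 - sin (x / 2) * sin (x / 2)) by lra.
    replace (cos a * cos a) with (1 - sin a * sin a) by lra. ring.
Qed.

(** Covers the points where the product formulas reduce to 0 = 0 and say nothing about the
    kernel. *)
Lemma dirichlet_kernel_sin0 (n : nat) (x : R) :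
  sin (x / 2) = 0 -> dirichlet_kernel n x = 2 * INR n + 1.
Proof.
  intros H.
  assert (Hc : cos x = 1).
  { replace x with (2 * (x / 2)) by field. rewrite cos_2a_sin, H. ring. }
  assert (Hs : sin x = 0).
  { replace x with (2 * (x / 2)) by field. rewrite sin_2a, H. ring. }
  assert (Hm : forall m, cos (INR m * x) = 1).
  { induction m as [|m IH]; [simpl; rewrite Rmult_0_l; apply cos_0|].
    rewrite S_INR. replace ((INR m + 1) * x) with (INR m * x + x) by ring.
    rewrite cos_plus, IH, Hc, Hs. ring. }
  induction n as [|n IH]; [simpl; ring|].
  cbn [dirichlet_kernel]. rewrite IH, Hm, S_INR. ring.
Qed.

Lemma sum_dirichlet_kernel_ge0 (n : nat) (x : R) :
  0 <= sum_n (fun i => dirichlet_kernel i x) n.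
Proof.
  destruct (Req_dec (sin (x / 2)) 0) as [H|H].
  - induction n as [|n IH].
    + rewrite sum_O. simpl. lra.
    + rewrite sum_n_Sn_R, dirichlet_kernel_sin0 by auto. pose proof (pos_INR (S n)). lra.
  - pose proof (sum_dirichlet_kernel_sin n x) as E.
    assert (0 < (sin (x / 2))²) by (apply Rsqr_pos_lt; auto).
    pose proof (Rle_0_sqr (sin ((INR n + 1) * x / 2))). nra.
Qed.

Lemma continuous_dirichlet_kernel (n : nat) (om c s : R) :
  continuous (fun t => dirichlet_kernel n (om * (t - c))) s.
Proof.
  induction n as [|n IH].
  - apply continuous_const.
  - cbn [dirichlet_kernel].
    apply (continuous_plus (fun t => dirichlet_kernel n (om * (t - c)))); auto.
    apply (ex_derive_continuous (fun t => 2 * cos (INR (S n) * (om * (t - c))))).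
    auto_derive. auto.
Qed.

Lemma continuous_sum_dirichlet_kernel (n : nat) (om c s : R) :
  continuous (fun t => sum_n (fun i => dirichlet_kernel i (om * (t - c))) n) s.
Proof.
  induction n as [|n IH].
  - apply continuous_ext with (fun t => dirichlet_kernel 0 (om * (t - c))).
    { intros t. now rewrite sum_O. }
    apply continuous_dirichlet_kernel.
  - apply continuous_ext with
      (fun t => sum_n (fun i => dirichlet_kernel i (om * (t - c))) n
                + dirichlet_kernel (S n) (om * (t - c))).
    { intros t. now rewrite sum_n_Sn_R. }
    apply (continuous_plus (fun t => sum_n (fun i => dirichlet_kernel i (om * (t - c))) n)); auto.
    apply continuous_dirichlet_kernel.
Qed.

(** Every cosine integrates to 0 over a full period, wherever the period starts and wherever the
    kernel is centred. *)
Lemma is_RInt_dirichlet_kernel (n : nat) (a T c : R) : 0 < T ->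
  is_RInt (fun s => dirichlet_kernel n (2 * PI / T * (s - c))) a (a + T) T.
Proof.
  intros HT. induction n as [|n IH].
  - cbn [dirichlet_kernel]. replace T with (scal (a + T - a) 1) at 2.
    2:{ unfold scal; simpl; unfold mult; simpl; ring. }
    apply (is_RInt_const a (a + T) 1).
  - cbn [dirichlet_kernel].
    replace (is_RInt _ _ _ T) with (is_RInt (fun s => plus (dirichlet_kernel n (2 * PI / T * (s - c)))
        (2 * cos (INR (S n) * (2 * PI / T * (s - c))))) a (a + T) (plus T 0)).
    2:{ f_equal. unfold plus; simpl; ring. }
    apply (is_RInt_plus (V := R_NormedModule) (fun s => dirichlet_kernel n (2 * PI / T * (s - c)))); auto.
    set (m := INR (S n) * (2 * PI / T)).
    pose proof PI_RGT_0 as Hpi.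
    assert (Hm : 0 < m).
    { apply Rmult_lt_0_compat; [apply lt_0_INR; lia|apply Rdiv_lt_0_compat; lra]. }
    set (prim := fun s => 2 * sin (INR (S n) * (2 * PI / T * (s - c))) / m).
    replace 0 with (minus (prim (a + T)) (prim a)).
    + apply (is_RInt_derive prim).
      * intros x _. unfold prim. auto_derive; auto.
        change (match n with 0%nat => 1 | S _ => INR n + 1 end) with (INR (S n)).
        unfold m. change (x + - c) with (x - c).
        assert (HN : 0 < INR (S n)) by (apply lt_0_INR; lia).
        generalize (cos (INR (S n) * (2 * PI / T * (x - c)))). revert HN.
        generalize (INR (S n)). intros N HN y. field. repeat split; lra.
      * intros x _.
        apply (ex_derive_continuous (fun t => 2 * cos (INR (S n) * (2 * PI / T * (t - c))))).
        auto_derive. auto.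
    + unfold prim, minus, plus, opp; simpl (Hierarchy.AbelianMonoid.sort _).
      cbn -[INR].
      replace (INR (S n) * (2 * PI / T * (a + T - c)))
        with (INR (S n) * (2 * PI / T * (a - c)) + 2 * INR (S n) * PI) by (field; lra).
      rewrite sin_period. ring.
Qed.

Lemma is_RInt_sum_dirichlet_kernel (n : nat) (a T c : R) : 0 < T ->
  is_RInt (fun s => sum_n (fun i => dirichlet_kernel i (2 * PI / T * (s - c))) n)
    a (a + T) ((INR n + 1) * T).
Proof.
  intros HT. induction n as [|n IH].
  - apply is_RInt_ext with (fun s => dirichlet_kernel 0 (2 * PI / T * (s - c))).
    { intros x _. now rewrite sum_O. }
    simpl INR. replace ((0 + 1) * T) with T by ring.
    now apply is_RInt_dirichlet_kernel.
  - apply is_RInt_ext with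
      (fun s => plus (sum_n (fun i => dirichlet_kernel i (2 * PI / T * (s - c))) n)
                 (dirichlet_kernel (S n) (2 * PI / T * (s - c)))).
    { intros x _. now rewrite sum_n_Sn_R. }
    replace ((INR (S n) + 1) * T) with (plus ((INR n + 1) * T) T).
    2:{ unfold plus; simpl (Hierarchy.AbelianMonoid.sort _). rewrite S_INR. simpl. ring. }
    apply (is_RInt_plus (V := R_NormedModule)); auto. now apply is_RInt_dirichlet_kernel.
Qed.

Section Fejer.

Variables (h : R -> R) (a T c B : R).
Hypothesis HT : 0 < T.
(** Integrability is asked against continuous test functions, in place of continuity of h, so that
    the section applies to the glued data with their jumps. *)
Hypothesis Hint : forall phi : R -> R, (forall s, continuous phi s) ->
  ex_RInt (fun s => h s * phi s) a (a + T).
Hypothesis HB : forall s, a <= s <= a + T -> Rabs (h s) <= B.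
Hypothesis Hc : a < c < a + T.
Hypothesis Hcont : continuous h c.

Let om := 2 * PI / T.
Let partial_sum (n : nat) : R := RInt (fun s => h s * dirichlet_kernel n (om * (s - c))) a (a + T).

Lemma sum_partial_sum (n : nat) :
  sum_n partial_sum n =
  RInt (fun s => h s * sum_n (fun i => dirichlet_kernel i (om * (s - c))) n) a (a + T) :> R.
Proof.
  induction n as [|n IH].
  - rewrite sum_O. unfold partial_sum. apply RInt_ext. intros x _. now rewrite sum_O.
  - rewrite sum_n_Sn_R, IH. unfold partial_sum.
    assert (E := RInt_plus
     (fun s => h s * sum_n (fun i => dirichlet_kernel i (om * (s - c))) n)
     (fun s => h s * dirichlet_kernel (S n) (om * (s - c))) a (a + T)
     (Hint _ (continuous_sum_dirichlet_kernel n om c))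
     (Hint _ (continuous_dirichlet_kernel (S n) om c))).
    unfold plus in E; simpl (Hierarchy.AbelianMonoid.sort _) in E.
    etransitivity; [symmetry; exact E|].
    apply RInt_ext. intros x _. rewrite sum_n_Sn_R. simpl. ring.
Qed.

(** The summed kernel is nonnegative with total mass [(n + 1) * T], and away from c it is bounded
    independently of n. After division by n + 1 only the values of h near c survive, and continuity
    at c concludes. *)
Lemma fejer : is_lim_seq (fun n => sum_n partial_sum n / (INR n + 1)) (T * h c).
Proof.
  assert (HB0 : 0 <= B).
  { eapply Rle_trans; [apply Rabs_pos|apply (HB c); lra]. }
  apply is_lim_seq_spec. intros eps.
  pose proof (cond_pos eps) as Heps.
  set (e1 := eps / (2 * T)).
  assert (He1 : 0 < e1) by (apply Rdiv_lt_0_compat; lra).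
  assert (Hloc : locally c (fun s => Rabs (h s - h c) < e1)).
  { apply (Hcont (fun y => Rabs (y - h c) < e1)). exists (mkposreal _ He1). intros y Hy; exact Hy. }
  destruct Hloc as [d0 Hd0].
  (* With [de] smaller than the distances from c to both ends, every s of the period satisfies
     [Rabs (s - c) <= T - de]. So far points stay away from the next copy of c as well, and the sine
     is bounded below by its value at [PI * de / T]. *)
  set (de := Rmin d0 (Rmin (c - a) (a + T - c)) / 2).
  assert (Hmin : 0 < Rmin d0 (Rmin (c - a) (a + T - c))).
  { apply Rmin_pos; [apply cond_pos|apply Rmin_pos; lra]. }
  assert (Hde0 : de < d0 /\ de < c - a /\ de < a + T - c /\ 0 < de).
  { unfold de. pose proof (Rmin_l d0 (Rmin (c - a) (a + T - c))).
    pose proof (Rmin_r d0 (Rmin (c - a) (a + T - c))).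
    pose proof (Rmin_l (c - a) (a + T - c)). pose proof (Rmin_r (c - a) (a + T - c)). lra. }
  clearbody de. clear Hmin. destruct Hde0 as (Hd1 & Hd2 & Hd3 & Hd4).
  pose proof PI_RGT_0 as Hpi.
  set (m := (sin (PI * de / T))²).
  assert (Hpd : 0 < PI * de / T < PI / 2).
  { split; [apply Rdiv_lt_0_compat; nra|]. apply Rlt_div_l; auto. nra. }
  assert (Hsd : 0 < sin (PI * de / T)) by (apply sin_gt_0; lra).
  assert (Hm : 0 < m) by (apply Rsqr_pos_lt; lra).
  assert (Hfar : forall s, a <= s <= a + T -> de <= Rabs (s - c) ->
            m <= (sin (om * (s - c) / 2))²).
  { intros s Hs Hsc.
    assert (Hup : Rabs (s - c) <= T - de).
    { unfold Rabs. destruct (Rcase_abs _); lra. }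
    assert (E : (sin (om * (s - c) / 2))² = (sin (PI * Rabs (s - c) / T))²).
    { unfold om. replace (2 * PI / T * (s - c) / 2) with (PI * (s - c) / T) by (field; lra).
      unfold Rabs. destruct (Rcase_abs _) as [Hn|Hn]; auto.
      replace (PI * - (s - c) / T) with (- (PI * (s - c) / T)) by (field; lra).
      rewrite sin_neg. unfold Rsqr. ring. }
    rewrite E. unfold m. apply Rsqr_incr_1; [|lra|].
    - set (th := PI * Rabs (s - c) / T).
      assert (Hth : PI * de / T <= th <= PI - PI * de / T).
      { unfold th. split.
        - unfold Rdiv. apply Rmult_le_compat_r; [left; apply Rinv_0_lt_compat; auto|].
          apply Rmult_le_compat_l; lra.
        - replace (PI - PI * de / T) with (PI * (T - de) / T) by (field; lra).
          unfold Rdiv. apply Rmult_le_compat_r; [left; apply Rinv_0_lt_compat; auto|].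
          apply Rmult_le_compat_l; lra. }
      destruct (Rle_or_lt th (PI / 2)).
      + apply sin_incr_1; lra.
      + rewrite <- (sin_PI_x th).
        apply sin_incr_1; lra.
    - set (th := PI * Rabs (s - c) / T).
      assert (Hth : 0 <= th <= PI).
      { unfold th. pose proof (Rabs_pos (s - c)). split.
        - apply Rdiv_le_0_compat; nra.
        - apply Rle_div_l; auto. nra. }
      apply sin_ge_0; lra. }
  set (FK := fun (n : nat) (s : R) => (sum_n (fun i => dirichlet_kernel i (om * (s - c))) n : R)).
  assert (HFK0 : forall n s, 0 <= FK n s) by (intros; apply sum_dirichlet_kernel_ge0).
  (* The first summand serves the points near c, the second the far ones, where the kernel is at
     most [/ m] and the oscillation of h at most [2 * B]. Since both are nonnegative, one bound
     holds everywhere and the integral is not split. *)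
  assert (Hpt : forall n s, a <= s <= a + T ->
     Rabs ((h s - h c) * FK n s) <= e1 * FK n s + 2 * B / m).
  { intros n s Hs. rewrite Rabs_mult, (Rabs_pos_eq (FK n s)) by auto.
    assert (H2B : 0 <= 2 * B / m) by (apply Rdiv_le_0_compat; lra).
    destruct (Rlt_or_le (Rabs (s - c)) d0) as [Hnear|Hf].
    - assert (Rabs (h s - h c) < e1) by (apply Hd0; exact Hnear).
      pose proof (HFK0 n s). nra.
    - assert (Hm' := Hfar s Hs ltac:(lra)).
      assert (HF : FK n s <= / m).
      { pose proof (sum_dirichlet_kernel_sin n (om * (s - c))) as E. fold (FK n s) in E.
        assert (Hs1 : (sin ((INR n + 1) * (om * (s - c)) / 2))² <= 1).
        { pose proof (sin2_cos2 ((INR n + 1) * (om * (s - c)) / 2)).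
          pose proof (Rle_0_sqr (cos ((INR n + 1) * (om * (s - c)) / 2))). lra. }
        apply (Rmult_le_reg_r m); auto. rewrite Rinv_l by lra.
        pose proof (HFK0 n s). nra. }
      assert (Rabs (h s - h c) <= 2 * B).
      { unfold Rminus. eapply Rle_trans; [apply Rabs_triang|]. rewrite Rabs_Ropp.
        pose proof (HB s Hs). pose proof (HB c ltac:(lra)). lra. }
      pose proof (Rabs_pos (h s - h c)). pose proof (HFK0 n s).
      assert (Rabs (h s - h c) * FK n s <= 2 * B * / m) by (apply Rmult_le_compat; auto).
      unfold Rdiv. nra. }
  destruct (nfloor_ex (2 * B / m * T / (eps / 2))) as [N [_ HN]].
  { apply Rdiv_le_0_compat; [|lra]. apply Rmult_le_pos; [apply Rdiv_le_0_compat; lra|lra]. }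
  exists N. intros n Hn.
  rewrite sum_partial_sum. fold (FK n).
  assert (HiF : is_RInt (FK n) a (a + T) ((INR n + 1) * T)).
  { apply is_RInt_sum_dirichlet_kernel; auto. }
  assert (HihF := RInt_correct _ _ _ (Hint _ (continuous_sum_dirichlet_kernel n om c))).
  set (I := RInt _ _ _) in *. change (RInt _ _ _) with I.
  assert (HiD : is_RInt (fun s => (h s - h c) * FK n s) a (a + T) (I - h c * ((INR n + 1) * T))).
  { apply is_RInt_ext with (fun s => minus (h s * FK n s) (scal (h c) (FK n s))).
    { intros s _. unfold minus, plus, opp, scal; simpl. unfold mult; simpl. ring. }
    apply (is_RInt_minus (V := R_NormedModule) (fun s => h s * FK n s) (fun s => scal (h c) (FK n s))); auto.
    apply (is_RInt_scal (V := R_NormedModule) (FK n)). exact HiF. }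
  assert (HiU : is_RInt (fun s => e1 * FK n s + 2 * B / m) a (a + T)
                 (e1 * ((INR n + 1) * T) + T * (2 * B / m))).
  { apply (is_RInt_plus (V := R_NormedModule) (fun s => scal e1 (FK n s)) (fun _ => 2 * B / m)).
    - apply (is_RInt_scal (V := R_NormedModule) (FK n)). exact HiF.
    - replace (T * (2 * B / m)) with (scal (a + T - a) (2 * B / m)).
      apply (is_RInt_const (V := R_NormedModule) a (a + T)).
      unfold scal; simpl; unfold mult; simpl; ring. }
  assert (Hub : I - h c * ((INR n + 1) * T) <= e1 * ((INR n + 1) * T) + T * (2 * B / m)).
  { apply (is_RInt_le _ _ a (a + T) _ _ ltac:(lra) HiD HiU).
    intros s Hs. eapply Rle_trans; [apply Rle_abs|apply Hpt; lra]. }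
  assert (Hlb : - (e1 * ((INR n + 1) * T) + T * (2 * B / m)) <= I - h c * ((INR n + 1) * T)).
  { apply (is_RInt_le (fun s => - (e1 * FK n s + 2 * B / m)) _ a (a + T) _ _ ltac:(lra)
             (is_RInt_opp (V := R_NormedModule) _ _ _ _ HiU) HiD).
    intros s Hs. pose proof (Hpt n s ltac:(lra)) as H.
    apply Rabs_le_between in H. lra. }
  pose proof (pos_INR n) as Hn0.
  assert (HNn : 2 * B / m * T / (eps / 2) < INR n + 1).
  { eapply Rlt_le_trans; [exact HN|]. apply Rplus_le_compat_r, le_INR. lia. }
  apply Rlt_div_l in HNn; [|lra].
  assert (Ee1 : e1 * T = eps / 2) by (unfold e1; field; lra).
  replace (I / (INR n + 1) - T * h c) with ((I - h c * ((INR n + 1) * T)) / (INR n + 1))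
    by (field; lra).
  unfold Rdiv at 1. rewrite Rabs_mult, (Rabs_pos_eq (/ _)) by (left; apply Rinv_0_lt_compat; lra).
  apply Rlt_div_l; [lra|].
  apply Rle_lt_trans with (e1 * ((INR n + 1) * T) + T * (2 * B / m)).
  - apply Rabs_le. lra.
  - nra.
Qed.

Lemma partial_sum_step (n : nat) :
  partial_sum (n + 1) - partial_sum n =
  2 * RInt (fun s => h s * cos (INR (S n) * (om * (s - c)))) a (a + T).
Proof.
  rewrite Nat.add_1_r.
  assert (Hcos : forall s, continuous (fun t => cos (INR (S n) * (om * (t - c)))) s).
  { intros s. apply (ex_derive_continuous (fun t => cos (INR (S n) * (om * (t - c))))).
    auto_derive. auto. }
  assert (E : partial_sum (S n) = partial_sum n +
     2 * RInt (fun s => h s * cos (INR (S n) * (om * (s - c)))) a (a + T)); [|lra].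
  apply is_RInt_unique.
  apply is_RInt_ext with
    (fun s => plus (h s * dirichlet_kernel n (om * (s - c)))
                (scal 2 (h s * cos (INR (S n) * (om * (s - c)))))).
  { intros s _. cbn [dirichlet_kernel]. unfold plus, scal; simpl (Hierarchy.AbelianMonoid.sort _).
    cbn -[INR]. unfold mult; cbn -[INR]. ring. }
  apply (is_RInt_plus (V := R_NormedModule) (fun s => h s * dirichlet_kernel n (om * (s - c)))).
  - apply (RInt_correct (fun s => h s * dirichlet_kernel n (om * (s - c)))).
    apply Hint, continuous_dirichlet_kernel.
  - apply (is_RInt_scal (V := R_NormedModule) (fun s => h s * cos (INR (S n) * (om * (s - c))))).
    apply (RInt_correct (fun s => h s * cos (INR (S n) * (om * (s - c))))).
    now apply Hint.
Qed.

(** Consecutive partial sums differ by twice a cosine coefficient centred at c, so O(1/n)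
    coefficients are exactly the Tauberian hypothesis for the Fejer means. *)
Lemma fourier_series_converges (K : R) (N0 : nat) :
  (forall n, (N0 <= n)%nat ->
     Rabs (RInt (fun s => h s * cos (INR (S n) * (om * (s - c)))) a (a + T)) <= K / INR (S n)) ->
  is_lim_seq partial_sum (T * h c).
Proof.
  intros Hdecay. apply (cesaro_tauberian _ (2 * K) _ N0).
  - intros n Hn. rewrite partial_sum_step, Rabs_mult, (Rabs_pos_eq 2) by lra.
    pose proof (Hdecay n Hn). rewrite <- S_INR. unfold Rdiv in *. nra.
  - apply fejer.
Qed.

End Fejer.

(** * Circulation of closed forms *)

Lemma locally_interval (a b x : R) : a < x < b -> locally x (fun t => a < t < b).
Proof.
  intros H. apply (open_and (fun t => a < t) (fun t => t < b)); [apply open_gt|apply open_lt|exact H].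
Qed.

Lemma continuous_C_pair {U : UniformSpace} (f g : U -> R) (x : U) :
  continuous f x -> continuous g x -> continuous (fun t => (f t, g t) : C) x.
Proof.
  intros Hf Hg.
  apply (continuous_comp_2 f g (fun u v => (u, v) : C) x Hf Hg).
  apply continuous_ext with (fun z => z).
  - intros [u v]. reflexivity.
  - apply continuous_id.
Qed.

(** As [phi] takes all its values in D, the restriction to D hidden in [continuous_on] is always
    satisfied, and plain continuity results. *)
Lemma continuous_on_comp {U V W : UniformSpace} (D : V -> Prop) (phi : U -> V) (f : V -> W) (x : U) :
  (forall y, D (phi y)) -> continuous phi x -> continuous_on D f ->
  continuous (fun y => f (phi y)) x.
Proof.
  intros HD Hphi Hf P HP.
  specialize (Hf (phi x) (HD x) P HP). unfold filtermap, within in *.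
  apply Hphi in Hf. unfold filtermap in Hf.
  revert Hf. apply filter_imp. intros y Hy. apply Hy, HD.
Qed.

(* Composing with [clamp] makes a function continuous on a segment continuous on the whole line. *)
Definition clamp (a b x : R) : R := Rmax a (Rmin x b).

Lemma clamp_range (a b x : R) : a <= b -> a <= clamp a b x <= b.
Proof.
  intros H. unfold clamp. split; [apply Rmax_l|].
  apply Rmax_lub; auto. apply Rmin_r.
Qed.

Lemma clamp_id (a b x : R) : a <= x <= b -> clamp a b x = x.
Proof.
  intros H. unfold clamp. rewrite Rmin_left by lra. apply Rmax_right. lra.
Qed.

Lemma continuous_clamp (a b x : R) : continuous (clamp a b) x.
Proof.
  apply filterlim_locally. intros eps. exists eps. intros y Hy.
  change (Rabs (y - x) < eps) in Hy.
  change (Rabs (clamp a b y - clamp a b x) < eps).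
  apply Rabs_def2 in Hy. apply Rabs_def1; unfold clamp, Rmax, Rmin;
    repeat destruct (Rle_dec _ _); lra.
Qed.

(** Continuity in the parameter is uniform in s, because s ranges over a compact interval. *)
Lemma continuous_RInt_param (f : R -> R -> R) (a b : R) : a <= b ->
  (forall r s, continuous (fun z : R * R => f (fst z) (snd z)) (r, s)) ->
  forall r, continuous (fun r => RInt (fun s => f r s) a b) r.
Proof.
  intros Hab Hf r0.
  assert (Hslice : forall r s, continuous (fun s => f r s) s).
  { intros r s. apply (continuous_comp_2 (fun _ => r) (fun s => s) f s).
    - apply continuous_const.
    - apply continuous_id.
    - apply Hf. }
  assert (Hex : forall r, ex_RInt (fun s => f r s) a b).
  { intros r. apply (ex_RInt_continuous (V := R_CompleteNormedModule)). intros; apply Hslice. }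
  apply filterlim_locally. intros eps.
  (* The added 1 keeps the quotient meaningful for a = b and makes the final estimate strict. *)
  assert (He : 0 < eps / (b - a + 1)) by (apply Rdiv_lt_0_compat; [apply cond_pos|lra]).
  destruct (uniform_continuity_2d_1d (fun s r => f r s) a b r0) with (eps := mkposreal _ He)
    as [de Hde].
  { intros s _. apply continuity_2d_pt_filterlim.
    apply (continuous_comp_2 snd fst f (s, r0)).
    - apply continuous_snd.
    - apply continuous_fst.
    - apply Hf. }
  exists de. intros r Hr. change (Rabs (r - r0) < de) in Hr.
  change (Rabs (RInt (fun s => f r s) a b - RInt (fun s => f r0 s) a b) < eps).
  assert (E := RInt_minus (V := R_CompleteNormedModule) _ _ a b (Hex r) (Hex r0)).
  unfold minus, plus, opp in E; simpl in E.
  unfold Rminus. rewrite <- E.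
  apply Rle_lt_trans with ((b - a) * (eps / (b - a + 1))).
  - apply abs_RInt_le_const; auto.
    + apply (ex_RInt_minus (V := R_NormedModule) (fun s => f r s) (fun s => f r0 s)); auto.
    + intros s Hs. left.
      pose proof (cond_pos de). apply Rabs_def2 in Hr.
      apply (Hde s r0 s r); try lra. rewrite Rminus_diag, Rabs_R0. lra.
  - replace ((b - a) * (eps / (b - a + 1))) with (eps * ((b - a) / (b - a + 1))) by (field; lra).
    rewrite <- (Rmult_1_r eps) at 2. apply Rmult_lt_compat_l; [apply cond_pos|].
    apply Rlt_div_l; lra.
Qed.

(** The partials are named functions and not [Derive] expressions, so that products and differences
    carry theirs as explicit formulas. *)
Definition has_partials (D : C -> Prop) (F Fx Fy : C -> R) : Prop :=
  forall z : C, D z ->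
    is_derive (fun x : R => F (x, Im z)) (Re z) (Fx z) /\
    is_derive (fun y : R => F (Re z, y)) (Im z) (Fy z) /\
    continuous Fx z /\ continuous Fy z.

Lemma C1_in_has_partials (D : C -> Prop) (F : C -> R) :
  C1_in D F -> has_partials D F (partial_x F) (partial_y F).
Proof.
  intros H z Hz. destruct (H z Hz) as (H1 & H2 & H3 & H4).
  refine (conj _ (conj _ (conj _ _))); auto; now apply Derive_correct.
Qed.

Section Partials.

Variable D : C -> Prop.
Hypothesis HD : forall z : C, D z -> locally z D.

(** Total differentiability needs the x-partial on a whole neighbourhood of the point; this is where
    D being open enters. *)
Lemma has_partials_filterdiff (F Fx Fy : C -> R) (x y : R) :
  has_partials D F Fx Fy -> D (x, y) ->
  filterdiff (fun u : R * R => F (fst u, snd u)) (locally (x, y))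
    (fun u : R * R => plus (scal (fst u) (Fx (x, y))) (scal (snd u) (Fy (x, y)))).
Proof.
  intros H Hz.
  apply (is_derive_filterdiff (fun x y => F (x, y)) x y (fun x y => Fx (x, y)) (Fy (x, y))).
  - generalize (HD _ Hz). apply filter_imp. intros [u v] Huv. apply (H (u, v) Huv).
  - apply (H (x, y) Hz).
  - apply continuous_ext with Fx; [intros [u v]; reflexivity|]. apply (H (x, y) Hz).
Qed.

Lemma has_partials_continuous (F Fx Fy : C -> R) (z : C) :
  has_partials D F Fx Fy -> D z -> continuous F z.
Proof.
  intros H Hz. destruct z as [x y].
  apply continuous_ext with (fun u : R * R => F (fst u, snd u)); [intros [u v]; reflexivity|].
  apply (filterdiff_continuous (K := R_AbsRing)
           (U := prod_NormedModule R_AbsRing R_NormedModule R_NormedModule)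
           (V := R_NormedModule)).
  eexists. apply (has_partials_filterdiff F Fx Fy x y H Hz).
Qed.

Lemma has_partials_comp (F Fx Fy : C -> R) (x y : R -> R) (t dx dy : R) :
  has_partials D F Fx Fy -> D (x t, y t) ->
  is_derive x t dx -> is_derive y t dy ->
  is_derive (fun t => F (x t, y t)) t (Fx (x t, y t) * dx + Fy (x t, y t) * dy).
Proof.
  intros H Hz Hx Hy.
  pose proof (has_partials_filterdiff F Fx Fy _ _ H Hz) as Hd.
  eapply filterdiff_ext_lin.
  - apply (filterdiff_comp'_2 (K := R_AbsRing) (T := R_NormedModule) (U := R_NormedModule)
             (V := R_NormedModule) (W := R_NormedModule) x y (fun u v => F (u, v)) t
             _ _ (fun u v => plus (scal u (Fx (x t, y t))) (scal v (Fy (x t, y t)))) Hx Hy Hd).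
  - intros s. unfold plus, scal; simpl. unfold mult; simpl. ring.
Qed.

Lemma has_partials_mult (F Fx Fy G Gx Gy : C -> R) :
  has_partials D F Fx Fy -> has_partials D G Gx Gy ->
  has_partials D (fun z => F z * G z)
    (fun z => Fx z * G z + F z * Gx z) (fun z => Fy z * G z + F z * Gy z).
Proof.
  intros HF HG z Hz.
  pose proof (has_partials_continuous _ _ _ z HF Hz) as CF.
  pose proof (has_partials_continuous _ _ _ z HG Hz) as CG.
  destruct (HF z Hz) as (F1 & F2 & F3 & F4). destruct (HG z Hz) as (G1 & G2 & G3 & G4).
  destruct z as [x y]. refine (conj _ (conj _ (conj _ _))).
  - apply (Derive.is_derive_mult _ _ _ _ _ F1 G1).
  - apply (Derive.is_derive_mult _ _ _ _ _ F2 G2).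
  - apply (continuous_plus (fun z : C => Fx z * G z)); now apply (continuous_mult (K := R_AbsRing)).
  - apply (continuous_plus (fun z : C => Fy z * G z)); now apply (continuous_mult (K := R_AbsRing)).
Qed.

Lemma has_partials_minus (F Fx Fy G Gx Gy : C -> R) :
  has_partials D F Fx Fy -> has_partials D G Gx Gy ->
  has_partials D (fun z => F z - G z) (fun z => Fx z - Gx z) (fun z => Fy z - Gy z).
Proof.
  intros HF HG z Hz.
  destruct (HF z Hz) as (F1 & F2 & F3 & F4). destruct (HG z Hz) as (G1 & G2 & G3 & G4).
  refine (conj _ (conj _ (conj _ _))).
  - apply (is_derive_minus (K := R_AbsRing) (V := R_NormedModule) _ _ _ _ _ F1 G1).
  - apply (is_derive_minus (K := R_AbsRing) (V := R_NormedModule) _ _ _ _ _ F2 G2).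
  - now apply (continuous_minus (V := R_NormedModule) Fx Gx).
  - now apply (continuous_minus (V := R_NormedModule) Fy Gy).
Qed.

Variables (P Px Py Q Qx Qy : C -> R).
Hypothesis HP : has_partials D P Px Py.
Hypothesis HQ : has_partials D Q Qx Qy.
Hypothesis Hclosed : forall z, D z -> Py z = Qx z.

Section Edge.

Variables (a b p1 p2 v1 v2 : R).
Hypothesis Hab : a <= b.
Let gam1 (s : R) := p1 + s * v1.
Let gam2 (s : R) := p2 + s * v2.
Let pt (r s : R) : C := (r * gam1 s, r * gam2 s).
Hypothesis Hin : forall r s, 0 < r < 1 -> a <= s <= b -> D (pt r s).

(** For the edge scaled by r, [work] is the form P dx + Q dy evaluated on the s-derivative of [pt]
    and [radial] is the form evaluated on its r-derivative. Closedness amounts to the r-derivative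
    of the first being the s-derivative of the second; [dwork] is the common value. *)
Let work (r s : R) := r * (P (pt r s) * v1 + Q (pt r s) * v2).
Let radial (r s : R) := P (pt r s) * gam1 s + Q (pt r s) * gam2 s.
Let dwork (r s : R) := (P (pt r s) * v1 + Q (pt r s) * v2)
  + r * ((Px (pt r s) * gam1 s + Py (pt r s) * gam2 s) * v1
       + (Qx (pt r s) * gam1 s + Qy (pt r s) * gam2 s) * v2).

Lemma is_derive_work (r s : R) : D (pt r s) -> is_derive (fun r => work r s) r (dwork r s).
Proof.
  intros Hz.
  assert (H1 : is_derive (fun r => r * gam1 s) r (gam1 s)) by (auto_derive; auto; ring).
  assert (H2 : is_derive (fun r => r * gam2 s) r (gam2 s)) by (auto_derive; auto; ring).
  pose proof (has_partials_comp _ _ _ _ _ _ _ _ HP Hz H1 H2) as DP.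
  pose proof (has_partials_comp _ _ _ _ _ _ _ _ HQ Hz H1 H2) as DQ.
  unfold work, dwork, pt in *. cbv beta in *.
  evar_last.
  - apply (Derive.is_derive_mult (fun r => r)); [apply (is_derive_id (K := R_AbsRing))|].
    apply (is_derive_plus (K := R_AbsRing) (V := R_NormedModule)
             (fun r => P (r * gam1 s, r * gam2 s) * v1) (fun r => Q (r * gam1 s, r * gam2 s) * v2)).
    + apply (Derive.is_derive_mult _ (fun _ => v1) _ _ _ DP
               (is_derive_const (K := R_AbsRing) (V := R_NormedModule) v1 r)).
    + apply (Derive.is_derive_mult _ (fun _ => v2) _ _ _ DQ
               (is_derive_const (K := R_AbsRing) (V := R_NormedModule) v2 r)).
  - unfold plus, zero, one; simpl. ring.
Qed.

(** Differentiating in s instead of r exchanges the mixed terms in [Py] and [Qx]; closedness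
    identifies the result with [dwork]. *)
Lemma is_derive_radial (r s : R) : D (pt r s) -> is_derive (fun s => radial r s) s (dwork r s).
Proof.
  intros Hz.
  assert (G1 : is_derive gam1 s v1) by (unfold gam1; auto_derive; auto; ring).
  assert (G2 : is_derive gam2 s v2) by (unfold gam2; auto_derive; auto; ring).
  assert (H1 : is_derive (fun s => r * gam1 s) s (r * v1)) by now apply (is_derive_scal gam1).
  assert (H2 : is_derive (fun s => r * gam2 s) s (r * v2)) by now apply (is_derive_scal gam2).
  pose proof (has_partials_comp _ _ _ _ _ _ _ _ HP Hz H1 H2) as DP.
  pose proof (has_partials_comp _ _ _ _ _ _ _ _ HQ Hz H1 H2) as DQ.
  pose proof (Hclosed _ Hz) as Hc.
  unfold radial, dwork, pt in *. cbv beta in *.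
  evar_last.
  - apply (is_derive_plus (K := R_AbsRing) (V := R_NormedModule)
             (fun s => P (r * gam1 s, r * gam2 s) * gam1 s)
             (fun s => Q (r * gam1 s, r * gam2 s) * gam2 s)).
    + apply (Derive.is_derive_mult _ _ _ _ _ DP G1).
    + apply (Derive.is_derive_mult _ _ _ _ _ DQ G2).
  - unfold plus; simpl. rewrite Hc. ring.
Qed.

Lemma continuous_pt (r s : R) : continuous (fun z : R * R => pt (fst z) (snd z)) (r, s).
Proof.
  assert (Hg : forall p v, continuous (fun z : R * R => fst z * (p + snd z * v)) (r, s)).
  { intros p v.
    apply (continuous_mult (K := R_AbsRing) (fun z : R * R => fst z)); [apply continuous_fst|].
    apply (continuous_plus (V := R_NormedModule) (fun _ : R * R => p)); [apply continuous_const|].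
    apply (continuous_mult (K := R_AbsRing) (fun z : R * R => snd z)); [apply continuous_snd|].
    apply continuous_const. }
  apply continuous_C_pair; apply Hg.
Qed.

Lemma continuous_dwork (r s : R) : D (pt r s) ->
  continuous (fun z : R * R => dwork (fst z) (snd z)) (r, s).
Proof.
  intros Hz.
  assert (Hc : forall F : C -> R, continuous F (pt r s) ->
             continuous (fun z : R * R => F (pt (fst z) (snd z))) (r, s)).
  { intros F HF. apply (continuous_comp (fun z : R * R => pt (fst z) (snd z)) F); auto.
    apply continuous_pt. }
  assert (Hg : forall p v, continuous (fun z : R * R => p + snd z * v) (r, s)).
  { intros p v.
    apply (continuous_plus (V := R_NormedModule) (fun _ : R * R => p)); [apply continuous_const|].
    apply (continuous_mult (K := R_AbsRing) (fun z : R * R => snd z)); [apply continuous_snd|].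
    apply continuous_const. }
  assert (Hm : forall F G : R * R -> R, continuous F (r, s) -> continuous G (r, s) ->
             continuous (fun z => F z * G z) (r, s)).
  { intros F G HF HG. now apply (continuous_mult (K := R_AbsRing)). }
  assert (Hp : forall F G : R * R -> R, continuous F (r, s) -> continuous G (r, s) ->
             continuous (fun z => F z + G z) (r, s)).
  { intros F G HF HG. now apply (continuous_plus (V := R_NormedModule)). }
  pose proof (has_partials_continuous _ _ _ _ HP Hz) as CP.
  pose proof (has_partials_continuous _ _ _ _ HQ Hz) as CQ.
  destruct (HP _ Hz) as (_ & _ & CPx & CPy). destruct (HQ _ Hz) as (_ & _ & CQx & CQy).
  assert (Cf : continuous (fun z : R * R => fst z) (r, s)) by apply continuous_fst.
  assert (Cs : continuous (fun z : R * R => snd z) (r, s)) by apply continuous_snd.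
  unfold dwork.
  repeat first [exact Cs | apply Hp | apply Hm | now apply Hc | apply continuous_const | apply Hg | exact Cf].
Qed.

(** Differentiation under the integral produces [dwork], which is an s-derivative, so only end
    values of [radial] remain. *)
Lemma is_derive_edge_integral (r : R) : 0 < r < 1 ->
  is_derive (fun r => RInt (fun s => work r s) a b) r (radial r b - radial r a).
Proof.
  intros Hr.
  assert (Hin' : forall r s, 0 < r < 1 -> Rmin a b <= s <= Rmax a b -> D (pt r s)).
  { intros u s. rewrite Rmin_left, Rmax_right by exact Hab. apply Hin. }
  assert (Hloc : locally r (fun r => 0 < r < 1)).
  { apply locally_interval; lra. }
  assert (Hnear : forall s, Rmin a b <= s <= Rmax a b -> locally (r, s)
             (fun z : R * R => D (pt (fst z) (snd z)))).
  { intros s Hs. apply (continuous_pt r s). apply HD. now apply Hin'. }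
  replace (radial r b - radial r a) with (RInt (fun t => Derive (fun u => work u t) r) a b).
  - apply (is_derive_RInt_param work a b r).
    + revert Hloc. apply filter_imp. intros u Hu s Hs. eexists. apply is_derive_work. now apply Hin'.
    + intros s Hs. apply continuity_2d_pt_ext_loc with dwork.
      * apply locally_2d_locally. generalize (Hnear s Hs). apply filter_imp.
        intros [u v] Huv. symmetry. apply is_derive_unique, is_derive_work, Huv.
      * apply continuity_2d_pt_filterlim. apply continuous_dwork. now apply Hin'.
    + revert Hloc. apply filter_imp. intros u Hu.
      apply (ex_RInt_continuous (V := R_CompleteNormedModule)). intros s Hs.
      pose proof (Hin' u s Hu Hs) as Hz.
      assert (Hc : continuous (fun s => pt u s) s).
      { apply (continuous_comp_2 (fun _ => u) (fun s => s) pt s).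
        - apply continuous_const.
        - apply continuous_id.
        - apply continuous_pt. }
      unfold work. apply (continuous_mult (K := R_AbsRing) (fun _ : R => u)); [apply continuous_const|].
      apply (continuous_plus (V := R_NormedModule) (fun s => P (pt u s) * v1));
        apply (continuous_mult (K := R_AbsRing)); try apply continuous_const.
      * apply (continuous_comp (fun s => pt u s) P); auto. eapply has_partials_continuous; eauto.
      * apply (continuous_comp (fun s => pt u s) Q); auto. eapply has_partials_continuous; eauto.
  - apply is_RInt_unique.
    apply is_RInt_ext with (fun s => dwork r s).
    { intros s Hs. symmetry. apply is_derive_unique, is_derive_work, Hin'; lra. }
    apply (is_RInt_derive (V := R_CompleteNormedModule) (fun s => radial r s)).
    + intros s Hs. apply is_derive_radial. now apply Hin'.
    + intros s Hs. apply (continuous_comp_2 (fun _ => r) (fun s => s) dwork s).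
      * apply continuous_const.
      * apply continuous_id.
      * apply continuous_dwork. now apply Hin'.
Qed.

Variables (Dbar : C -> Prop) (Pb Qb : C -> R).
Hypothesis HinB : forall r s, 0 <= r <= 1 -> a <= s <= b -> Dbar (pt r s).
Hypothesis HPb : continuous_on Dbar Pb.
Hypothesis HQb : continuous_on Dbar Qb.
Hypothesis HPe : forall z, D z -> Pb z = P z.
Hypothesis HQe : forall z, D z -> Qb z = Q z.

Let cpt (r s : R) : C := pt (clamp 0 1 r) (clamp a b s).

Lemma continuous_cpt (F : C -> R) (r s : R) : continuous_on Dbar F ->
  continuous (fun z : R * R => F (cpt (fst z) (snd z))) (r, s).
Proof.
  intros HF. apply continuous_on_comp with Dbar; auto.
  - intros [u v]. apply HinB; apply clamp_range; lra.
  - unfold cpt.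
    apply (continuous_comp_2 (fun z : R * R => clamp 0 1 (fst z)) (fun z => clamp a b (snd z)) pt).
    + apply (continuous_comp (fun z : R * R => fst z) (clamp 0 1)).
      * apply continuous_fst.
      * apply continuous_clamp.
    + apply (continuous_comp (fun z : R * R => snd z) (clamp a b)).
      * apply continuous_snd.
      * apply continuous_clamp.
    + apply continuous_pt.
Qed.

(** The form is differentiable only for 0 < r < 1, while the edge of interest has r = 1. Using the
    boundary extensions and clamping r and s gives a function of r that is continuous on the whole
    line, as the mean value theorem on [0, 1] demands. *)
Definition edge_integral (r : R) : R :=
  RInt (fun s => clamp 0 1 r * (Pb (cpt r s) * v1 + Qb (cpt r s) * v2)) a b.

Lemma continuous_edge_integral (r : R) : continuous edge_integral r.
Proof.
  apply (continuous_RInt_param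
           (fun r s => clamp 0 1 r * (Pb (cpt r s) * v1 + Qb (cpt r s) * v2)) a b Hab).
  clear r. intros r s.
  apply (continuous_mult (K := R_AbsRing) (fun z : R * R => clamp 0 1 (fst z))).
  - apply (continuous_comp (fun z : R * R => fst z) (clamp 0 1)).
    + apply continuous_fst.
    + apply continuous_clamp.
  - apply (continuous_plus (V := R_NormedModule) (fun z : R * R => Pb (cpt (fst z) (snd z)) * v1));
      apply (continuous_mult (K := R_AbsRing)); try apply continuous_const; now apply continuous_cpt.
Qed.

Lemma is_derive_edge_integral_closed (r : R) : 0 < r < 1 ->
  is_derive edge_integral r (radial r b - radial r a).
Proof.
  intros Hr.
  apply is_derive_ext_loc with (fun r => RInt (fun s => work r s) a b);
    [|now apply is_derive_edge_integral].
  assert (Hloc : locally r (fun r => 0 < r < 1)).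
  { apply locally_interval; lra. }
  revert Hloc. apply filter_imp. intros u Hu. apply RInt_ext.
  rewrite Rmin_left, Rmax_right by auto. intros s Hs. unfold work, cpt.
  rewrite !clamp_id by lra. rewrite HPe, HQe; auto; apply Hin; lra.
Qed.

Lemma edge_integral_0 : edge_integral 0 = 0.
Proof.
  unfold edge_integral. rewrite (RInt_ext _ (fun _ => 0)).
  - rewrite RInt_const. unfold scal; simpl; unfold mult; simpl. ring.
  - intros s _. rewrite clamp_id by lra. eq_in_R. ring.
Qed.

Lemma edge_integral_1 :
  edge_integral 1 =
  RInt (fun s => Pb (gam1 s, gam2 s) * v1 + Qb (gam1 s, gam2 s) * v2) a b.
Proof.
  apply RInt_ext. rewrite Rmin_left, Rmax_right by auto. intros s Hs. unfold cpt, pt.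
  rewrite !clamp_id by lra. rewrite !Rmult_1_l. reflexivity.
Qed.

End Edge.

End Partials.

(** * Green's formula on the triangle *)

Lemma sqrt3_sqr : sqrt 3 * sqrt 3 = 3.
Proof. apply sqrt_sqrt. lra. Qed.

Lemma sqrt3_pos : 0 < sqrt 3.
Proof. apply sqrt_lt_R0. lra. Qed.

Lemma alpha_eq : alpha = (- 1 / 2, sqrt 3 / 2).
Proof.
  unfold alpha, Cexp.
  replace (2 * Ci * PI / 3)%C with ((0, 2 * (PI / 3)) : C).
  - cbn [Re Im fst snd]. rewrite exp_0, cos_2PI3, sin_2PI3. apply injective_projections; simpl; field.
  - apply injective_projections; simpl; field.
Qed.

Lemma alphab_eq : alphab = (- 1 / 2, - sqrt 3 / 2).
Proof.
  unfold alphab, Cexp.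
  replace (- (2 * Ci * PI) / 3)%C with ((0, - (2 * (PI / 3))) : C).
  - cbn [Re Im fst snd]. rewrite exp_0, cos_neg, sin_neg, cos_2PI3, sin_2PI3.
    apply injective_projections; simpl; field.
  - apply injective_projections; simpl; field.
Qed.

Definition inradius (l : R) : R := l / (2 * sqrt 3).

Lemma half_side_inradius (l : R) : l / 2 = sqrt 3 * inradius l.
Proof. unfold inradius. pose proof sqrt3_pos. field. lra. Qed.

Lemma inradius_pos (l : R) : 0 < l -> 0 < inradius l.
Proof. intros. apply Rdiv_lt_0_compat; auto. pose proof sqrt3_pos. lra. Qed.

Definition normal_x (j : side) : R :=
  match j with side1 => 1 | _ => - 1 / 2 end.
Definition normal_y (j : side) : R :=
  match j with side1 => 0 | side2 => - sqrt 3 / 2 | side3 => sqrt 3 / 2 end.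

Lemma outward_normal_eq (j : side) : outward_normal j = (normal_x j, normal_y j).
Proof.
  destruct j; [reflexivity|exact alphab_eq|exact alpha_eq].
Qed.

Lemma side_point_eq (l : R) (j : side) (s : R) :
  side_point l j s = (inradius l * normal_x j + s * - normal_y j,
                      inradius l * normal_y j + s * normal_x j).
Proof.
  unfold side_point. rewrite outward_normal_eq. fold (inradius l).
  apply injective_projections; simpl; ring.
Qed.

Lemma vertex1_eq (l : R) : vertex1 l = (inradius l, l / 2).
Proof.
  unfold vertex1, Cexp.
  replace (Ci * PI / 3)%C with ((0, PI / 3) : C).
  2:{ apply injective_projections; simpl; field. }
  cbn [Re Im fst snd]. rewrite exp_0, cos_PI3, sin_PI3. pose proof sqrt3_pos.
  unfold inradius. apply injective_projections; simpl; field; lra.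
Qed.

Lemma barycentric_eq (l a b c : R) :
  (a * vertex1 l + b * vertex2 l + c * vertex3 l)%C =
  (inradius l * (a + b - 2 * c), l / 2 * (a - b)).
Proof.
  unfold vertex2, vertex3. rewrite vertex1_eq. pose proof sqrt3_pos.
  unfold inradius. apply injective_projections; simpl; field; lra.
Qed.

(** The inequalities bound the scalar product of z with each outward normal by the inradius; those
    for sides (2) and (3) are multiplied by 2. *)
Lemma open_triangle_iff (l x y : R) : 0 < l ->
  (open_triangle l (x, y) <->
   x < inradius l /\ - x - sqrt 3 * y < 2 * inradius l /\ - x + sqrt 3 * y < 2 * inradius l).
Proof.
  intros Hl. pose proof (inradius_pos l Hl) as Hd. pose proof sqrt3_pos as H3.
  pose proof sqrt3_sqr as H33. pose proof (half_side_inradius l) as Hh.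
  set (d := inradius l) in *. split.
  - intros (a & b & c & Ha & Hb & Hc & Hs & E). rewrite barycentric_eq in E. fold d in E.
    injection E as Ex Ey. rewrite Hh in Ey.
    assert (Ey' : sqrt 3 * y = 3 * d * (a - b)).
    { transitivity (sqrt 3 * sqrt 3 * d * (a - b)); [rewrite Ey; ring|rewrite H33; ring]. }
    rewrite Ex, Ey'. pose proof (Rmult_lt_0_compat d a Hd Ha). pose proof (Rmult_lt_0_compat d b Hd Hb).
    pose proof (Rmult_lt_0_compat d c Hd Hc). replace c with (1 - a - b) in * by lra.
    repeat split; nra.
  - intros (H1 & H2 & H4).
    (* Each barycentric coordinate is the distance to the side opposite its vertex, divided by the
       height, which is three times the inradius. *)
    exists ((2 * d + x + sqrt 3 * y) / (6 * d)), ((2 * d + x - sqrt 3 * y) / (6 * d)),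
      ((d - x) / (3 * d)).
    repeat split; try (apply Rdiv_lt_0_compat; lra).
    + field. lra.
    + rewrite barycentric_eq, Hh. fold d.
      apply injective_projections; cbn [fst snd].
      * field. lra.
      * replace y with (sqrt 3 * sqrt 3 * y / 3) at 1 by (rewrite H33; field). field. lra.
Qed.

Lemma closed_triangle_intro (l x y : R) : 0 < l ->
  x <= inradius l -> - x - sqrt 3 * y <= 2 * inradius l -> - x + sqrt 3 * y <= 2 * inradius l ->
  closed_triangle l (x, y).
Proof.
  intros Hl H1 H2 H4. pose proof (inradius_pos l Hl) as Hd. pose proof sqrt3_pos as H3.
  pose proof sqrt3_sqr as H33. pose proof (half_side_inradius l) as Hh.
  set (d := inradius l) in *.
  exists ((2 * d + x + sqrt 3 * y) / (6 * d)), ((2 * d + x - sqrt 3 * y) / (6 * d)),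
    ((d - x) / (3 * d)).
  repeat split; try (apply Rdiv_le_0_compat; lra).
  - field. lra.
  - rewrite barycentric_eq, Hh. fold d.
    apply injective_projections; cbn [fst snd].
    + field. lra.
    + replace y with (sqrt 3 * sqrt 3 * y / 3) at 1 by (rewrite H33; field). field. lra.
Qed.

Lemma continuous_linear (a b : R) (z : C) : continuous (fun w : C => a * fst w + b * snd w) z.
Proof.
  destruct z as [x y].
  apply (continuous_plus (V := R_NormedModule) (fun w : C => a * fst w));
    apply (continuous_mult (K := R_AbsRing)); try apply continuous_const.
  - apply (continuous_fst (U := R_UniformSpace) (V := R_UniformSpace)).
  - apply (continuous_snd (U := R_UniformSpace) (V := R_UniformSpace)).
Qed.

Lemma open_triangle_open (l : R) (z : C) : 0 < l -> open_triangle l z -> locally z (open_triangle l).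
Proof.
  intros Hl Hz. destruct z as [x y].
  apply (open_triangle_iff l x y Hl) in Hz. destruct Hz as (H1 & H2 & H3).
  assert (Hopen : forall a b c : R, a * x + b * y < c ->
            locally ((x, y) : C) (fun w : C => a * fst w + b * snd w < c)).
  { intros a b c H. apply (continuous_linear a b (x, y) (fun t => t < c)).
    apply (open_lt c). exact H. }
  assert (L1 : 1 * x + 0 * y < inradius l) by lra.
  assert (L2 : - 1 * x + - sqrt 3 * y < 2 * inradius l) by lra.
  assert (L3 : - 1 * x + sqrt 3 * y < 2 * inradius l) by lra.
  generalize (filter_and _ _ (Hopen _ _ _ L1) (filter_and _ _ (Hopen _ _ _ L2) (Hopen _ _ _ L3))).
  apply filter_imp. intros [u v] (G1 & G2 & G3). cbn [fst snd] in *.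
  apply open_triangle_iff; auto. lra.
Qed.

Lemma scaled_side_in_open (l : R) (j : side) (r s : R) : 0 < l ->
  0 <= r < 1 -> - (l / 2) <= s <= l / 2 ->
  open_triangle l (r * (inradius l * normal_x j + s * - normal_y j),
                   r * (inradius l * normal_y j + s * normal_x j)).
Proof.
  intros Hl Hr. pose proof (inradius_pos l Hl) as Hd. pose proof sqrt3_pos as H3.
  pose proof sqrt3_sqr as H33. rewrite half_side_inradius. intros Hs.
  apply open_triangle_iff; auto. set (d := inradius l) in *.
  set (t := sqrt 3) in *.
  assert (Hs1 : t * s <= 3 * d).
  { rewrite <- H33. replace (t * t * d) with (t * (t * d)) by ring. apply Rmult_le_compat_l; lra. }
  assert (Hs2 : - (3 * d) <= t * s).
  { rewrite <- H33. replace (- (t * t * d)) with (t * - (t * d)) by ring. apply Rmult_le_compat_l; lra. }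
  assert (Hr0 : 0 <= r * d) by (apply Rmult_le_pos; lra).
  assert (Hr1 : r * d < d) by (rewrite <- (Rmult_1_l d) at 2; apply Rmult_lt_compat_r; lra).
  assert (Hr2 : r * (t * s) <= r * (3 * d)) by (apply Rmult_le_compat_l; lra).
  assert (Hr3 : r * - (3 * d) <= r * (t * s)) by (apply Rmult_le_compat_l; lra).
  destruct j; cbn [normal_x normal_y]; fold t.
  - replace (t * (r * (d * 0 + s * 1))) with (r * (t * s)) by ring. repeat split; lra.
  - replace (t * (r * (d * (- t / 2) + s * (- 1 / 2)))) with (r * (- (t * t) * d - t * s) / 2) by field.
    replace (s * - (- t / 2)) with (t * s / 2) by field. rewrite H33. repeat split; lra.
  - replace (t * (r * (d * (t / 2) + s * (- 1 / 2)))) with (r * ((t * t) * d - t * s) / 2) by field.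
    replace (s * - (t / 2)) with (- (t * s) / 2) by field. rewrite H33. repeat split; lra.
Qed.

Lemma scaled_side_in_closed (l : R) (j : side) (r s : R) : 0 < l ->
  0 <= r <= 1 -> - (l / 2) <= s <= l / 2 ->
  closed_triangle l (r * (inradius l * normal_x j + s * - normal_y j),
                     r * (inradius l * normal_y j + s * normal_x j)).
Proof.
  intros Hl Hr. pose proof (inradius_pos l Hl) as Hd. pose proof sqrt3_pos as H3.
  pose proof sqrt3_sqr as H33. rewrite half_side_inradius. intros Hs.
  set (d := inradius l) in *. set (t := sqrt 3) in *.
  assert (Hs1 : t * s <= 3 * d).
  { rewrite <- H33. replace (t * t * d) with (t * (t * d)) by ring. apply Rmult_le_compat_l; lra. }
  assert (Hs2 : - (3 * d) <= t * s).
  { rewrite <- H33. replace (- (t * t * d)) with (t * - (t * d)) by ring. apply Rmult_le_compat_l; lra. }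
  assert (Hr0 : 0 <= r * d) by (apply Rmult_le_pos; lra).
  assert (Hr1 : r * d <= d) by (rewrite <- (Rmult_1_l d) at 2; apply Rmult_le_compat_r; lra).
  assert (Hr2 : r * (t * s) <= r * (3 * d)) by (apply Rmult_le_compat_l; lra).
  assert (Hr3 : r * - (3 * d) <= r * (t * s)) by (apply Rmult_le_compat_l; lra).
  destruct j; cbn [normal_x normal_y]; fold t; apply closed_triangle_intro; auto; fold d; fold t;
  try replace (t * (r * (d * 0 + s * 1))) with (r * (t * s)) by ring;
  try replace (t * (r * (d * (- t / 2) + s * (- 1 / 2)))) with (r * (- (t * t) * d - t * s) / 2) by field;
  try replace (s * - (- t / 2)) with (t * s / 2) by field;
  try replace (t * (r * (d * (t / 2) + s * (- 1 / 2)))) with (r * ((t * t) * d - t * s) / 2) by field;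
  try replace (s * - (t / 2)) with (- (t * s) / 2) by field; rewrite ?H33; lra.
Qed.

Lemma side_point_in_closed (l : R) (j : side) (s : R) : 0 < l ->
  - (l / 2) <= s <= l / 2 -> closed_triangle l (side_point l j s).
Proof.
  intros Hl Hs. rewrite side_point_eq.
  pose proof (scaled_side_in_closed l j 1 s Hl ltac:(lra) Hs) as H. now rewrite !Rmult_1_l in H.
Qed.

Lemma vertex_side12 (l : R) : side_point l side1 (- (l / 2)) = side_point l side2 (l / 2).
Proof.
  rewrite !side_point_eq, !half_side_inradius. cbn [normal_x normal_y].
  pose proof sqrt3_sqr as H. set (t := sqrt 3) in *. set (d := inradius l).
  apply injective_projections; cbn [fst snd]; [|field].
  replace (d * (- 1 / 2) + t * d * - (- t / 2)) with (d * (- 1 / 2) + t * t * d / 2) by field.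
  rewrite H. field.
Qed.

Lemma vertex_side23 (l : R) : side_point l side2 (- (l / 2)) = side_point l side3 (l / 2).
Proof.
  rewrite !side_point_eq, !half_side_inradius. cbn [normal_x normal_y].
  apply injective_projections; cbn [fst snd]; field.
Qed.

Lemma vertex_side31 (l : R) : side_point l side3 (- (l / 2)) = side_point l side1 (l / 2).
Proof.
  rewrite !side_point_eq, !half_side_inradius. cbn [normal_x normal_y].
  pose proof sqrt3_sqr as H. set (t := sqrt 3) in *. set (d := inradius l).
  apply injective_projections; cbn [fst snd]; [|field].
  replace (d * (- 1 / 2) + - (t * d) * - (t / 2)) with (d * (- 1 / 2) + t * t * d / 2) by field.
  rewrite H. field.
Qed.

(* Scaling the triangle by r changes the circulation of a closed form at rate
   the sum over the edges of the boundary values of a primitive, which telescopes to 0. *)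
Lemma closed_form_circulation (l : R) (P Px Py Q Qx Qy Pb Qb : C -> R) : 0 < l ->
  has_partials (open_triangle l) P Px Py ->
  has_partials (open_triangle l) Q Qx Qy ->
  (forall z, open_triangle l z -> Py z = Qx z) ->
  continuous_on (closed_triangle l) Pb -> continuous_on (closed_triangle l) Qb ->
  (forall z, open_triangle l z -> Pb z = P z) ->
  (forall z, open_triangle l z -> Qb z = Q z) ->
  let circ j := RInt (fun s => Pb (side_point l j s) * - normal_y j
                               + Qb (side_point l j s) * normal_x j) (- (l / 2)) (l / 2) in
  circ side1 + circ side2 + circ side3 = 0.
Proof.
  intros Hl HP HQ Hcl HPb HQb HPe HQe circ.
  set (I := fun j => edge_integral (- (l / 2)) (l / 2) (inradius l * normal_x j)
              (inradius l * normal_y j) (- normal_y j) (normal_x j) Pb Qb).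
  set (G := fun r => I side1 r + I side2 r + I side3 r).
  set (U := fun j r s => P (r * (inradius l * normal_x j + s * - normal_y j),
                           r * (inradius l * normal_y j + s * normal_x j))
                         * (inradius l * normal_x j + s * - normal_y j)
                       + Q (r * (inradius l * normal_x j + s * - normal_y j),
                            r * (inradius l * normal_y j + s * normal_x j))
                         * (inradius l * normal_y j + s * normal_x j)).
  assert (Hle : - (l / 2) <= l / 2) by lra.
  assert (HI' : forall j r, 0 < r < 1 -> is_derive (I j) r (U j r (l / 2) - U j r (- (l / 2)))).
  { intros j r Hr. unfold I, U.
    apply (is_derive_edge_integral_closed (open_triangle l)) with
      (Px := Px) (Py := Py) (Qx := Qx) (Qy := Qy); auto; try lra.
    - intros z Hz. now apply open_triangle_open.
    - intros u s Hu Hs. apply scaled_side_in_open; auto; lra. }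
  assert (HIc : forall j r, continuous (I j) r).
  { intros j r. unfold I.
    apply (continuous_edge_integral (- (l / 2)) (l / 2) _ _ _ _ Hle (closed_triangle l) Pb Qb);
      try assumption.
    intros u s Hu Hs. now apply scaled_side_in_closed. }
  (* Each vertex ends one edge and starts the next, so its value occurs once with each sign. *)
  assert (HU : forall r, U side1 r (l / 2) - U side1 r (- (l / 2))
     + (U side2 r (l / 2) - U side2 r (- (l / 2)))
     + (U side3 r (l / 2) - U side3 r (- (l / 2))) = 0).
  { intros r. unfold U.
    pose proof (vertex_side12 l) as V12. pose proof (vertex_side23 l) as V23.
    pose proof (vertex_side31 l) as V31. rewrite !side_point_eq in V12, V23, V31.
    pose proof (f_equal fst V12) as E1. pose proof (f_equal snd V12) as E2.
    pose proof (f_equal fst V23) as E3. pose proof (f_equal snd V23) as E4.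
    pose proof (f_equal fst V31) as E5. pose proof (f_equal snd V31) as E6.
    cbn [fst snd] in E1, E2, E3, E4, E5, E6.
    rewrite E1, E2, E3, E4, E5, E6. ring. }
  assert (HG : G 1 - G 0 = 0).
  { destruct (MVT_gen G 0 1 (fun _ => 0)) as [c [_ Hc]].
    - rewrite Rmin_left, Rmax_right by lra. intros r Hr. rewrite <- (HU r). unfold G.
      apply (is_derive_plus (K := R_AbsRing) (V := R_NormedModule) (fun r => I side1 r + I side2 r));
        [apply (is_derive_plus (K := R_AbsRing) (V := R_NormedModule))|]; now apply HI'.
    - intros r _. apply continuity_pt_filterlim. unfold G.
      apply (continuous_plus (V := R_NormedModule) (fun r => I side1 r + I side2 r));
        [apply (continuous_plus (V := R_NormedModule))|]; apply HIc.
    - lra. }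
  assert (H0 : forall j, I j 0 = 0).
  { intros j. unfold I. apply edge_integral_0. }
  assert (H1 : forall j, I j 1 = circ j).
  { intros j. unfold I, circ. rewrite edge_integral_1 by lra. apply RInt_ext.
    intros s _. now rewrite side_point_eq. }
  unfold G in HG. rewrite !H0, !H1 in HG. lra.
Qed.

Lemma continuous_on_mult {U : UniformSpace} (D : U -> Prop) (F G : U -> R) :
  continuous_on D F -> continuous_on D G -> continuous_on D (fun z => F z * G z).
Proof.
  intros HF HG z Hz.
  apply (filterlim_comp_2 (G := locally (F z)) (H := locally (G z)) F G Rmult); auto.
  apply (filterlim_mult (K := R_AbsRing)).
Qed.

Lemma continuous_on_minus {U : UniformSpace} (D : U -> Prop) (F G : U -> R) :
  continuous_on D F -> continuous_on D G -> continuous_on D (fun z => F z - G z).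
Proof.
  intros HF HG z Hz.
  apply (filterlim_comp_2 (G := locally (F z)) (H := locally (- G z)) F (fun z => - G z) Rplus); auto.
  - eapply filterlim_comp; [apply HG; exact Hz|]. apply (filterlim_opp (V := R_NormedModule)).
  - apply (filterlim_plus (V := R_NormedModule)).
Qed.

(** Circulation of (q w_y - w q_y) dx + (w q_x - q w_x) dy. Its exterior derivative is w times the
    Laplacian of q minus q times that of w, and this vanishes because both functions solve the same
    equation. On the tangent (- [normal_y], [normal_x]) the form is the integrand of the flux. *)
Lemma green_triangle (l lam : R) (q gx gy w : C -> R) : 0 < l ->
  C2_in (open_triangle l) q ->
  (forall z, open_triangle l z ->
     partial_x (partial_x q) z + partial_y (partial_y q) z - 4 * lam * q z = 0) ->
  continuous_on (closed_triangle l) q ->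
  continuous_on (closed_triangle l) gx -> continuous_on (closed_triangle l) gy ->
  (forall z, open_triangle l z -> gx z = partial_x q z /\ gy z = partial_y q z) ->
  C2_in (fun _ => True) w ->
  (forall z, partial_x (partial_x w) z + partial_y (partial_y w) z = 4 * lam * w z) ->
  let flux j := RInt (fun s =>
      let z := side_point l j s in
      w z * (gx z * normal_x j + gy z * normal_y j)
      - q z * (partial_x w z * normal_x j + partial_y w z * normal_y j)) (- (l / 2)) (l / 2) in
  flux side1 + flux side2 + flux side3 = 0.
Proof.
  intros Hl (Hq & Hqx & Hqy) Hpde Hqc Hgx Hgy Hg (Hw & Hwx & Hwy) Hwpde flux.
  apply C1_in_has_partials in Hq, Hqx, Hqy, Hw, Hwx, Hwy.
  assert (Hsub : forall F Fx Fy, has_partials (fun _ => True) F Fx Fy ->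
                   has_partials (open_triangle l) F Fx Fy) by (intros F Fx Fy H z _; now apply H).
  assert (Ho : forall z, open_triangle l z -> locally z (open_triangle l))
    by (intros z; now apply open_triangle_open).
  assert (Hwc : forall F Fx Fy, has_partials (fun _ => True) F Fx Fy ->
                  continuous_on (closed_triangle l) F).
  { intros F Fx Fy H. apply continuous_on_forall. intros z _.
    apply (has_partials_continuous (fun _ => True)) with Fx Fy; auto.
    intros. apply filter_true. }
  pose proof (Hwc _ _ _ Hw) as Cw. pose proof (Hwc _ _ _ Hwx) as Cwx. pose proof (Hwc _ _ _ Hwy) as Cwy.
  apply Hsub in Hw, Hwx, Hwy.
  assert (Hc2 : forall F G H K : C -> R, continuous_on (closed_triangle l) F ->
     continuous_on (closed_triangle l) G -> continuous_on (closed_triangle l) H ->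
     continuous_on (closed_triangle l) K ->
     continuous_on (closed_triangle l) (fun z => F z * G z - H z * K z)).
  { intros F G H K HF HG HH HK z Hz.
    apply (continuous_on_minus (closed_triangle l) (fun z => F z * G z) (fun z => H z * K z));
      auto; now apply continuous_on_mult. }
  pose proof (closed_form_circulation l _ _ _ _ _ _
    (fun z => q z * partial_y w z - w z * gy z) (fun z => w z * gx z - q z * partial_x w z) Hl
    (has_partials_minus _ _ _ _ _ _ _ (has_partials_mult _ Ho _ _ _ _ _ _ Hq Hwy)
                                      (has_partials_mult _ Ho _ _ _ _ _ _ Hw Hqy))
    (has_partials_minus _ _ _ _ _ _ _ (has_partials_mult _ Ho _ _ _ _ _ _ Hw Hqx)
                                      (has_partials_mult _ Ho _ _ _ _ _ _ Hq Hwx))) as H.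
  cbv beta zeta in H.
  assert (E : forall j, flux j = RInt (fun s =>
     (q (side_point l j s) * partial_y w (side_point l j s) - w (side_point l j s) * gy (side_point l j s))
       * - normal_y j
     + (w (side_point l j s) * gx (side_point l j s) - q (side_point l j s) * partial_x w (side_point l j s))
       * normal_x j) (- (l / 2)) (l / 2)).
  { intros j. apply RInt_ext. intros s _. cbv zeta. eq_in_R. ring. }
  rewrite !E. apply H; auto.
  - intros z Hz. pose proof (Hpde z Hz) as E1. pose proof (Hwpde z) as E2. nra.
  - intros z Hz. destruct (Hg z Hz) as [E1 E2]. now rewrite ?E1, ?E2.
  - intros z Hz. destruct (Hg z Hz) as [E1 E2]. now rewrite ?E1, ?E2.
Qed.

(** [3 * inradius l - sqrt 3 * Rabs s] is the height of the triangle above the point s of a side,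
    that is sqrt 3 (l/2 - |s|): the inner normal stays inside over exactly that length. *)
Lemma inner_normal_in_open (l : R) (j : side) (s t : R) : 0 < l ->
  - (3 * inradius l - sqrt 3 * Rabs s) < t < 0 ->
  open_triangle l (inradius l * normal_x j + s * - normal_y j + t * normal_x j,
                   inradius l * normal_y j + s * normal_x j + t * normal_y j).
Proof.
  intros Hl Ht. pose proof sqrt3_sqr as H33. pose proof sqrt3_pos as H3.
  apply open_triangle_iff; auto. set (d := inradius l) in *. set (u := sqrt 3) in *.
  assert (B1 : u * s <= u * Rabs s) by (apply Rmult_le_compat_l; [lra|apply Rle_abs]).
  assert (B2 : u * - s <= u * Rabs s).
  { apply Rmult_le_compat_l; [lra|]. rewrite <- Rabs_Ropp. apply Rle_abs. }
  destruct j; cbn [normal_x normal_y]; fold u.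
  - repeat split; lra.
  - replace (u * (d * (- u / 2) + s * (- 1 / 2) + t * (- u / 2)))
      with (- (u * u * d + u * s + u * u * t) / 2) by field. rewrite H33. repeat split; lra.
  - replace (u * (d * (u / 2) + s * (- 1 / 2) + t * (u / 2)))
      with ((u * u * d - u * s + u * u * t) / 2) by field. rewrite H33. repeat split; lra.
Qed.

Lemma inner_normal_in_closed (l : R) (j : side) (s t : R) : 0 < l ->
  - (3 * inradius l - sqrt 3 * Rabs s) <= t <= 0 ->
  closed_triangle l (inradius l * normal_x j + s * - normal_y j + t * normal_x j,
                     inradius l * normal_y j + s * normal_x j + t * normal_y j).
Proof.
  intros Hl Ht. pose proof sqrt3_sqr as H33. pose proof sqrt3_pos as H3.
  assert (B1 : sqrt 3 * s <= sqrt 3 * Rabs s) by (apply Rmult_le_compat_l; [lra|apply Rle_abs]).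
  assert (B2 : sqrt 3 * - s <= sqrt 3 * Rabs s).
  { apply Rmult_le_compat_l; [lra|]. rewrite <- Rabs_Ropp. apply Rle_abs. }
  apply closed_triangle_intro; auto; set (d := inradius l) in *; set (u := sqrt 3) in *;
  destruct j; cbn [normal_x normal_y]; fold u;
  try replace (u * (d * (- u / 2) + s * (- 1 / 2) + t * (- u / 2)))
      with (- (u * u * d + u * s + u * u * t) / 2) by field;
  try replace (u * (d * (u / 2) + s * (- 1 / 2) + t * (u / 2)))
      with ((u * u * d - u * s + u * u * t) / 2) by field; rewrite ?H33; lra.
Qed.

(** By the mean value theorem along the inner normal, the difference quotient is a value of the
    normal component of the gradient at an intermediate point, and the extended gradient is
    continuous up to the side. An s strictly inside the side leaves an inner normal of positive
    length [de]. *)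
Lemma normal_derivative_eq (l : R) (q gx gy : C -> R) (j : side) (s : R) : 0 < l ->
  C2_in (open_triangle l) q ->
  continuous_on (closed_triangle l) q ->
  continuous_on (closed_triangle l) gx -> continuous_on (closed_triangle l) gy ->
  (forall z, open_triangle l z -> gx z = partial_x q z /\ gy z = partial_y q z) ->
  - (l / 2) < s < l / 2 ->
  is_normal_derivative l q j s
    (gx (side_point l j s) * normal_x j + gy (side_point l j s) * normal_y j).
Proof.
  intros Hl [Hq _] Hqc Hgx Hgy Hg Hs.
  apply C1_in_has_partials in Hq.
  set (de := 3 * inradius l - sqrt 3 * Rabs s).
  assert (Hde : 0 < de).
  { unfold de. rewrite half_side_inradius in Hs. pose proof sqrt3_pos. pose proof sqrt3_sqr as H33.
    assert (Rabs s < sqrt 3 * inradius l) by (apply Rabs_def1; lra).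
    assert (sqrt 3 * Rabs s < sqrt 3 * (sqrt 3 * inradius l)) by (apply Rmult_lt_compat_l; lra).
    rewrite <- Rmult_assoc, H33 in *. lra. }
  set (pt := fun t => (inradius l * normal_x j + s * - normal_y j + t * normal_x j,
                       inradius l * normal_y j + s * normal_x j + t * normal_y j) : C).
  assert (Ept : forall t : R, (side_point l j s + t * outward_normal j)%C = pt t).
  { intros t. rewrite side_point_eq, outward_normal_eq. unfold pt.
    apply injective_projections; simpl; ring. }
  assert (E0 : side_point l j s = pt 0).
  { rewrite side_point_eq. unfold pt. apply injective_projections; simpl; ring. }
  set (cpt := fun t => pt (clamp (- de) 0 t)).
  assert (Hcpt : forall (F : C -> R) t, continuous_on (closed_triangle l) F ->
            continuous (fun t => F (cpt t)) t).
  { intros F t HF. apply continuous_on_comp with (closed_triangle l); auto.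
    - intros u. apply inner_normal_in_closed; auto. apply clamp_range. lra.
    - apply (continuous_comp (clamp (- de) 0) pt); [apply continuous_clamp|].
      assert (Haff : forall a b t, continuous (fun t : R => a + t * b) t).
      { intros a b u. apply (ex_derive_continuous (fun t : R => a + t * b)). auto_derive. auto. }
      apply continuous_C_pair; apply Haff. }
  set (G := fun t => gx (cpt t) * normal_x j + gy (cpt t) * normal_y j).
  assert (HG : continuous G 0).
  { apply (continuous_plus (V := R_NormedModule) (fun t => gx (cpt t) * normal_x j));
      apply (continuous_mult (K := R_AbsRing)); try apply continuous_const; now apply Hcpt. }
  assert (Hc0 : cpt 0 = side_point l j s) by (unfold cpt; rewrite clamp_id, E0 by lra; reflexivity).
  assert (HDer : forall t, - de < t < 0 -> is_derive (fun t => q (cpt t)) t (G t)).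
  { intros t Ht. assert (Hin : open_triangle l (pt t)) by (apply inner_normal_in_open; auto).
    apply is_derive_ext_loc with (fun t => q (pt t)).
    { assert (Hloc : locally t (fun u => - de < u < 0)).
      { apply locally_interval; lra. }
      revert Hloc. apply filter_imp. intros u Hu. unfold cpt. rewrite clamp_id by lra. reflexivity. }
    unfold G, cpt. rewrite clamp_id by lra. destruct (Hg _ Hin) as [-> ->].
    apply (has_partials_comp (open_triangle l) ltac:(intros; now apply open_triangle_open)
             q _ _ (fun t => inradius l * normal_x j + s * - normal_y j + t * normal_x j)
             (fun t => inradius l * normal_y j + s * normal_x j + t * normal_y j) t _ _ Hq Hin);
      auto_derive; auto; ring. }
  unfold is_normal_derivative. rewrite <- Hc0. change (filterlim (fun t : R =>
    (q (cpt 0 + t * outward_normal j)%C - q (cpt 0)) / t) (at_left 0) (locally (G 0))).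
  apply filterlim_locally. intros eps.
  apply filterlim_locally with (eps := eps) in HG. destruct HG as [d1 Hd1].
  assert (Hmin : 0 < Rmin d1 de) by (apply Rmin_pos; auto; apply cond_pos).
  exists (mkposreal _ Hmin). intros t Ht Ht0.
  change (Rabs (t - 0) < Rmin d1 de) in Ht. rewrite Rminus_0_r, Rabs_left in Ht by auto.
  pose proof (Rmin_l d1 de). pose proof (Rmin_r d1 de).
  destruct (MVT_gen (fun t => q (cpt t)) t 0 G) as [c [Hc Ec]].
  { rewrite Rmin_left, Rmax_right by lra. intros u Hu. apply HDer. lra. }
  { intros u _. apply continuity_pt_filterlim. now apply Hcpt. }
  rewrite Rmin_left, Rmax_right in Hc by lra.
  replace ((q (cpt 0 + t * outward_normal j)%C - q (cpt 0)) / t) with (G c).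
  - apply Hd1. change (Rabs (c - 0) < d1). rewrite Rminus_0_r, Rabs_left1 by lra. lra.
  - rewrite Hc0 at 1. rewrite Ept.
    assert (E : cpt t = pt t) by (unfold cpt; rewrite clamp_id by lra; reflexivity).
    rewrite <- E. replace (q (cpt t) - q (cpt 0)) with (G c * t) by lra. field. lra.
Qed.

(** * Complex exponentials and integrals *)

Ltac eq_in_C := match goal with |- @eq _ ?x ?y => change (@eq C x y) end.

Lemma C_eq (z w : C) : Re z = Re w -> Im z = Im w -> z = w.
Proof. intros H1 H2. now apply injective_projections. Qed.

Lemma Cexp_plus (z w : C) : Cexp (z + w)%C = (Cexp z * Cexp w)%C.
Proof.
  unfold Cexp. destruct z as [a b], w as [c d]. cbn -[exp cos sin].
  rewrite exp_plus, cos_plus, sin_plus. apply C_eq; cbn -[exp cos sin]; ring.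
Qed.

Lemma Cexp_0 : Cexp 0 = 1%C.
Proof. unfold Cexp. cbn -[exp cos sin]. rewrite exp_0, cos_0, sin_0. apply C_eq; cbn; ring. Qed.

Lemma Cexp_opp_l (z : C) : (Cexp (- z) * Cexp z)%C = 1%C.
Proof. rewrite <- Cexp_plus. replace (- z + z)%C with (0 : C) by ring. apply Cexp_0. Qed.

Lemma Cmod_Cexp (z : C) : Cmod (Cexp z) = exp (Re z).
Proof.
  unfold Cmod, Cexp. cbn [fst snd].
  replace ((exp (Re z) * cos (Im z)) ^ 2 + (exp (Re z) * sin (Im z)) ^ 2)
    with (exp (Re z) ^ 2 * ((sin (Im z))² + (cos (Im z))²)) by (unfold Rsqr; ring).
  rewrite sin2_cos2, Rmult_1_r. apply sqrt_pow2. left. apply exp_pos.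
Qed.

Lemma continuous_C_fst {U : UniformSpace} (f : U -> C) (x : U) :
  continuous f x -> continuous (fun t => fst (f t)) x.
Proof.
  intros H. apply (continuous_comp f (fst : C -> R)); auto. destruct (f x) as [a b].
  apply (continuous_fst (U := R_UniformSpace) (V := R_UniformSpace)).
Qed.

Lemma continuous_C_snd {U : UniformSpace} (f : U -> C) (x : U) :
  continuous f x -> continuous (fun t => snd (f t)) x.
Proof.
  intros H. apply (continuous_comp f (snd : C -> R)); auto. destruct (f x) as [a b].
  apply (continuous_snd (U := R_UniformSpace) (V := R_UniformSpace)).
Qed.

Lemma continuous_Cplus {U : UniformSpace} (f g : U -> C) (x : U) :
  continuous f x -> continuous g x -> continuous (fun t => (f t + g t)%C) x.
Proof.
  intros Hf Hg. apply continuous_C_pair.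
  - apply (continuous_plus (V := R_NormedModule)); now apply continuous_C_fst.
  - apply (continuous_plus (V := R_NormedModule)); now apply continuous_C_snd.
Qed.

Lemma continuous_Cmult {U : UniformSpace} (f g : U -> C) (x : U) :
  continuous f x -> continuous g x -> continuous (fun t => (f t * g t)%C) x.
Proof.
  intros Hf Hg. apply continuous_C_pair.
  - apply (continuous_minus (V := R_NormedModule)); apply (continuous_mult (K := R_AbsRing));
      now (apply continuous_C_fst || apply continuous_C_snd).
  - apply (continuous_plus (V := R_NormedModule)); apply (continuous_mult (K := R_AbsRing));
      now (apply continuous_C_fst || apply continuous_C_snd).
Qed.

Lemma continuous_RtoC {U : UniformSpace} (f : U -> R) (x : U) :
  continuous f x -> continuous (fun t => RtoC (f t)) x.
Proof.
  intros Hf. apply continuous_C_pair; auto. apply continuous_const.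
Qed.

Lemma continuous_Cexp {U : UniformSpace} (f : U -> C) (x : U) :
  continuous f x -> continuous (fun t => Cexp (f t)) x.
Proof.
  intros Hf. pose proof (continuous_C_fst f x Hf) as H1. pose proof (continuous_C_snd f x Hf) as H2.
  apply continuous_C_pair; apply (continuous_mult (K := R_AbsRing)).
  - apply (continuous_comp (fun t => fst (f t)) exp); auto.
    apply (ex_derive_continuous exp). auto_derive. auto.
  - apply (continuous_comp (fun t => snd (f t)) cos); auto. apply continuous_cos.
  - apply (continuous_comp (fun t => fst (f t)) exp); auto.
    apply (ex_derive_continuous exp). auto_derive. auto.
  - apply (continuous_comp (fun t => snd (f t)) sin); auto. apply continuous_sin.
Qed.

Lemma continuous_Cexp_linear (kap : C) (s : R) : continuous (fun s : R => Cexp (kap * s)) s.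
Proof.
  apply continuous_Cexp, continuous_Cmult; [apply continuous_const|].
  apply continuous_RtoC, continuous_id.
Qed.

Definition CInt (f : R -> C) (a b : R) : C := @RInt C_R_CompleteNormedModule f a b.

Section CInt.

Variables (a b : R).

Lemma is_CInt (f : R -> C) : (forall s, continuous f s) ->
  @is_RInt C_R_NormedModule f a b (CInt f a b).
Proof.
  intros Hf. apply (RInt_correct (V := C_R_CompleteNormedModule)).
  apply (ex_RInt_continuous (V := C_R_CompleteNormedModule)). intros s _. apply Hf.
Qed.

Lemma CInt_pair (f : R -> C) : (forall s, continuous f s) ->
  CInt f a b = (RInt (fun s => Re (f s)) a b, RInt (fun s => Im (f s)) a b).
Proof.
  intros Hf. apply (is_RInt_unique (V := C_R_CompleteNormedModule)).
  apply (is_RInt_fct_extend_pair (U := R_NormedModule) (V := R_NormedModule) f a b);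
    apply (RInt_correct (V := R_CompleteNormedModule));
    apply (ex_RInt_continuous (V := R_CompleteNormedModule)); intros s _.
  - now apply continuous_C_fst.
  - now apply continuous_C_snd.
Qed.

Lemma CInt_ext (f g : R -> C) :
  (forall s, Rmin a b < s < Rmax a b -> f s = g s) -> CInt f a b = CInt g a b.
Proof. apply (RInt_ext (V := C_R_CompleteNormedModule)). Qed.

Lemma CInt_plus (f g : R -> C) : (forall s, continuous f s) -> (forall s, continuous g s) ->
  CInt (fun s => f s + g s)%C a b = (CInt f a b + CInt g a b)%C.
Proof.
  intros Hf Hg. apply (is_RInt_unique (V := C_R_CompleteNormedModule)).
  apply (is_RInt_plus (V := C_R_NormedModule) f g); now apply is_CInt.
Qed.

(** The integral is taken in C as a real normed module, so a complex factor is pulled out through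
    real and imaginary parts. *)
Lemma CInt_Cmult (c : C) (f : R -> C) : (forall s, continuous f s) ->
  CInt (fun s => c * f s)%C a b = (c * CInt f a b)%C.
Proof.
  intros Hf. rewrite !CInt_pair; auto.
  2:{ intros s. apply continuous_Cmult; [apply continuous_const|apply Hf]. }
  assert (H1 : is_RInt (fun s => Re (f s)) a b (RInt (fun s => Re (f s)) a b)).
  { apply (RInt_correct (V := R_CompleteNormedModule)).
    apply (ex_RInt_continuous (V := R_CompleteNormedModule)). intros s _. now apply continuous_C_fst. }
  assert (H2 : is_RInt (fun s => Im (f s)) a b (RInt (fun s => Im (f s)) a b)).
  { apply (RInt_correct (V := R_CompleteNormedModule)).
    apply (ex_RInt_continuous (V := R_CompleteNormedModule)). intros s _. now apply continuous_C_snd. }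
  destruct c as [c1 c2]. apply C_eq; cbn [Re Im fst snd Cmult].
  - apply is_RInt_unique.
    apply (is_RInt_minus (V := R_NormedModule) (fun s => scal c1 (Re (f s))) (fun s => scal c2 (Im (f s))));
      now apply (is_RInt_scal (V := R_NormedModule)).
  - apply is_RInt_unique.
    apply (is_RInt_plus (V := R_NormedModule) (fun s => scal c1 (Im (f s))) (fun s => scal c2 (Re (f s))));
      now apply (is_RInt_scal (V := R_NormedModule)).
Qed.

(** The factor 2 absorbs the sqrt 2 lost by estimating the two components separately; only the order
    of magnitude matters later. *)
Lemma Cmod_CInt_le (f : R -> C) (M : R) : a <= b -> (forall s, continuous f s) ->
  (forall s, a <= s <= b -> Cmod (f s) <= M) -> Cmod (CInt f a b) <= 2 * ((b - a) * M).
Proof.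
  intros Hab Hf HM. rewrite CInt_pair by auto.
  eapply Rle_trans; [apply Cmod_2Rmax|]. cbn [fst snd].
  assert (H1 : Rabs (RInt (fun s => Re (f s)) a b) <= (b - a) * M).
  { apply abs_RInt_le_const; auto.
    - apply (ex_RInt_continuous (V := R_CompleteNormedModule)). intros s _. now apply continuous_C_fst.
    - intros s Hs. eapply Rle_trans; [|apply HM, Hs]. eapply Rle_trans; [apply Rmax_l|apply Rmax_Cmod]. }
  assert (H2 : Rabs (RInt (fun s => Im (f s)) a b) <= (b - a) * M).
  { apply abs_RInt_le_const; auto.
    - apply (ex_RInt_continuous (V := R_CompleteNormedModule)). intros s _. now apply continuous_C_snd.
    - intros s Hs. eapply Rle_trans; [|apply HM, Hs]. eapply Rle_trans; [apply Rmax_r|apply Rmax_Cmod]. }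
  assert (Hs2 : sqrt 2 <= 2).
  { rewrite <- (sqrt_square 2) at 2 by lra. apply sqrt_le_1_alt. lra. }
  pose proof (sqrt_pos 2).
  assert (Hm : Rmax (Rabs (RInt (fun s => Re (f s)) a b)) (Rabs (RInt (fun s => Im (f s)) a b))
               <= (b - a) * M) by now apply Rmax_lub.
  assert (Hm0 : 0 <= Rmax (Rabs (RInt (fun s => Re (f s)) a b)) (Rabs (RInt (fun s => Im (f s)) a b))).
  { eapply Rle_trans; [apply Rabs_pos|apply Rmax_l]. }
  apply Rmult_le_compat; auto.
Qed.

(** The integrand is the derivative of exp(kap s) h(s). In this form integration by parts needs no
    division by [kap] and holds for [kap = 0] too. *)
Lemma CInt_exp_parts (kap : C) (h h' : R -> R) :
  (forall s, is_derive h s (h' s)) -> (forall s, continuous h' s) ->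
  CInt (fun s => Cexp (kap * s) * (kap * h s + h' s))%C a b =
  (Cexp (kap * b) * h b - Cexp (kap * a) * h a)%C.
Proof.
  intros Hd Hc.
  assert (Hh : forall s, continuous h s).
  { intros s. apply (ex_derive_continuous h). eexists; apply Hd. }
  assert (Hcont : forall s, continuous (fun s : R => (Cexp (kap * s) * (kap * h s + h' s))%C) s).
  { intros s. apply continuous_Cmult; [apply continuous_Cexp_linear|].
    apply continuous_Cplus; [apply continuous_Cmult; [apply continuous_const|]|];
      now apply continuous_RtoC. }
  rewrite CInt_pair by auto. destruct kap as [k1 k2].
  assert (Er : forall s : R, Re (Cexp ((k1, k2) * s)%C * h s)%C = exp (k1 * s) * cos (k2 * s) * h s).
  { intros s. unfold Cexp. cbn -[exp cos sin].
    replace (k1 * s - k2 * 0) with (k1 * s) by ring. replace (k1 * 0 + k2 * s) with (k2 * s) by ring. ring. }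
  assert (Ei : forall s : R, Im (Cexp ((k1, k2) * s)%C * h s)%C = exp (k1 * s) * sin (k2 * s) * h s).
  { intros s. unfold Cexp. cbn -[exp cos sin].
    replace (k1 * s - k2 * 0) with (k1 * s) by ring. replace (k1 * 0 + k2 * s) with (k2 * s) by ring. ring. }
  assert (Dh : forall s, ex_derive h s /\ Derive h s = h' s).
  { intros s. split; [eexists; apply Hd|now apply is_derive_unique]. }
  apply C_eq.
  - transitivity (exp (k1 * b) * cos (k2 * b) * h b - exp (k1 * a) * cos (k2 * a) * h a).
    2:{ rewrite <- !Er. reflexivity. }
    cbn [Re fst]. apply is_RInt_unique.
    apply (is_RInt_derive (V := R_CompleteNormedModule) (fun s => exp (k1 * s) * cos (k2 * s) * h s)).
    + intros s _. destruct (Dh s) as [D1 D2]. auto_derive; auto. change (Derive (fun x => h x) s) with (Derive h s).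
      rewrite D2. unfold Cexp.
      cbn -[exp cos sin]. replace (k1 * s - k2 * 0) with (k1 * s) by ring.
      replace (k1 * 0 + k2 * s) with (k2 * s) by ring. ring.
    + intros s _. now apply continuous_C_fst.
  - transitivity (exp (k1 * b) * sin (k2 * b) * h b - exp (k1 * a) * sin (k2 * a) * h a).
    2:{ rewrite <- !Ei. reflexivity. }
    cbn [Im snd]. apply is_RInt_unique.
    apply (is_RInt_derive (V := R_CompleteNormedModule) (fun s => exp (k1 * s) * sin (k2 * s) * h s)).
    + intros s _. destruct (Dh s) as [D1 D2]. auto_derive; auto. change (Derive (fun x => h x) s) with (Derive h s).
      rewrite D2. unfold Cexp.
      cbn -[exp cos sin]. replace (k1 * s - k2 * 0) with (k1 * s) by ring.
      replace (k1 * 0 + k2 * s) with (k2 * s) by ring. ring.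
    + intros s _. now apply continuous_C_snd.
Qed.

End CInt.

(** * Plane waves as test functions in Green's formula *)

Section PlaneWave.

Variables (A B : C).

Definition plane_wave (z : C) : C := Cexp (A * Re z + B * Im z).
(** Green's formula above is for real functions. Real parts with a free complex coefficient form a
    family stable under differentiation, since the partials multiply c by A or B; the coefficients 1
    and - i give back the real and imaginary parts of the wave. *)
Definition wave_part (c : C) (z : C) : R := Re (c * plane_wave z).

Lemma is_derive_wave_x (c z : C) :
  is_derive (fun x => wave_part c (x, Im z)) (Re z) (wave_part (c * A) z).
Proof.
  destruct c as [c1 c2], z as [x y]. unfold wave_part, plane_wave, Cexp.
  destruct A as [A1 A2], B as [B1 B2]. cbn -[exp cos sin].
  auto_derive; auto. unfold Rminus. ring.
Qed.

Lemma is_derive_wave_y (c z : C) :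
  is_derive (fun y => wave_part c (Re z, y)) (Im z) (wave_part (c * B) z).
Proof.
  destruct c as [c1 c2], z as [x y]. unfold wave_part, plane_wave, Cexp.
  destruct A as [A1 A2], B as [B1 B2]. cbn -[exp cos sin].
  auto_derive; auto. unfold Rminus. ring.
Qed.

Lemma partial_x_wave (c : C) : partial_x (wave_part c) = wave_part (c * A).
Proof.
  apply functional_extensionality. intros z. apply is_derive_unique, is_derive_wave_x.
Qed.

Lemma partial_y_wave (c : C) : partial_y (wave_part c) = wave_part (c * B).
Proof.
  apply functional_extensionality. intros z. apply is_derive_unique, is_derive_wave_y.
Qed.

Lemma continuous_plane_wave (z : C) : continuous plane_wave z.
Proof.
  apply continuous_Cexp. apply continuous_Cplus; apply continuous_Cmult;
    try apply continuous_const; apply continuous_RtoC.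
  - apply (continuous_C_fst (fun z : C => z)), continuous_id.
  - apply (continuous_C_snd (fun z : C => z)), continuous_id.
Qed.

Lemma continuous_wave_part (c z : C) : continuous (wave_part c) z.
Proof.
  apply (continuous_C_fst (fun z => (c * plane_wave z)%C)).
  apply continuous_Cmult; [apply continuous_const|apply continuous_plane_wave].
Qed.

Lemma C2_in_wave (c : C) : C2_in (fun _ => True) (wave_part c).
Proof.
  assert (H : forall c, C1_in (fun _ => True) (wave_part c)).
  { clear c. intros c z _. rewrite partial_x_wave, partial_y_wave.
    split; [eexists; apply is_derive_wave_x|]. split; [eexists; apply is_derive_wave_y|].
    split; apply continuous_wave_part. }
  unfold C2_in. rewrite partial_x_wave, partial_y_wave. auto.
Qed.

End PlaneWave.

Section ExpGreen.

Variables (l lam : R) (q gx gy : C -> R).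
Hypothesis Hl : 0 < l.
Hypothesis Hq2 : C2_in (open_triangle l) q.
Hypothesis Hpde : forall z : C, open_triangle l z ->
  partial_x (partial_x q) z + partial_y (partial_y q) z - 4 * lam * q z = 0.
Hypothesis Hqc : continuous_on (closed_triangle l) q.
Hypothesis Hgx : continuous_on (closed_triangle l) gx.
Hypothesis Hgy : continuous_on (closed_triangle l) gy.
Hypothesis Hg : forall z, open_triangle l z -> gx z = partial_x q z /\ gy z = partial_y q z.

Definition neumann (j : side) (s : R) : R :=
  gx (side_point l j (clamp (- (l / 2)) (l / 2) s)) * normal_x j
  + gy (side_point l j (clamp (- (l / 2)) (l / 2) s)) * normal_y j.

Lemma continuous_neumann (j : side) (s : R) : continuous (neumann j) s.
Proof.
  assert (H : forall F : C -> R, continuous_on (closed_triangle l) F ->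
     continuous (fun s => F (side_point l j (clamp (- (l / 2)) (l / 2) s))) s).
  { intros F HF. apply continuous_on_comp with (closed_triangle l); auto.
    - intros t. apply side_point_in_closed; auto. apply clamp_range. lra.
    - apply continuous_ext with
        (fun s => (inradius l * normal_x j + clamp (- (l / 2)) (l / 2) s * - normal_y j,
                   inradius l * normal_y j + clamp (- (l / 2)) (l / 2) s * normal_x j) : C).
      { intros t. now rewrite side_point_eq. }
      apply continuous_C_pair; apply (continuous_plus (V := R_NormedModule));
        try apply continuous_const; apply (continuous_mult (K := R_AbsRing));
        try apply continuous_const; apply continuous_clamp. }
  apply (continuous_plus (V := R_NormedModule)); apply (continuous_mult (K := R_AbsRing));
    try apply continuous_const; now apply H.
Qed.

Variable fe : side -> R -> R.
Hypothesis Hfc : forall j s, continuous (fe j) s.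
Hypothesis Hfe : forall j s, - (l / 2) <= s <= l / 2 -> q (side_point l j s) = fe j s.

(** A^2 + B^2 = 4 lam says that exp(A x + B y) solves the equation. [a j] and [b j] are the
    components of (A, B) along the normal and the tangent of side j, so on that side the wave is
    exp(inradius a_j) exp(b_j s) and its normal derivative is a_j times it. *)
Lemma exp_green (A B : C) : (A * A + B * B = 4 * lam)%C ->
  let a j := (A * normal_x j + B * normal_y j)%C in
  let b j := (B * normal_x j - A * normal_y j)%C in
  let flux j := (Cexp (inradius l * a j)
      * CInt (fun s => Cexp (b j * s) * (neumann j s - a j * fe j s)) (- (l / 2)) (l / 2))%C in
  (flux side1 + flux side2 + flux side3 = 0)%C.
Proof.
  intros HAB a b flux.
  set (integrand := fun j (s : R) =>
     (Cexp (inradius l * a j) * (Cexp (b j * s) * (neumann j s - a j * fe j s)))%C).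
  assert (Hcont0 : forall j s, continuous
            (fun s : R => (Cexp (b j * s) * (neumann j s - a j * fe j s))%C) s).
  { intros j s. apply continuous_Cmult; [apply continuous_Cexp_linear|].
    apply continuous_ext with (fun s : R => (neumann j s + (- a j) * fe j s)%C).
    { intros t. eq_in_C. ring. }
    apply continuous_Cplus; [apply continuous_RtoC, continuous_neumann|].
    apply continuous_Cmult; [apply continuous_const|apply continuous_RtoC, Hfc]. }
  assert (Hcont : forall j s, continuous (integrand j) s).
  { intros j s. apply continuous_Cmult; [apply continuous_const|apply Hcont0]. }
  assert (E : forall j, flux j = CInt (integrand j) (- (l / 2)) (l / 2)).
  { intros j. symmetry. apply (CInt_Cmult (- (l / 2)) (l / 2)). apply Hcont0. }
  assert (Hw : forall c : C,
     RInt (fun s => Re (c * integrand side1 s)) (- (l / 2)) (l / 2)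
     + RInt (fun s => Re (c * integrand side2 s)) (- (l / 2)) (l / 2)
     + RInt (fun s => Re (c * integrand side3 s)) (- (l / 2)) (l / 2) = 0).
  { intros c.
    pose proof (green_triangle l lam q gx gy (wave_part A B c) Hl Hq2 Hpde Hqc Hgx Hgy Hg
                  (C2_in_wave A B c)) as G.
    cbv zeta in G.
    rewrite partial_x_wave, partial_y_wave, partial_x_wave, partial_y_wave in G.
    assert (Ej : forall j, RInt (fun s => Re (c * integrand j s)) (- (l / 2)) (l / 2) =
      RInt (fun s => wave_part A B c (side_point l j s) *
         (gx (side_point l j s) * normal_x j + gy (side_point l j s) * normal_y j) -
         q (side_point l j s) * (wave_part A B (c * A) (side_point l j s) * normal_x j
                                 + wave_part A B (c * B) (side_point l j s) * normal_y j))
       (- (l / 2)) (l / 2)).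
    { intros j. apply RInt_ext. rewrite Rmin_left, Rmax_right by lra. intros s Hs.
      rewrite Hfe by lra.
      assert (Ew : plane_wave A B (side_point l j s) = (Cexp (inradius l * a j) * Cexp (b j * s))%C).
      { rewrite <- Cexp_plus. unfold plane_wave. f_equal. rewrite side_point_eq. cbn [Re Im fst snd].
        unfold a, b. rewrite !RtoC_plus, !RtoC_mult, RtoC_opp. ring. }
      assert (Ei : integrand j s = (plane_wave A B (side_point l j s) * (neumann j s - a j * fe j s))%C).
      { rewrite Ew. unfold integrand. ring. }
      rewrite Ei. unfold wave_part, neumann.
      rewrite clamp_id by lra. unfold a.
      destruct (plane_wave A B (side_point l j s)) as [e1 e2].
      destruct c as [c1 c2], A as [A1 A2], B as [B1 B2]. eq_in_R. simpl. ring. }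
    rewrite !Ej. apply G.
    intros z. unfold wave_part.
    assert (HAB' : (c * A * A + c * B * B = c * (4 * lam))%C) by (rewrite <- HAB; ring).
    pose proof (f_equal Re HAB') as H1. pose proof (f_equal Im HAB') as H2.
    destruct (plane_wave A B z) as [e1 e2].
    set (cAA := (c * A * A)%C) in *. set (cBB := (c * B * B)%C) in *.
    destruct cAA as [x1 x2], cBB as [y1 y2], c as [c1 c2]. simpl in *. nra. }
  rewrite !E, !CInt_pair by auto.
  pose proof (Hw 1) as H1. pose proof (Hw (- Ci)%C) as H2.
  assert (E1 : forall j, RInt (fun s => Re (1 * integrand j s)%C) (- (l / 2)) (l / 2)
                = RInt (fun s => Re (integrand j s)) (- (l / 2)) (l / 2)).
  { intros j. apply RInt_ext. intros s _. now rewrite Cmult_1_l. }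
  assert (E2 : forall j, RInt (fun s => Re (- Ci * integrand j s)%C) (- (l / 2)) (l / 2)
                = RInt (fun s => Im (integrand j s)) (- (l / 2)) (l / 2)).
  { intros j. apply RInt_ext. intros s _. destruct (integrand j s) as [e1 e2]. eq_in_R. simpl. ring. }
  rewrite !E1 in H1. rewrite !E2 in H2. apply C_eq; simpl; assumption.
Qed.

End ExpGreen.

(** * Global relations *)

Lemma Ci_sqr : (Ci * Ci = - (1))%C.
Proof. apply C_eq; simpl; ring. Qed.

Lemma Cmult_reg_l (c a b : C) : c <> 0%C -> (c * a = c * b)%C -> a = b.
Proof.
  intros Hc H. transitivity (/ c * (c * a))%C; [field; auto|].
  rewrite H. field. auto.
Qed.

Lemma alpha_sqr : (alpha * alpha = alphab)%C.
Proof.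
  rewrite alpha_eq, alphab_eq. pose proof sqrt3_sqr. apply C_eq; simpl; nra.
Qed.

Lemma alphab_sqr : (alphab * alphab = alpha)%C.
Proof.
  rewrite alpha_eq, alphab_eq. pose proof sqrt3_sqr. apply C_eq; simpl; nra.
Qed.

Lemma alpha_alphab : (alpha * alphab = 1)%C.
Proof.
  rewrite alpha_eq, alphab_eq. pose proof sqrt3_sqr. apply C_eq; simpl; nra.
Qed.

Lemma alpha_neq_0 : alpha <> 0%C.
Proof. intros H. pose proof alpha_alphab as E. rewrite H, Cmult_0_l in E. injection E. lra. Qed.

Lemma alphab_neq_0 : alphab <> 0%C.
Proof. intros H. pose proof alpha_alphab as E. rewrite H, Cmult_0_r in E. injection E. lra. Qed.

Lemma div_alpha (c k : C) : k <> 0%C -> (c / (alpha * k) = alphab * (c / k))%C.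
Proof.
  intros Hk. pose proof alpha_neq_0. apply (Cmult_reg_l alpha); auto.
  rewrite (Cmult_assoc alpha alphab), alpha_alphab. field. auto.
Qed.

Lemma div_alphab (c k : C) : k <> 0%C -> (c / (alphab * k) = alpha * (c / k))%C.
Proof.
  intros Hk. pose proof alphab_neq_0. apply (Cmult_reg_l alphab); auto.
  rewrite (Cmult_assoc alphab alpha), (Cmult_comm alphab alpha), alpha_alphab. field. auto.
Qed.

Lemma kfreq_opp (lam : R) (k : C) : k <> 0%C -> (kfreq lam (- k) = - kfreq lam k)%C.
Proof.
  intros Hk. unfold kfreq. field. auto.
Qed.

(* [exp (- i k z + i (lam / k) zbar) = exp (nfreq k * x + kfreq k * y)] for [z = x + i y]. *)
Definition nfreq (lam : R) (k : C) : C := (- Ci * (k - lam / k))%C.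

(** With [nfreq_alphab], this expresses the normal factors exp(inradius nfreq) at the rotated
    frequencies as the factor at k times values of [efun]. Within each global relation that factor
    at k then becomes common to all terms. *)
Lemma nfreq_alpha (l lam : R) (k : C) : k <> 0%C ->
  (inradius l * nfreq lam (alpha * k)
   = inradius l * nfreq lam k - kfreq lam (alphab * k) * (l / 2)%R)%C.
Proof.
  intros Hk. unfold kfreq, nfreq. rewrite div_alpha, div_alphab, half_side_inradius by auto.
  generalize (lam / k)%C. intros m. rewrite alpha_eq, alphab_eq.
  destruct k as [k1 k2], m as [m1 m2]. pose proof sqrt3_sqr as H33.
  set (t := sqrt 3) in *. set (d := inradius l).
  apply C_eq; simpl; field_simplify; replace (t ^ 2) with 3 by (simpl; lra); field.
Qed.

Lemma nfreq_alphab (l lam : R) (k : C) : k <> 0%C ->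
  (inradius l * nfreq lam (alphab * k)
   = inradius l * nfreq lam k - kfreq lam k * (l / 2)%R - kfreq lam (alphab * k) * (l / 2)%R)%C.
Proof.
  intros Hk. unfold kfreq, nfreq. rewrite !div_alphab, half_side_inradius by auto.
  generalize (lam / k)%C. intros m. rewrite alpha_eq, alphab_eq.
  destruct k as [k1 k2], m as [m1 m2]. pose proof sqrt3_sqr as H33.
  set (t := sqrt 3) in *. set (d := inradius l).
  apply C_eq; simpl; field_simplify; replace (t ^ 2) with 3 by (simpl; lra); field.
Qed.

Lemma Cexp_pow (z : C) (n : nat) : Cpow (Cexp z) n = Cexp (INR n * z).
Proof.
  induction n as [|n IH].
  - simpl. rewrite Cmult_0_l, Cexp_0. reflexivity.
  - cbn [Cpow]. rewrite IH, S_INR, <- Cexp_plus. f_equal. rewrite RtoC_plus. ring.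
Qed.

Lemma Cexp_neq_0 (z : C) : Cexp z <> 0%C.
Proof. intros H. pose proof (Cexp_opp_l z) as E. rewrite H, Cmult_0_r in E. injection E. lra. Qed.

Lemma CpowZ_Cexp (z : C) (m : Z) : CpowZ (Cexp z) m = Cexp (IZR m * z).
Proof.
  destruct m as [|p|p]; cbn [CpowZ].
  - rewrite Cmult_0_l, Cexp_0. reflexivity.
  - rewrite Cexp_pow, INR_IZR_INZ, positive_nat_Z. reflexivity.
  - rewrite Cexp_pow, INR_IZR_INZ, positive_nat_Z.
    apply (Cmult_reg_l (Cexp (IZR (Zpos p) * z))); [apply Cexp_neq_0|].
    rewrite Cinv_r by apply Cexp_neq_0. rewrite <- Cexp_plus.
    replace (IZR (Zneg p)) with (- IZR (Zpos p)) by (rewrite <- opp_IZR; reflexivity).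
    rewrite <- Cexp_0. f_equal. rewrite RtoC_opp. ring.
Qed.

Lemma Cexp_2PI (m : Z) : Cexp (2 * Ci * PI * IZR m) = 1%C.
Proof.
  unfold Cexp. replace (2 * Ci * PI * IZR m)%C with ((0, 2 * IZR m * PI) : C).
  2:{ apply C_eq; simpl; ring. }
  cbn [Re Im fst snd]. rewrite exp_0.
  assert (Hs : sin (2 * IZR m * PI) = 0).
  { apply sin_eq_0_1. exists (2 * m)%Z. rewrite mult_IZR. ring. }
  assert (Hc : cos (2 * IZR m * PI) = 1).
  { replace (2 * IZR m * PI) with (2 * (IZR m * PI)) by ring.
    rewrite cos_2a_sin, (sin_eq_0_1 (IZR m * PI)); [ring|]. now exists m. }
  rewrite Hs, Hc. apply C_eq; simpl; ring.
Qed.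

(* With G1, ..., G6 the six relations, [G1 + y^2 G2 + Y^2 G3] and [G4 + Y^2 G5 + y^2 G6] involve
   the same three unknowns; multiplying them by [y^2 V] and [- v] and adding eliminates those at
   alpha k and alphab k simultaneously. *)
Lemma neumann_elimination
  (a a' y Y v V N1 N2 N3 N1a N2a N3a N1b N2b N3b F1 F2 F3 F1a F2a F3a F1b F2b F3b : C) :
  a <> 0%C -> a' <> 0%C ->
  (y * Y = 1)%C -> (v * V = 1)%C -> (y * y * y = Y * Y * Y)%C ->
  (a * (N1 - 2 * Ci * F1) + a * (y * v) * (N2b - 2 * Ci * F2b) + a * v * (N3a - 2 * Ci * F3a) = 0)%C ->
  (a * v * (N1a - 2 * Ci * F1a) + a * (N2 - 2 * Ci * F2) + a * (y * v) * (N3b - 2 * Ci * F3b) = 0)%C ->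
  (a * (y * v) * (N1b - 2 * Ci * F1b) + a * v * (N2a - 2 * Ci * F2a) + a * (N3 - 2 * Ci * F3) = 0)%C ->
  (a' * (N1 + 2 * Ci * F1) + a' * V * (N2a + 2 * Ci * F2a) + a' * (Y * V) * (N3b + 2 * Ci * F3b) = 0)%C ->
  (a' * V * (N1a + 2 * Ci * F1a) + a' * (Y * V) * (N2b + 2 * Ci * F2b) + a' * (N3 + 2 * Ci * F3) = 0)%C ->
  (a' * (Y * V) * (N1b + 2 * Ci * F1b) + a' * (N2 + 2 * Ci * F2) + a' * V * (N3a + 2 * Ci * F3a) = 0)%C ->
  ((N1 + y ^ 2 * N2 + Y ^ 2 * N3) * (y * y * V - v) =
   2 * Ci *
   ((y ^ 2 * V + v) * (F1 + y ^ 2 * F2 + Y ^ 2 * F3)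
    + 2 * Y ^ 2 * (F1a + y ^ 2 * F2a + Y ^ 2 * F3a)
    + 2 * y * (F1b + y ^ 2 * F2b + Y ^ 2 * F3b)))%C.
Proof.
  intros Ha Ha' HyY HvV Hy3 G1 G2 G3 G4 G5 G6.
  (* The relations y Y = 1 and y^3 = Y^3 make y a sixth root of unity; the next equalities are the
     reductions of monomials used below. *)
  assert (H4 : (y * y * y * y = Y * Y)%C).
  { rewrite Hy3. transitivity (Y * Y * (y * Y))%C; [ring|]. rewrite HyY. ring. }
  assert (H5 : (y * y * y * y * y = Y)%C).
  { rewrite H4. transitivity (Y * (y * Y))%C; [ring|]. rewrite HyY. ring. }
  assert (H22 : (y * y * Y * Y = 1)%C).
  { transitivity (y * Y * (y * Y))%C; [ring|]. rewrite HyY. ring. }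
  assert (H32 : (y * y * y * Y * Y = y)%C).
  { transitivity (y * (y * y * Y * Y))%C; [ring|]. rewrite H22. ring. }
  assert (H21 : (y * y * Y = y)%C).
  { transitivity (y * (y * Y))%C; [ring|]. rewrite HyY. ring. }
  assert (HY4 : (Y * Y * Y * Y = y * y)%C).
  { rewrite <- Hy3. transitivity (y * y * (y * Y))%C; [ring|]. rewrite HyY. ring. }
  assert (HYy : (Y * Y * y * y = 1)%C) by (rewrite <- H22; ring).
  assert (G1' : (N1 - 2 * Ci * F1 + v * (N3a - 2 * Ci * F3a) + v * (y * (N2b - 2 * Ci * F2b)) = 0)%C)
    by (apply (Cmult_reg_l a); auto; rewrite Cmult_0_r, <- G1; ring).
  assert (G2' : (N2 - 2 * Ci * F2 + v * (N1a - 2 * Ci * F1a) + v * (y * (N3b - 2 * Ci * F3b)) = 0)%C)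
    by (apply (Cmult_reg_l a); auto; rewrite Cmult_0_r, <- G2; ring).
  assert (G3' : (N3 - 2 * Ci * F3 + v * (N2a - 2 * Ci * F2a) + v * (y * (N1b - 2 * Ci * F1b)) = 0)%C)
    by (apply (Cmult_reg_l a); auto; rewrite Cmult_0_r, <- G3; ring).
  assert (G4' : (N1 + 2 * Ci * F1 + V * (N2a + 2 * Ci * F2a) + V * (Y * (N3b + 2 * Ci * F3b)) = 0)%C)
    by (apply (Cmult_reg_l a'); auto; rewrite Cmult_0_r, <- G4; ring).
  assert (G5' : (N3 + 2 * Ci * F3 + V * (N1a + 2 * Ci * F1a) + V * (Y * (N2b + 2 * Ci * F2b)) = 0)%C)
    by (apply (Cmult_reg_l a'); auto; rewrite Cmult_0_r, <- G5; ring).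
  assert (G6' : (N2 + 2 * Ci * F2 + V * (N3a + 2 * Ci * F3a) + V * (Y * (N1b + 2 * Ci * F1b)) = 0)%C)
    by (apply (Cmult_reg_l a'); auto; rewrite Cmult_0_r, <- G6; ring).
  clear G1 G2 G3 G4 G5 G6.
  set (am1 := (N1a - 2 * Ci * F1a)%C) in *. set (am2 := (N2a - 2 * Ci * F2a)%C) in *.
  set (am3 := (N3a - 2 * Ci * F3a)%C) in *. set (bm1 := (N1b - 2 * Ci * F1b)%C) in *.
  set (bm2 := (N2b - 2 * Ci * F2b)%C) in *. set (bm3 := (N3b - 2 * Ci * F3b)%C) in *.
  set (ap1 := (N1a + 2 * Ci * F1a)%C) in *. set (ap2 := (N2a + 2 * Ci * F2a)%C) in *.
  set (ap3 := (N3a + 2 * Ci * F3a)%C) in *. set (bp1 := (N1b + 2 * Ci * F1b)%C) in *.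
  set (bp2 := (N2b + 2 * Ci * F2b)%C) in *. set (bp3 := (N3b + 2 * Ci * F3b)%C) in *.
  assert (E1 : (y * y * V * (N1 - 2 * Ci * F1 + y * y * (N2 - 2 * Ci * F2) + Y * Y * (N3 - 2 * Ci * F3))
     = - (y * y * am3 + Y * Y * am1 + am2 + y * y * y * bm2 + Y * bm3 + y * bm1))%C).
  { transitivity (- (v * V) * (y * y * am3 + y * y * y * y * am1 + y * y * Y * Y * am2
       + y * y * y * bm2 + y * y * y * y * y * bm3 + y * y * y * Y * Y * bm1)
     + y * y * V * ((N1 - 2 * Ci * F1 + v * am3 + v * (y * bm2))
       + y * y * (N2 - 2 * Ci * F2 + v * am1 + v * (y * bm3))
       + Y * Y * (N3 - 2 * Ci * F3 + v * am2 + v * (y * bm1))))%C; [ring|].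
    rewrite G1', G2', G3', HvV, H5, H4, H22, H32. ring. }
  assert (E2 : (v * (N1 + 2 * Ci * F1 + y * y * (N2 + 2 * Ci * F2) + Y * Y * (N3 + 2 * Ci * F3))
     = - (ap2 + Y * Y * ap1 + y * y * ap3 + Y * bp3 + y * y * y * bp2 + y * bp1))%C).
  { transitivity (- (v * V) * (ap2 + Y * Y * ap1 + y * y * ap3
       + Y * bp3 + Y * Y * Y * bp2 + y * y * Y * bp1)
     + v * ((N1 + 2 * Ci * F1 + V * ap2 + V * (Y * bp3))
       + Y * Y * (N3 + 2 * Ci * F3 + V * ap1 + V * (Y * bp2))
       + y * y * (N2 + 2 * Ci * F2 + V * ap3 + V * (Y * bp1))))%C; [ring|].
    rewrite G4', G5', G6', HvV, <- Hy3, H21. ring. }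
  (* In [E1] minus [E2] the unknowns at alpha k and alphab k cancel, while the F there have opposite
     signs in the two and add up. This is the origin of the coefficients 2 in X. *)
  transitivity (y * y * V * (N1 - 2 * Ci * F1 + y * y * (N2 - 2 * Ci * F2) + Y * Y * (N3 - 2 * Ci * F3))
    - v * (N1 + 2 * Ci * F1 + y * y * (N2 + 2 * Ci * F2) + Y * Y * (N3 + 2 * Ci * F3))
    + 2 * Ci * (y * y * V + v) * (F1 + y * y * F2 + Y * Y * F3))%C; [simpl Cpow; ring|].
  rewrite E1, E2. unfold am1, am2, am3, bm1, bm2, bm3, ap1, ap2, ap3, bp1, bp2, bp3.
  transitivity (2 * Ci * ((y * y * V + v) * (F1 + y * y * F2 + Y * Y * F3)
    + 2 * (Y * Y * F1a + Y * Y * y * y * F2a + Y * Y * Y * Y * F3a)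
    + 2 * (y * F1b + y * y * y * F2b + y * Y * Y * F3b)))%C; [|simpl Cpow; ring].
  rewrite HYy, HY4. replace (y * Y * Y)%C with Y by (rewrite HyY; ring). ring.
Qed.

Section GlobalRelation.

Variables (l lam : R) (f g fe fe' : side -> R -> R).
Hypothesis Hl : 0 < l.
Hypothesis Hg : forall j s, continuous (g j) s.
Hypothesis Hfe : forall j s, is_derive (fe j) s (fe' j s).
Hypothesis Hfe' : forall j s, continuous (fe' j) s.
Hypothesis Hf : forall j s, - (l / 2) < s < l / 2 -> f j s = fe j s /\ Derive (f j) s = fe' j s.
Hypothesis Hv12 : fe side1 (- (l / 2)) = fe side2 (l / 2).
Hypothesis Hv23 : fe side2 (- (l / 2)) = fe side3 (l / 2).
Hypothesis Hv31 : fe side3 (- (l / 2)) = fe side1 (l / 2).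
Hypothesis Hgreen : forall A B : C, (A * A + B * B = 4 * lam)%C ->
  let a j := (A * normal_x j + B * normal_y j)%C in
  let b j := (B * normal_x j - A * normal_y j)%C in
  let flux j := (Cexp (inradius l * a j)
      * CInt (fun s => Cexp (b j * s) * (g j s - a j * fe j s)) (- (l / 2)) (l / 2))%C in
  (flux side1 + flux side2 + flux side3 = 0)%C.

Definition transform (j : side) (kap : C) : C :=
  CInt (fun s => Cexp (kap * s) * g j s)%C (- (l / 2)) (l / 2).

Let N (j : side) (k : C) : C := transform j (kfreq lam k).
Let F (j : side) (k : C) : C := Ffun l lam f j k.

(** At the ends of the segment [Derive (f j)] depends on values of f off the segment. The integral
    sees interior points only, and there f agrees with its smooth extension [fe]. *)
Lemma Ffun_CInt (j : side) (k : C) :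
  F j k = CInt (fun s => Cexp (kfreq lam k * s) * ((1 / 2 * fe' j s)%R + lam / k * fe j s))%C
            (- (l / 2)) (l / 2).
Proof.
  apply CInt_ext. rewrite Rmin_left, Rmax_right by lra. intros s Hs.
  destruct (Hf j s Hs) as [-> ->]. reflexivity.
Qed.

Lemma continuous_fe (j : side) (s : R) : continuous (fe j) s.
Proof. apply (ex_derive_continuous (fe j)). eexists; apply Hfe. Qed.

(** Since - nfreq = i (k - lam/k) = i kfreq - 2 i lam/k, the Dirichlet term equals sg i (kfreq f +
    f') - 2 i sg (f'/2 + lam/k f). The first part is integrated to boundary values; the second is
    the integrand of F_j. *)
Lemma side_integral (sg k : C) (j : side) :
  CInt (fun s => Cexp (kfreq lam k * s) * (g j s - sg * nfreq lam k * fe j s))%C (- (l / 2)) (l / 2)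
  = (N j k - 2 * Ci * sg * F j k
     + sg * Ci * (Cexp (kfreq lam k * (l / 2)%R) * fe j (l / 2)
                  - Cexp (kfreq lam k * (- (l / 2))%R) * fe j (- (l / 2))))%C.
Proof.
  rewrite <- (CInt_exp_parts (- (l / 2)) (l / 2) (kfreq lam k) (fe j) (fe' j)) by auto.
  rewrite Ffun_CInt. unfold N, transform.
  set (E := fun s : R => Cexp (kfreq lam k * s)).
  assert (HE : forall s, continuous E s) by (intros; apply continuous_Cexp_linear).
  assert (C1 : forall s, continuous (fun s : R => (E s * g j s)%C) s).
  { intros s. apply continuous_Cmult; auto. now apply continuous_RtoC. }
  assert (C2 : forall s, continuous (fun s : R => (E s * ((1 / 2 * fe' j s)%R + lam / k * fe j s))%C) s).
  { intros s. apply continuous_Cmult; auto. apply continuous_Cplus.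
    - apply continuous_RtoC. apply (continuous_mult (K := R_AbsRing)); auto. apply continuous_const.
    - apply continuous_Cmult; [apply continuous_const|apply continuous_RtoC, continuous_fe]. }
  assert (C3 : forall s, continuous (fun s : R => (E s * (kfreq lam k * fe j s + fe' j s))%C) s).
  { intros s. apply continuous_Cmult; auto. apply continuous_Cplus.
    - apply continuous_Cmult; [apply continuous_const|apply continuous_RtoC, continuous_fe].
    - now apply continuous_RtoC. }
  transitivity (CInt (fun s => E s * g j s)%C (- (l / 2)) (l / 2)
    + (- (2 * Ci * sg) * CInt (fun s => E s * ((1 / 2 * fe' j s)%R + lam / k * fe j s))%C (- (l / 2)) (l / 2)
       + sg * Ci * CInt (fun s => E s * (kfreq lam k * fe j s + fe' j s))%C (- (l / 2)) (l / 2)))%C;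
    [|unfold E; ring].
  rewrite <- !CInt_Cmult by auto.
  rewrite <- CInt_plus, <- CInt_plus.
  - apply CInt_ext. intros s _. unfold E, nfreq, kfreq. rewrite RtoC_mult.
    replace (RtoC (1 / 2)) with (/ 2)%C by (rewrite RtoC_div; [field|lra]).
    generalize (lam / k)%C. intros m. field.
  - auto.
  - intros s. apply continuous_Cplus; apply continuous_Cmult; auto; apply continuous_const.
  - intros s. apply continuous_Cmult; auto; apply continuous_const.
  - intros s. apply continuous_Cmult; auto; apply continuous_const.
Qed.

(* The boundary terms of the three integrations by parts cancel in pairs at the vertices. *)
Lemma global_relation_gen (A B sg : C) (kj : side -> C) : (A * A + B * B = 4 * lam)%C ->
  (forall j, (A * normal_x j + B * normal_y j = sg * nfreq lam (kj j))%C) ->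
  (forall j, (B * normal_x j - A * normal_y j = kfreq lam (kj j))%C) ->
  let term j := (Cexp (inradius l * (sg * nfreq lam (kj j)))
                 * (N j (kj j) - 2 * Ci * sg * F j (kj j)))%C in
  (term side1 + term side2 + term side3 = 0)%C.
Proof.
  intros HAB Ha Hb term.
  pose proof (Hgreen A B HAB) as G. cbv beta zeta in G. rewrite !Ha, !Hb, !side_integral in G.
  assert (Hw : forall j (s : R), (Cexp (inradius l * (sg * nfreq lam (kj j)))
      * Cexp (kfreq lam (kj j) * s))%C = plane_wave A B (side_point l j s)).
  { intros j s. rewrite <- Cexp_plus, <- Ha, <- Hb. unfold plane_wave. f_equal.
    rewrite side_point_eq. cbn [Re Im fst snd].
    rewrite !RtoC_plus, !RtoC_mult, RtoC_opp. ring. }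
  pose proof (fun j => Hw j (l / 2)) as W1. pose proof (fun j => Hw j (- (l / 2))) as W2.
  rewrite <- G. unfold term.
  set (T := fun j => (Cexp (inradius l * (sg * nfreq lam (kj j)))
      * (Cexp (kfreq lam (kj j) * (l / 2)%R) * fe j (l / 2)
                  - Cexp (kfreq lam (kj j) * (- (l / 2))%R) * fe j (- (l / 2))))%C).
  assert (HT : (T side1 + T side2 + T side3 = 0)%C).
  { assert (ET : forall j, T j = (plane_wave A B (side_point l j (l / 2)) * fe j (l / 2)
       - plane_wave A B (side_point l j (- (l / 2))) * fe j (- (l / 2)))%C).
    { intros j. rewrite <- W1, <- W2. unfold T. ring. }
    rewrite !ET, Hv12, Hv23, Hv31, vertex_side12, vertex_side23, vertex_side31. ring. }
  transitivity (term side1 + term side2 + term side3 + sg * Ci * (T side1 + T side2 + T side3))%C.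
  - rewrite HT. unfold term. ring.
  - unfold term, T. ring.
Qed.

Lemma nfreq_kfreq_sqr (sg k : C) : (sg * sg = 1)%C -> k <> 0%C ->
  ((sg * nfreq lam k) * (sg * nfreq lam k) + kfreq lam k * kfreq lam k = 4 * lam)%C.
Proof.
  intros Hs Hk. unfold nfreq, kfreq.
  transitivity ((sg * sg) * (Ci * Ci) * (k - lam / k) * (k - lam / k) + (k + lam / k) * (k + lam / k))%C;
    [ring|]. rewrite Hs, Ci_sqr. field. auto.
Qed.

(** Side j is side (1) turned by its normal, and turning z amounts to turning k. The wave containing
    k z is seen on side j at k times the normal, the wave containing k zbar ([corotated]) at k times
    the conjugate normal. *)
Definition rotated (k : C) (j : side) : C :=
  match j with side1 => k | side2 => (alphab * k)%C | side3 => (alpha * k)%C end.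
Definition corotated (k : C) (j : side) : C :=
  match j with side1 => k | side2 => (alpha * k)%C | side3 => (alphab * k)%C end.

Lemma global_relation_plus (k : C) : k <> 0%C ->
  let term j := (Cexp (inradius l * nfreq lam (rotated k j))
                 * (N j (rotated k j) - 2 * Ci * F j (rotated k j)))%C in
  (term side1 + term side2 + term side3 = 0)%C.
Proof.
  intros Hk term.
  rewrite <- (global_relation_gen (1 * nfreq lam k) (kfreq lam k) 1 (rotated k)).
  - unfold term. rewrite !Cmult_1_l, !Cmult_1_r. reflexivity.
  - apply nfreq_kfreq_sqr; auto. ring.
  - intros j. destruct j; unfold rotated, nfreq, kfreq; rewrite ?div_alpha, ?div_alphab by auto;
      generalize (lam / k)%C; intros m; rewrite ?alpha_eq, ?alphab_eq;
      destruct k as [k1 k2], m as [m1 m2]; apply C_eq; simpl; field.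
  - intros j. destruct j; unfold rotated, nfreq, kfreq; rewrite ?div_alpha, ?div_alphab by auto;
      generalize (lam / k)%C; intros m; rewrite ?alpha_eq, ?alphab_eq;
      destruct k as [k1 k2], m as [m1 m2]; apply C_eq; simpl; field.
Qed.

Lemma global_relation_minus (k : C) : k <> 0%C ->
  let term j := (Cexp (- (inradius l * nfreq lam (corotated k j)))
                 * (N j (corotated k j) + 2 * Ci * F j (corotated k j)))%C in
  (term side1 + term side2 + term side3 = 0)%C.
Proof.
  intros Hk term.
  rewrite <- (global_relation_gen (- (1) * nfreq lam k) (kfreq lam k) (- (1)) (corotated k)).
  - unfold term.
    assert (E : forall j, (inradius l * (- (1) * nfreq lam (corotated k j))
                 = - (inradius l * nfreq lam (corotated k j)))%C) by (intros; ring).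
    rewrite !E. ring.
  - apply nfreq_kfreq_sqr; auto. ring.
  - intros j. destruct j; unfold corotated, nfreq, kfreq; rewrite ?div_alpha, ?div_alphab by auto;
      generalize (lam / k)%C; intros m; rewrite ?alpha_eq, ?alphab_eq;
      destruct k as [k1 k2], m as [m1 m2]; apply C_eq; simpl; field.
  - intros j. destruct j; unfold corotated, nfreq, kfreq; rewrite ?div_alpha, ?div_alphab by auto;
      generalize (lam / k)%C; intros m; rewrite ?alpha_eq, ?alphab_eq;
      destruct k as [k1 k2], m as [m1 m2]; apply C_eq; simpl; field.
Qed.

Lemma neumann_transform_identity (m : Z) (k : C) : k <> 0%C ->
  kfreq lam k = (2 * Ci * IZR m * PI / (3 * l))%C ->
  ((N side1 k + Cpow (efun l lam (- k)) 2 * N side2 k + Cpow (efun l lam k) 2 * N side3 k)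
     * Mden l lam m k = 2 * Ci * Xfun l lam f k)%C.
Proof.
  intros Hk Hm.
  assert (Hlc : RtoC l <> 0%C) by (intros H; injection H; lra).
  assert (Hka : (alpha * k)%C <> 0%C) by (apply Cmult_neq_0; auto; apply alpha_neq_0).
  assert (Hkb : (alphab * k)%C <> 0%C) by (apply Cmult_neq_0; auto; apply alphab_neq_0).
  set (a := Cexp (inradius l * nfreq lam k)).
  set (a' := Cexp (- (inradius l * nfreq lam k))).
  set (y := efun l lam (- k)). set (Y := efun l lam k).
  set (v := efun l lam (- (alphab * k))). set (V := efun l lam (alphab * k)).
  assert (Ey : y = Cexp (- (kfreq lam k * (l / 2)%R))).
  { unfold y, efun. rewrite kfreq_opp by auto. f_equal. ring. }
  assert (Ev : v = Cexp (- (kfreq lam (alphab * k) * (l / 2)%R))).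
  { unfold v, efun. rewrite kfreq_opp by auto. f_equal. ring. }
  assert (HyY : (y * Y = 1)%C) by (rewrite Ey; apply Cexp_opp_l).
  assert (HvV : (v * V = 1)%C) by (rewrite Ev; apply Cexp_opp_l).
  (* The condition on k gives [kfreq lam k * l] = 2 i m pi / 3. The power of alphab in [Mden] is
     thus e^2(-k), and [Mden] is the factor y^2 V - v produced by the elimination. *)
  assert (Hy2 : CpowZ alphab m = (y * y)%C).
  { unfold alphab. rewrite CpowZ_Cexp, Ey, <- Cexp_plus, Hm. f_equal.
    rewrite RtoC_div by lra. field. auto. }
  assert (HY6 : (y * y * y = Y * Y * Y)%C).
  { transitivity (y * y * y * (Y * Y * Y * (Y * Y * Y)))%C.
    - unfold Y, efun. rewrite <- !Cexp_plus, Hm.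
      match goal with |- context [(_ * Cexp ?e)%C] =>
        replace e with (2 * Ci * PI * IZR m)%C by (rewrite RtoC_div by lra; field; auto) end.
      rewrite Cexp_2PI. ring.
    - transitivity ((y * Y) * (y * Y) * (y * Y) * (Y * Y * Y))%C; [ring|]. rewrite HyY. ring. }
  assert (Hb : Cexp (inradius l * nfreq lam (alpha * k)) = (a * v)%C).
  { unfold a. rewrite nfreq_alpha, Ev, <- Cexp_plus by auto. f_equal. }
  assert (Hc : Cexp (inradius l * nfreq lam (alphab * k)) = (a * (y * v))%C).
  { unfold a. rewrite nfreq_alphab, Ev, Ey, <- !Cexp_plus by auto. f_equal. ring. }
  assert (Hb' : Cexp (- (inradius l * nfreq lam (alpha * k))) = (a' * V)%C).
  { unfold a', V, efun. rewrite nfreq_alpha, <- Cexp_plus by auto. f_equal. ring. }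
  assert (Hc' : Cexp (- (inradius l * nfreq lam (alphab * k))) = (a' * (Y * V))%C).
  { unfold a', V, Y, efun. rewrite nfreq_alphab, <- !Cexp_plus by auto. f_equal. ring. }
  assert (R1 : (alphab * (alpha * k) = k)%C).
  { transitivity (alpha * alphab * k)%C; [ring|]. rewrite alpha_alphab. ring. }
  assert (R2 : (alpha * (alpha * k) = alphab * k)%C) by (rewrite Cmult_assoc, alpha_sqr; reflexivity).
  assert (R3 : (alphab * (alphab * k) = alpha * k)%C) by (rewrite Cmult_assoc, alphab_sqr; reflexivity).
  assert (R4 : (alpha * (alphab * k) = k)%C) by (rewrite Cmult_assoc, alpha_alphab; ring).
  pose proof (global_relation_plus k Hk) as G1. pose proof (global_relation_plus _ Hka) as G2.
  pose proof (global_relation_plus _ Hkb) as G3. pose proof (global_relation_minus k Hk) as G4.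
  pose proof (global_relation_minus _ Hka) as G5. pose proof (global_relation_minus _ Hkb) as G6.
  cbv beta zeta in G1, G2, G3, G4, G5, G6.
  cbn [rotated corotated] in G1, G2, G3, G4, G5, G6.
  rewrite R1, R2 in G2. rewrite R3, R4 in G3. rewrite R1, R2 in G5. rewrite R3, R4 in G6.
  fold a in G1, G2, G3. fold a' in G4, G5, G6.
  rewrite Hb, Hc in G1, G2, G3. rewrite Hb', Hc' in G4, G5, G6.
  unfold Mden, Xfun, Fcomb. rewrite Hy2. fold y Y v V.
  apply (neumann_elimination a a' y Y v V) with
    (N1a := N side1 (alpha * k)) (N2a := N side2 (alpha * k)) (N3a := N side3 (alpha * k))
    (N1b := N side1 (alphab * k)) (N2b := N side2 (alphab * k)) (N3b := N side3 (alphab * k));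
    try apply Cexp_neq_0; assumption.
Qed.

End GlobalRelation.

(** * Decay of the transforms *)

Lemma continuous_bounded (h : R -> R) (a b : R) : a <= b -> (forall s, continuous h s) ->
  exists M, 0 <= M /\ forall s, a <= s <= b -> Rabs (h s) <= M.
Proof.
  intros Hab Hc.
  destruct (continuity_ab_maj (fun s => Rabs (h s)) a b Hab) as [x [Hx _]].
  - intros s _. apply continuity_pt_filterlim.
    apply (continuous_comp h Rabs); [apply Hc|apply continuous_Rabs].
  - exists (Rabs (h x)). split; [apply Rabs_pos|exact Hx].
Qed.

Lemma exp_le_compat (x y : R) : x <= y -> exp x <= exp y.
Proof. intros [H| ->]; [left; now apply exp_increasing|lra]. Qed.

Lemma Cmod_Cexp_linear (kap : C) (L s : R) : Rabs s <= L ->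
  Cmod (Cexp (kap * s)) <= exp (Rabs (Re kap) * L).
Proof.
  intros Hs. rewrite Cmod_Cexp.
  replace (Re (kap * s)) with (Re kap * s) by (destruct kap; simpl; ring).
  apply exp_le_compat. eapply Rle_trans; [apply Rle_abs|]. rewrite Rabs_mult.
  apply Rmult_le_compat_l; [apply Rabs_pos|exact Hs].
Qed.

(** One integration by parts; stating it as a product with |kap| avoids a case distinction at 0. *)
Lemma exp_transform_decay (l : R) (h h' : R -> R) : 0 < l ->
  (forall s, is_derive h s (h' s)) -> (forall s, continuous h' s) ->
  exists K, 0 <= K /\ forall kap : C,
    Cmod (CInt (fun s => Cexp (kap * s) * h s)%C (- (l / 2)) (l / 2)) * Cmod kap
      <= K * exp (Rabs (Re kap) * (l / 2)).
Proof.
  intros Hl Hd Hc'.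
  assert (Hc : forall s, continuous h s).
  { intros s. apply (ex_derive_continuous h). eexists; apply Hd. }
  destruct (continuous_bounded h (- (l / 2)) (l / 2) ltac:(lra) Hc) as [M [HM0 HM]].
  destruct (continuous_bounded h' (- (l / 2)) (l / 2) ltac:(lra) Hc') as [M' [HM'0 HM']].
  (* The two boundary values give [2 * M]; the remaining integral over length l gives
     [2 * (l * M')], the 2 coming from [Cmod_CInt_le]. *)
  exists (2 * M + 2 * (l * M')). split; [nra|]. intros kap.
  set (I := CInt (fun s => Cexp (kap * s) * h s)%C (- (l / 2)) (l / 2)).
  set (J := CInt (fun s => Cexp (kap * s) * h' s)%C (- (l / 2)) (l / 2)).
  set (E := exp (Rabs (Re kap) * (l / 2))).
  assert (HE : 0 < E) by apply exp_pos.
  assert (CE : forall s, continuous (fun s : R => (Cexp (kap * s))) s) by apply continuous_Cexp_linear.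
  assert (C1 : forall s, continuous (fun s : R => (Cexp (kap * s) * h s)%C) s).
  { intros s. apply continuous_Cmult; auto. now apply continuous_RtoC. }
  assert (C2 : forall s, continuous (fun s : R => (Cexp (kap * s) * h' s)%C) s).
  { intros s. apply continuous_Cmult; auto. now apply continuous_RtoC. }
  assert (Eparts : (kap * I = Cexp (kap * (l / 2)%R) * h (l / 2)%R
            - Cexp (kap * (- (l / 2))%R) * h (- (l / 2))%R - J)%C).
  { rewrite <- (CInt_exp_parts (- (l / 2)) (l / 2) kap h h') by auto.
    transitivity (kap * I + J - J)%C; [ring|]. f_equal. unfold I, J.
    rewrite <- CInt_Cmult, <- CInt_plus; auto.
    - apply CInt_ext. intros s _. ring.
    - intros s. apply continuous_Cmult; auto. apply continuous_const. }
  assert (HJ : Cmod J <= 2 * ((l / 2 - - (l / 2)) * (E * M'))).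
  { apply Cmod_CInt_le; auto; [lra|]. intros s Hs. rewrite Cmod_mult, Cmod_R.
    apply Rmult_le_compat; auto; try apply Cmod_ge_0; try apply Rabs_pos.
    apply Cmod_Cexp_linear. apply Rabs_le. lra. }
  assert (HB : forall s, - (l / 2) <= s <= l / 2 -> Cmod (Cexp (kap * s) * h s) <= E * M).
  { intros s Hs. rewrite Cmod_mult, Cmod_R.
    apply Rmult_le_compat; auto; try apply Cmod_ge_0; try apply Rabs_pos.
    apply Cmod_Cexp_linear. apply Rabs_le. lra. }
  rewrite Rmult_comm, <- Cmod_mult, Eparts.
  unfold Cminus. eapply Rle_trans; [apply Cmod_triangle|]. rewrite Cmod_opp.
  eapply Rle_trans; [apply Rplus_le_compat_r, Cmod_triangle|]. rewrite Cmod_opp.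
  pose proof (HB (l / 2) ltac:(lra)). pose proof (HB (- (l / 2)) ltac:(lra)). nra.
Qed.

Section Decay.

Variables (l lam : R) (f g fe fe' fe'' : side -> R -> R).
Hypothesis Hl : 0 < l.
Hypothesis Hfe : forall j s, is_derive (fe j) s (fe' j s).
Hypothesis Hfe' : forall j s, is_derive (fe' j) s (fe'' j s).
Hypothesis Hfe'' : forall j s, continuous (fe'' j) s.
Hypothesis Hf : forall j s, - (l / 2) < s < l / 2 -> f j s = fe j s /\ Derive (f j) s = fe' j s.

(** F_j already contains f', so the integration by parts uses f''. The condition |k| >= 1 bounds lam
    / k, the weight of the second term. *)
Lemma Ffun_decay : exists K, 0 <= K /\ forall (j : side) (k : C), 1 <= Cmod k ->
  Cmod (Ffun l lam f j k) * Cmod (kfreq lam k) <= K * exp (Rabs (Re (kfreq lam k)) * (l / 2)).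
Proof.
  assert (Hc' : forall j s, continuous (fe' j) s).
  { intros j s. apply (ex_derive_continuous (fe' j)). eexists; apply Hfe'. }
  assert (Hc : forall j s, continuous (fe j) s).
  { intros j s. apply (ex_derive_continuous (fe j)). eexists; apply Hfe. }
  assert (Hone : forall j, exists K, 0 <= K /\ forall k : C, 1 <= Cmod k ->
    Cmod (Ffun l lam f j k) * Cmod (kfreq lam k) <= K * exp (Rabs (Re (kfreq lam k)) * (l / 2))).
  { intros j.
    destruct (exp_transform_decay l (fe' j) (fe'' j) Hl (Hfe' j) (Hfe'' j)) as [K1 [HK1 H1]].
    destruct (exp_transform_decay l (fe j) (fe' j) Hl (Hfe j) (Hc' j)) as [K2 [HK2 H2]].
    exists (K1 + Rabs lam * K2). pose proof (Rabs_pos lam) as Hlam. split; [nra|].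
    intros k Hk. set (kap := kfreq lam k).
    set (I1 := CInt (fun s => Cexp (kap * s) * fe' j s)%C (- (l / 2)) (l / 2)).
    set (I2 := CInt (fun s => Cexp (kap * s) * fe j s)%C (- (l / 2)) (l / 2)).
    assert (Hk0 : k <> 0%C) by (intros ->; rewrite Cmod_0 in Hk; lra).
    assert (E : Ffun l lam f j k = ((1 / 2)%R * I1 + lam / k * I2)%C).
    { rewrite (Ffun_CInt l lam f fe fe' Hl Hf). unfold I1, I2.
      rewrite <- !CInt_Cmult, <- CInt_plus.
      - apply CInt_ext. intros s _. fold kap. rewrite RtoC_mult. ring.
      - intros s. apply continuous_Cmult; [apply continuous_const|].
        apply continuous_Cmult; [apply continuous_Cexp_linear|now apply continuous_RtoC].
      - intros s. apply continuous_Cmult; [apply continuous_const|].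
        apply continuous_Cmult; [apply continuous_Cexp_linear|now apply continuous_RtoC].
      - intros s. apply continuous_Cmult; [apply continuous_Cexp_linear|now apply continuous_RtoC].
      - intros s. apply continuous_Cmult; [apply continuous_Cexp_linear|now apply continuous_RtoC]. }
    rewrite E. specialize (H1 kap). specialize (H2 kap). fold I1 in H1. fold I2 in H2.
    assert (Hd : Cmod (lam / k) <= Rabs lam).
    { rewrite Cmod_div, Cmod_R by auto. apply Rle_div_l; nra. }
    pose proof (Cmod_ge_0 kap). pose proof (Cmod_ge_0 I1). pose proof (Cmod_ge_0 I2).
    pose proof (Cmod_ge_0 (lam / k)).
    assert (Cmod ((1 / 2)%R * I1 + lam / k * I2) <= Cmod I1 + Rabs lam * Cmod I2).
    { eapply Rle_trans; [apply Cmod_triangle|]. rewrite !Cmod_mult, Cmod_R, Rabs_pos_eq by lra. nra. }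
    apply Rle_trans with ((Cmod I1 + Rabs lam * Cmod I2) * Cmod kap).
    - now apply Rmult_le_compat_r.
    - rewrite Rmult_plus_distr_r, (Rmult_plus_distr_r K1), !(Rmult_assoc (Rabs lam)).
      apply Rplus_le_compat; auto. now apply Rmult_le_compat_l. }
  destruct (Hone side1) as [K1 [P1 Q1]]. destruct (Hone side2) as [K2 [P2 Q2]].
  destruct (Hone side3) as [K3 [P3 Q3]].
  exists (K1 + K2 + K3). split; [lra|]. intros j k Hk.
  pose proof (exp_pos (Rabs (Re (kfreq lam k)) * (l / 2))) as He.
  destruct j; [pose proof (Q1 k Hk)|pose proof (Q2 k Hk)|pose proof (Q3 k Hk)]; nra.
Qed.

(** The exponential factors translate sides (2) and (3) by - l and l, so this is the Fourier-Laplace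
    transform of the glued Neumann data. It is a function of [kap] alone, hence blind to the choice
    of root k. *)
Definition neumann_transform (kap : C) : C :=
  (transform l g side1 kap + Cexp (- (kap * l)) * transform l g side2 kap
   + Cexp (kap * l) * transform l g side3 kap)%C.

Hypothesis Hid : forall (m : Z) (k : C), k <> 0%C ->
  kfreq lam k = (2 * Ci * IZR m * PI / (3 * l))%C ->
  (neumann_transform (kfreq lam k) * Mden l lam m k = 2 * Ci * Xfun l lam f k)%C.

Lemma kfreq_imag (y : R) : y <> 0 -> kfreq lam (0, y) = (0, y - lam / y).
Proof.
  intros Hy. unfold kfreq. replace (lam / (0, y))%C with ((0, - (lam / y)) : C).
  - apply C_eq; simpl; ring.
  - apply C_eq; simpl; field; auto.
Qed.

Lemma kfreq_imag_alphab (y : R) : y <> 0 ->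
  kfreq lam (alphab * (0, y)) = (sqrt 3 / 2 * (y + lam / y), - (y - lam / y) / 2).
Proof.
  intros Hy. unfold kfreq. rewrite div_alphab by (intros H; injection H; auto).
  replace (lam / (0, y))%C with ((0, - (lam / y)) : C).
  - rewrite alpha_eq, alphab_eq. apply C_eq; simpl; field; auto.
  - apply C_eq; simpl; field; auto.
Qed.

Lemma kfreq_imag_alpha (y : R) : y <> 0 ->
  kfreq lam (alpha * (0, y)) = (- (sqrt 3 / 2 * (y + lam / y)), - (y - lam / y) / 2).
Proof.
  intros Hy. unfold kfreq. rewrite div_alpha by (intros H; injection H; auto).
  replace (lam / (0, y))%C with ((0, - (lam / y)) : C).
  - rewrite alpha_eq, alphab_eq. apply C_eq; simpl; field; auto.
  - apply C_eq; simpl; field; auto.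
Qed.

Lemma Cmod_ge_Im (z : C) : Rabs (Im z) <= Cmod z.
Proof. eapply Rle_trans; [apply Rmax_r|apply Rmax_Cmod]. Qed.

(* [k = i y] with the larger root y: then the exponentials at alpha k and alphab k grow like
   [W = exp (sqrt 3 / 2 * (y + lam / y) * l / 2)], and so does the denominator. *)
Lemma neumann_transform_decay : exists K, 0 <= K /\ exists M0, forall m : Z, M0 <= IZR m ->
  Cmod (neumann_transform (2 * Ci * IZR m * PI / (3 * l))) * IZR m <= K.
Proof.
  destruct Ffun_decay as [K [HK HF]].
  (* The bound 30 K W / eta on X, doubled by 2 i and divided by the lower bound W / 2 of the
     denominator, gives 120 K / eta; [3 * l / (2 * PI)] is the ratio m / eta. *)
  exists (120 * K * (3 * l / (2 * PI))). pose proof PI_RGT_0 as Hpi.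
  assert (Hc : 0 < 3 * l / (2 * PI)) by (apply Rdiv_lt_0_compat; lra).
  split; [apply Rmult_le_pos; lra|].
  (* The 4 yields [eta * l >= 8] and through it [W >= 2]. The rest yields [eta >= 16 |lam| + 2],
     which makes the discriminant at least (eta / 2)^2 and the root y at least 1. *)
  exists (4 + (16 * Rabs lam + 2) * (3 * l / (2 * PI))).
  intros m Hm. set (eta := 2 * IZR m * PI / (3 * l)).
  pose proof (Rabs_pos lam) as Hlam0.
  assert (Hm4 : 4 <= IZR m) by nra.
  assert (Eeta : IZR m = eta * (3 * l / (2 * PI))) by (unfold eta; field; split; lra).
  assert (Heta : 16 * Rabs lam + 2 <= eta).
  { apply (Rmult_le_reg_r (3 * l / (2 * PI))); auto. rewrite <- Eeta. lra. }
  assert (Hetal : 8 <= eta * l).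
  { unfold eta. replace (2 * IZR m * PI / (3 * l) * l) with (2 * IZR m * (PI / 3)) by (field; lra).
    assert (1 <= PI / 3) by (pose proof PI2_3_2; lra). nra. }
  assert (Hlam : - Rabs lam <= lam <= Rabs lam).
  { split; [|apply Rle_abs]. pose proof (Rle_abs (- lam)) as H. rewrite Rabs_Ropp in H. lra. }
  assert (Hdisc : (eta / 2) * (eta / 2) <= eta * eta + 4 * lam) by nra.
  set (S := sqrt (eta * eta + 4 * lam)).
  assert (HS : eta / 2 <= S).
  { rewrite <- (sqrt_square (eta / 2)) by lra. apply sqrt_le_1_alt. exact Hdisc. }
  assert (HS2 : S * S = eta * eta + 4 * lam) by (apply sqrt_sqrt; nra).
  set (y := (eta + S) / 2).
  assert (Hy : 1 <= y) by (unfold y; lra).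
  assert (Hy1 : y - lam / y = eta).
  { replace lam with (y * y - eta * y) by (unfold y; nra). field. lra. }
  assert (Hy2 : y + lam / y = S).
  { replace (lam / y) with (y - eta) by lra. unfold y. lra. }
  set (k := (0, y) : C).
  assert (Hk0 : k <> 0%C) by (intros H; injection H; lra).
  assert (Hk1 : 1 <= Cmod k).
  { eapply Rle_trans; [|apply Cmod_ge_Im]. unfold k; cbn [Im snd]. rewrite Rabs_pos_eq; lra. }
  assert (Hmod : forall c, Cmod c = 1 -> 1 <= Cmod (c * k)).
  { intros c Ec. rewrite Cmod_mult, Ec. lra. }
  assert (Hal : Cmod alpha = 1) by (unfold alpha; rewrite Cmod_Cexp;
    replace (Re _) with 0 by (simpl; field); apply exp_0).
  assert (Halb : Cmod alphab = 1) by (unfold alphab; rewrite Cmod_Cexp;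
    replace (Re _) with 0 by (simpl; field); apply exp_0).
  pose proof (kfreq_imag y ltac:(lra)) as Ek. rewrite Hy1 in Ek. fold k in Ek.
  pose proof (kfreq_imag_alpha y ltac:(lra)) as Eka. rewrite Hy1, Hy2 in Eka. fold k in Eka.
  pose proof (kfreq_imag_alphab y ltac:(lra)) as Ekb. rewrite Hy1, Hy2 in Ekb. fold k in Ekb.
  set (sig := sqrt 3 / 2 * S) in *. set (W := exp (sig * (l / 2))).
  assert (Hsig : 0 <= sig /\ 1 <= sig * (l / 2)).
  { assert (1 <= sqrt 3) by (rewrite <- sqrt_1; apply sqrt_le_1_alt; lra).
    assert (S / 2 <= sig) by (unfold sig; nra). split; [lra|nra]. }
  assert (HW : 2 <= W).
  { unfold W. pose proof (exp_ineq1_le (sig * (l / 2))). lra. }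
  assert (Hkm : kfreq lam k = (2 * Ci * IZR m * PI / (3 * l))%C).
  { rewrite Ek. unfold eta. apply C_eq; simpl; field; lra. }
  pose proof (Hid m k Hk0 Hkm) as Eid. rewrite Hkm in Eid.
  set (P := neumann_transform _) in *.
  assert (He : forall x, Cmod (efun l lam x) = exp (Re (kfreq lam x) * (l / 2))).
  { intros x. unfold efun. rewrite Cmod_Cexp. f_equal. destruct (kfreq lam x); simpl; ring. }
  assert (Hkb0 : (alphab * k)%C <> 0%C) by (apply Cmult_neq_0; auto; apply alphab_neq_0).
  assert (E1 : Cmod (efun l lam k) = 1) by (rewrite He, Ek; cbn [Re fst]; rewrite Rmult_0_l; apply exp_0).
  assert (E2 : Cmod (efun l lam (- k)) = 1).
  { rewrite He, kfreq_opp, Ek by auto. replace (Re (- _)%C) with 0 by (simpl; ring).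
    rewrite Rmult_0_l; apply exp_0. }
  assert (E3 : Cmod (efun l lam (alphab * k)) = W) by (rewrite He, Ekb; reflexivity).
  assert (E4 : Cmod (efun l lam (- (alphab * k))) = / W).
  { rewrite He, kfreq_opp, Ekb by auto. replace (Re (- _)%C) with (- sig) by reflexivity.
    unfold W. rewrite <- exp_Ropp. f_equal. ring. }
  assert (HWi : / W <= 1 / 2).
  { rewrite <- (Rmult_1_l (/ W)). apply Rle_div_l; lra. }
  assert (HWi0 : 0 < / W) by (apply Rinv_0_lt_compat; lra).
  assert (E5 : Cmod (CpowZ alphab m) = 1).
  { unfold alphab. rewrite CpowZ_Cexp, Cmod_Cexp. replace (Re _) with 0 by (simpl; field). apply exp_0. }
  assert (Hden : W / 2 <= Cmod (Mden l lam m k)).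
  { unfold Mden.
    pose proof (Cmod_triangle (CpowZ alphab m * efun l lam (alphab * k) - efun l lam (- (alphab * k)))
                  (efun l lam (- (alphab * k)))) as H.
    replace (CpowZ alphab m * efun l lam (alphab * k) - efun l lam (- (alphab * k))
             + efun l lam (- (alphab * k)))%C with (CpowZ alphab m * efun l lam (alphab * k))%C in H by ring.
    rewrite Cmod_mult, E5, E3, E4 in H. lra. }
  assert (HeF : forall j, Cmod (Ffun l lam f j k) * eta <= K).
  { intros j. pose proof (HF j k Hk1) as H. rewrite Ek in H.
    cbn [Re fst] in H. rewrite Rabs_R0, Rmult_0_l, exp_0, Rmult_1_r in H.
    eapply Rle_trans; [|exact H]. apply Rmult_le_compat_l; [apply Cmod_ge_0|].
    eapply Rle_trans; [|apply Cmod_ge_Im]. apply Rle_abs. }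
  (* At the rotated frequencies only the imaginary part, of size eta / 2, bounds [kfreq] from below;
     hence the factor 2. *)
  assert (HeFr : forall j c, Cmod c = 1 ->
     Rabs (Re (kfreq lam (c * k))) = sig -> Im (kfreq lam (c * k)) = - eta / 2 ->
     Cmod (Ffun l lam f j (c * k)) * eta <= 2 * K * W).
  { intros j c Hc1 Hre Him. pose proof (HF j (c * k)%C (Hmod c Hc1)) as H. rewrite Hre in H.
    fold W in H. pose proof (Cmod_ge_Im (kfreq lam (c * k))) as Hi. rewrite Him in Hi.
    replace (- eta / 2) with (- (eta / 2)) in Hi by field.
    rewrite Rabs_Ropp, Rabs_pos_eq in Hi by lra.
    pose proof (Cmod_ge_0 (Ffun l lam f j (c * k))). nra. }
  assert (Ha : forall j, Cmod (Ffun l lam f j (alpha * k)) * eta <= 2 * K * W).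
  { intros j. apply HeFr; auto; rewrite Eka; cbn [Re Im fst snd]; auto.
    rewrite Rabs_Ropp. apply Rabs_pos_eq. lra. }
  assert (Hb : forall j, Cmod (Ffun l lam f j (alphab * k)) * eta <= 2 * K * W).
  { intros j. apply HeFr; auto; rewrite Ekb; cbn [Re Im fst snd]; auto. apply Rabs_pos_eq. lra. }
  assert (HFc : forall x B, (forall j, Cmod (Ffun l lam f j x) * eta <= B) ->
            Cmod (Fcomb l lam f k x) * eta <= 3 * B).
  { intros x B HB. unfold Fcomb.
    assert (H : Cmod (Ffun l lam f side1 x + Cpow (efun l lam (- k)) 2 * Ffun l lam f side2 x
       + Cpow (efun l lam k) 2 * Ffun l lam f side3 x)%C
       <= Cmod (Ffun l lam f side1 x) + Cmod (Ffun l lam f side2 x) + Cmod (Ffun l lam f side3 x)).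
    { eapply Rle_trans; [apply Cmod_triangle|].
      eapply Rle_trans; [apply Rplus_le_compat_r, Cmod_triangle|].
      rewrite !Cmod_mult, !Cmod_pow, E1, E2. lra. }
    pose proof (HB side1). pose proof (HB side2). pose proof (HB side3).
    apply Rle_trans with ((Cmod (Ffun l lam f side1 x) + Cmod (Ffun l lam f side2 x)
       + Cmod (Ffun l lam f side3 x)) * eta); [apply Rmult_le_compat_r; lra|lra]. }
  pose proof (HFc _ _ HeF) as X1. pose proof (HFc _ _ Ha) as X2. pose proof (HFc _ _ Hb) as X3.
  (* 30 is 6 from the first bracket, 2 W times 3 K, plus 12 from each of the other two, 2 times 3
     times 2 K W. *)
  assert (HX : Cmod (Xfun l lam f k) * eta <= 30 * K * W).
  { unfold Xfun.
    set (c0 := (Cpow (efun l lam (- k)) 2 * efun l lam (alphab * k) + efun l lam (- (alphab * k)))%C).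
    assert (Hc0 : Cmod c0 <= 2 * W).
    { unfold c0. eapply Rle_trans; [apply Cmod_triangle|].
      rewrite Cmod_mult, Cmod_pow, E2, E3, E4. lra. }
    assert (H : Cmod (c0 * Fcomb l lam f k k + 2 * Cpow (efun l lam k) 2 * Fcomb l lam f k (alpha * k)
        + 2 * efun l lam (- k) * Fcomb l lam f k (alphab * k))%C
       <= Cmod c0 * Cmod (Fcomb l lam f k k) + 2 * Cmod (Fcomb l lam f k (alpha * k))
          + 2 * Cmod (Fcomb l lam f k (alphab * k))).
    { eapply Rle_trans; [apply Cmod_triangle|].
      eapply Rle_trans; [apply Rplus_le_compat_r, Cmod_triangle|].
      rewrite !Cmod_mult, !Cmod_pow, E1, E2, !Cmod_R, !Rabs_pos_eq by lra. lra. }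
    assert (Hcf : Cmod c0 * (Cmod (Fcomb l lam f k k) * eta) <= 2 * W * (3 * K)).
    { apply Rmult_le_compat; auto; [apply Cmod_ge_0|].
      apply Rmult_le_pos; [apply Cmod_ge_0|lra]. }
    apply (Rmult_le_compat_r eta) in H; [|lra]. lra. }
  assert (HP : Cmod P * eta <= 120 * K).
  { apply (f_equal Cmod) in Eid. rewrite !Cmod_mult, Cmod_R, Rabs_pos_eq in Eid by lra.
    replace (Cmod Ci) with 1 in Eid.
    2:{ unfold Cmod, Ci; cbn [fst snd]. replace (0 ^ 2 + 1 ^ 2) with 1 by ring. now rewrite sqrt_1. }
    apply (Rmult_le_reg_r (W / 2)); [lra|].
    pose proof (Cmod_ge_0 P) as HP0.
    apply Rle_trans with (Cmod P * Cmod (Mden l lam m k) * eta).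
    - replace (Cmod P * Cmod (Mden l lam m k) * eta) with (Cmod P * eta * Cmod (Mden l lam m k)) by ring.
      apply Rmult_le_compat_l; auto. apply Rmult_le_pos; lra.
    - rewrite Eid. lra. }
  rewrite Eeta, <- Rmult_assoc. apply Rmult_le_compat_r; lra.
Qed.

End Decay.

(** * The Fourier series of the Neumann data *)

Lemma sum_n_first (u : nat -> C) (n : nat) :
  sum_n u (S n) = (u O + sum_n (fun i => u (S i)) n)%C.
Proof.
  induction n as [|n IH].
  - rewrite sum_Sn, !sum_O. reflexivity.
  - rewrite sum_Sn, IH, sum_Sn. symmetry. apply (Cplus_assoc (u O)).
Qed.

Definition bilateral_partial_sum (a : Z -> C) (N : nat) : C :=
  sum_n (fun i : nat => a (Z.of_nat i - Z.of_nat N)%Z) (2 * N).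

Lemma bilateral_partial_sum_S (a : Z -> C) (N : nat) :
  bilateral_partial_sum a (S N) =
  (bilateral_partial_sum a N + a (Z.of_nat N + 1)%Z + a (- Z.of_nat N - 1)%Z)%C.
Proof.
  unfold bilateral_partial_sum. replace (2 * S N)%nat with (S (S (2 * N))) by lia.
  rewrite sum_Sn, sum_n_first.
  replace (Z.of_nat 0 - Z.of_nat (S N))%Z with (- Z.of_nat N - 1)%Z by lia.
  replace (Z.of_nat (S (S (2 * N))) - Z.of_nat (S N))%Z with (Z.of_nat N + 1)%Z by lia.
  rewrite (sum_n_ext (fun i => a (Z.of_nat (S i) - Z.of_nat (S N))%Z)
             (fun i => a (Z.of_nat i - Z.of_nat N)%Z)).
  - unfold plus; simpl (Hierarchy.AbelianMonoid.sort _).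
    generalize (sum_n (fun i : nat => a (Z.of_nat i - Z.of_nat N)%Z) (2 * N)). intros z.
    change ((a (- Z.of_nat N - 1)%Z + z + a (Z.of_nat N + 1)%Z)%C
            = (z + a (Z.of_nat N + 1)%Z + a (- Z.of_nat N - 1)%Z)%C). ring.
  - intros i. f_equal. lia.
Qed.

Fixpoint symmetric_sum (b : Z -> C) (n : nat) : C :=
  match n with
  | O => b 0%Z
  | S p => (symmetric_sum b p + (b (Z.of_nat (S p)) + b (- Z.of_nat (S p))%Z))%C
  end.

(** Groups of three with |n| <= N reach down to -3N-2 but up only to 3N; the second summand is this
    asymmetry. *)
Lemma bilateral_sum_by_three (b : Z -> C) (N : nat) :
  bilateral_partial_sum (fun n => b (3 * n)%Z + b (3 * n - 1)%Z + b (3 * n - 2)%Z)%C N =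
  (symmetric_sum b (3 * N) + (b (- Z.of_nat (3 * N + 1))%Z + b (- Z.of_nat (3 * N + 2))%Z))%C.
Proof.
  induction N as [|N IH].
  - unfold bilateral_partial_sum. cbn [Nat.mul]. rewrite sum_O. simpl. ring.
  - rewrite bilateral_partial_sum_S, IH.
    replace (3 * S N)%nat with (S (S (S (3 * N)))) by lia. cbn [symmetric_sum].
    replace (3 * (Z.of_nat N + 1))%Z with (Z.of_nat (S (S (S (3 * N))))) by lia.
    replace (Z.of_nat (S (S (S (3 * N)))) - 1)%Z with (Z.of_nat (S (S (3 * N)))) by lia.
    replace (Z.of_nat (S (S (S (3 * N)))) - 2)%Z with (Z.of_nat (S (3 * N))) by lia.
    replace (3 * (- Z.of_nat N - 1))%Z with (- Z.of_nat (S (S (S (3 * N)))))%Z by lia.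
    replace (- Z.of_nat (S (S (S (3 * N)))) - 1)%Z with (- Z.of_nat (S (S (S (3 * N))) + 1))%Z by lia.
    replace (- Z.of_nat (S (S (S (3 * N)))) - 2)%Z with (- Z.of_nat (S (S (S (3 * N))) + 2))%Z by lia.
    replace (3 * N + 1)%nat with (S (3 * N)) by lia.
    replace (3 * N + 2)%nat with (S (S (3 * N))) by lia. ring.
Qed.

(** * The three sides as one period of length 3 l *)

Section Glue.

Variables (l : R) (g : side -> R -> R).
Hypothesis Hl : 0 < l.
Hypothesis Hg : forall j s, continuous (g j) s.

Definition shift (j : side) : R :=
  match j with side1 => 0 | side2 => - l | side3 => l end.

(* The sides (2), (1), (3) laid end to end. *)
Definition glue (s : R) : R :=
  if Rlt_dec s (- (l / 2)) then g side2 (s + l)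
  else if Rle_dec s (l / 2) then g side1 s else g side3 (s - l).

Lemma glue_shift (j : side) (s : R) : - (l / 2) < s < l / 2 -> glue (s + shift j) = g j s.
Proof.
  intros Hs. unfold glue, shift.
  destruct j; destruct (Rlt_dec _ _); try lra; try destruct (Rle_dec _ _); try lra; f_equal; lra.
Qed.

Lemma continuous_glue (j : side) (s : R) : - (l / 2) < s < l / 2 -> continuous glue (s + shift j).
Proof.
  intros Hs. apply continuous_ext_loc with (fun t => g j (t - shift j)).
  - assert (Hloc : locally (s + shift j) (fun t => - (l / 2) + shift j < t < l / 2 + shift j)).
    { apply locally_interval; lra. }
    revert Hloc. apply filter_imp. intros t Ht. rewrite <- glue_shift by lra. f_equal. ring.
  - apply (continuous_comp (fun t => t - shift j) (g j)); [|apply Hg].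
    apply (ex_derive_continuous (fun t : R => t - shift j)). auto_derive. auto.
Qed.

Lemma glue_bounded : exists B, forall s, - (3 * l / 2) <= s <= - (3 * l / 2) + 3 * l -> Rabs (glue s) <= B.
Proof.
  destruct (continuous_bounded (g side1) (- (l / 2)) (l / 2) ltac:(lra) (Hg side1)) as [B1 [P1 Q1]].
  destruct (continuous_bounded (g side2) (- (l / 2)) (l / 2) ltac:(lra) (Hg side2)) as [B2 [P2 Q2]].
  destruct (continuous_bounded (g side3) (- (l / 2)) (l / 2) ltac:(lra) (Hg side3)) as [B3 [P3 Q3]].
  exists (B1 + B2 + B3). intros s Hs. unfold glue.
  destruct (Rlt_dec _ _); [|destruct (Rle_dec _ _)].
  - pose proof (Q2 (s + l) ltac:(lra)). lra.
  - pose proof (Q1 s ltac:(lra)). lra.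
  - pose proof (Q3 (s - l) ltac:(lra)). lra.
Qed.

Definition glue_integral (phi : R -> R) : R :=
  RInt (fun s => g side1 s * phi (s + shift side1)) (- (l / 2)) (l / 2)
  + RInt (fun s => g side2 s * phi (s + shift side2)) (- (l / 2)) (l / 2)
  + RInt (fun s => g side3 s * phi (s + shift side3)) (- (l / 2)) (l / 2).

(** Integrability of the jumping function [glue] is reduced to its three continuous pieces,
    translated back to the sides and joined by Chasles' relation. *)
Lemma is_RInt_glue (phi : R -> R) : (forall s, continuous phi s) ->
  is_RInt (fun s => glue s * phi s) (- (3 * l / 2)) (- (3 * l / 2) + 3 * l) (glue_integral phi).
Proof.
  intros Hphi.
  assert (Hpiece : forall j, is_RInt (fun s => glue s * phi s)
     (- (l / 2) + shift j) (l / 2 + shift j)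
     (RInt (fun s => g j s * phi (s + shift j)) (- (l / 2)) (l / 2))).
  { intros j.
    assert (H : is_RInt (fun s => g j s * phi (s + shift j)) (- (l / 2)) (l / 2)
       (RInt (fun s => g j s * phi (s + shift j)) (- (l / 2)) (l / 2))).
    { apply (RInt_correct (V := R_CompleteNormedModule)).
      apply (ex_RInt_continuous (V := R_CompleteNormedModule)). intros s _.
      apply (continuous_mult (K := R_AbsRing)); [apply Hg|].
      apply (continuous_comp (fun t => t + shift j) phi); [|apply Hphi].
      apply (ex_derive_continuous (fun t : R => t + shift j)). auto_derive. auto. }
    assert (H' := is_RInt_comp_lin (V := R_NormedModule) (fun s => g j s * phi (s + shift j)) 1 (- shift j)
       (- (l / 2) + shift j) (l / 2 + shift j)
       (RInt (fun s => g j s * phi (s + shift j)) (- (l / 2)) (l / 2))).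
    replace (1 * (- (l / 2) + shift j) + - shift j) with (- (l / 2)) in H' by ring.
    replace (1 * (l / 2 + shift j) + - shift j) with (l / 2) in H' by ring.
    eapply is_RInt_ext; [|apply (H' H)].
    rewrite Rmin_left, Rmax_right by lra. intros s Hs.
    replace (glue s) with (g j (s - shift j)).
    2:{ rewrite <- glue_shift by lra. f_equal. ring. }
    unfold scal; simpl. unfold mult; simpl.
    replace (1 * s + - shift j) with (s - shift j) by ring.
    replace (s - shift j + shift j) with s by ring. ring. }
  pose proof (Hpiece side1) as H1. pose proof (Hpiece side2) as H2. pose proof (Hpiece side3) as H3.
  unfold glue_integral.
  set (I1 := RInt (fun s => g side1 s * phi (s + shift side1)) (- (l / 2)) (l / 2)) in *.
  set (I2 := RInt (fun s => g side2 s * phi (s + shift side2)) (- (l / 2)) (l / 2)) in *.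
  set (I3 := RInt (fun s => g side3 s * phi (s + shift side3)) (- (l / 2)) (l / 2)) in *.
  cbn [shift] in H1, H2, H3.
  replace (- (l / 2) + 0) with (- (l / 2)) in H1 by ring.
  replace (l / 2 + 0) with (l / 2) in H1 by ring.
  replace (- (l / 2) + - l) with (- (3 * l / 2)) in H2 by field.
  replace (l / 2 + - l) with (- (l / 2)) in H2 by field.
  replace (- (l / 2) + l) with (l / 2) in H3 by field.
  replace (l / 2 + l) with (- (3 * l / 2) + 3 * l) in H3 by field.
  pose proof (is_RInt_Chasles (V := R_NormedModule) _ _ _ _ _ _
    (is_RInt_Chasles (V := R_NormedModule) _ _ _ _ _ _ H2 H1) H3) as H.
  replace (I1 + I2 + I3) with (plus (plus I2 I1) I3) by (unfold plus; simpl; ring). exact H.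
Qed.

Lemma RInt_glue (phi : R -> R) : (forall s, continuous phi s) ->
  RInt (fun s => glue s * phi s) (- (3 * l / 2)) (- (3 * l / 2) + 3 * l) = glue_integral phi.
Proof. intros H. apply (is_RInt_unique (V := R_CompleteNormedModule)). now apply is_RInt_glue. Qed.

Definition freq (m : Z) : R := 2 * IZR m * PI / (3 * l).

(** The m-th term of the Fourier series at the point c, without the factor 1 / (3 l). *)
Definition fourier_mode (c : R) (m : Z) : C :=
  (neumann_transform l g (2 * Ci * IZR m * PI / (3 * l)) * Cexp (- (2 * Ci * IZR m * PI / (3 * l) * c)))%C.

Lemma fourier_mode_eq (c : R) (m : Z) :
  fourier_mode c m = (glue_integral (fun s => cos (freq m * (s - c))),
                      glue_integral (fun s => sin (freq m * (s - c)))).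
Proof.
  unfold fourier_mode, neumann_transform, transform, glue_integral.
  assert (Ek : (2 * Ci * IZR m * PI / (3 * l))%C = (0, freq m)).
  { unfold freq. apply C_eq; simpl; field; lra. }
  rewrite Ek. set (eta := freq m). set (kap := (0, eta) : C).
  assert (Hpart : forall j, (Cexp (kap * shift j) * CInt (fun s => Cexp (kap * s) * g j s)%C (- (l / 2)) (l / 2)
      * Cexp (- (kap * c)))%C =
    (RInt (fun s => g j s * cos (eta * (s + shift j - c))) (- (l / 2)) (l / 2),
     RInt (fun s => g j s * sin (eta * (s + shift j - c))) (- (l / 2)) (l / 2))).
  { intros j.
    transitivity (Cexp (kap * shift j) * Cexp (- (kap * c))
                  * CInt (fun s => Cexp (kap * s) * g j s)%C (- (l / 2)) (l / 2))%C; [ring|].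
    assert (C1 : forall s, continuous (fun s : R => (Cexp (kap * s) * g j s)%C) s).
    { intros s. apply continuous_Cmult; [apply continuous_Cexp_linear|now apply continuous_RtoC]. }
    rewrite <- CInt_Cmult by auto.
    rewrite CInt_pair by (intros s; apply continuous_Cmult; auto; apply continuous_const).
    assert (E : forall s : R, (Cexp (kap * shift j) * Cexp (- (kap * c)) * (Cexp (kap * s) * g j s))%C
        = (g j s * cos (eta * (s + shift j - c)), g j s * sin (eta * (s + shift j - c)))).
    { intros s.
      transitivity (Cexp (kap * shift j) * Cexp (- (kap * c)) * Cexp (kap * s) * g j s)%C; [ring|].
      rewrite <- !Cexp_plus.
      replace (kap * shift j + - (kap * c) + kap * s)%C with ((0, eta * (s + shift j - c)) : C).
      - unfold Cexp. cbn [Re Im fst snd]. rewrite exp_0. apply C_eq; simpl; ring.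
      - unfold kap. apply C_eq; simpl; ring. }
    apply injective_projections; cbn [fst snd]; apply RInt_ext; intros s _; now rewrite E. }
  pose proof (Hpart side1) as H1. pose proof (Hpart side2) as H2. pose proof (Hpart side3) as H3.
  cbn [shift] in H1, H2, H3 |- *.
  replace (kap * 0)%C with (0 : C) in H1 by ring. rewrite Cexp_0, Cmult_1_l in H1.
  replace (kap * (- l)%R)%C with (- (kap * l))%C in H2 by (rewrite RtoC_opp; ring).
  rewrite !Cmult_plus_distr_r, H1, H2, H3. reflexivity.
Qed.

Lemma freq_opp (m : Z) : freq (- m) = - freq m.
Proof. unfold freq. rewrite opp_IZR. field. lra. Qed.

Lemma glue_integral_ext (phi psi : R -> R) : (forall s, phi s = psi s) ->
  glue_integral phi = glue_integral psi.
Proof.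
  intros H. unfold glue_integral. f_equal; [f_equal|]; apply RInt_ext; intros s _; now rewrite H.
Qed.

Lemma glue_integral_opp (phi : R -> R) : (forall s, continuous phi s) ->
  glue_integral (fun s => - phi s) = - glue_integral phi.
Proof.
  intros Hphi. pose proof (is_RInt_glue phi Hphi) as H.
  assert (Hopp : forall s, continuous (fun s => - phi s) s).
  { intros s. now apply (continuous_opp (V := R_NormedModule) phi). }
  pose proof (is_RInt_glue _ Hopp) as H'.
  apply (is_RInt_opp (V := R_NormedModule)) in H.
  apply (is_RInt_unique (V := R_CompleteNormedModule)) in H'. etransitivity; [symmetry; exact H'|].
  apply (is_RInt_unique (V := R_CompleteNormedModule)).
  eapply is_RInt_ext; [|exact H]. intros s _. unfold opp; simpl. ring.
Qed.

Lemma continuous_sin_freq (w c s : R) : continuous (fun t => sin (w * (t - c))) s.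
Proof. apply (ex_derive_continuous (fun t => sin (w * (t - c)))). auto_derive. auto. Qed.

Lemma continuous_cos_freq (w c s : R) : continuous (fun t => cos (w * (t - c))) s.
Proof. apply (ex_derive_continuous (fun t => cos (w * (t - c)))). auto_derive. auto. Qed.

(** Because the Neumann data are real; decay for positive m thus gives decay for negative m. *)
Lemma fourier_mode_opp (c : R) (m : Z) : fourier_mode c (- m) = Cconj (fourier_mode c m).
Proof.
  rewrite !fourier_mode_eq. unfold Cconj; cbn [fst snd]. rewrite freq_opp. f_equal.
  - apply glue_integral_ext. intros s. rewrite <- cos_neg. f_equal. ring.
  - rewrite <- glue_integral_opp by apply continuous_sin_freq.
    apply glue_integral_ext. intros s. rewrite <- sin_neg. f_equal. ring.
Qed.

Lemma Cmod_fourier_mode (c : R) (m : Z) :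
  Cmod (fourier_mode c m) = Cmod (neumann_transform l g (2 * Ci * IZR m * PI / (3 * l))).
Proof.
  unfold fourier_mode. rewrite Cmod_mult, Cmod_Cexp.
  replace (Re _) with 0; [rewrite exp_0; ring|].
  simpl. field. lra.
Qed.

Let partial_sum (c : R) (n : nat) : R :=
  RInt (fun s => glue s * dirichlet_kernel n (2 * PI / (3 * l) * (s - c)))
    (- (3 * l / 2)) (- (3 * l / 2) + 3 * l).

Lemma ex_RInt_glue (phi : R -> R) : (forall s, continuous phi s) ->
  ex_RInt (fun s => glue s * phi s) (- (3 * l / 2)) (- (3 * l / 2) + 3 * l).
Proof. intros H. eexists. now apply is_RInt_glue. Qed.

Lemma RInt_glue_cos (c : R) (n : nat) :
  RInt (fun s => glue s * cos (INR n * (2 * PI / (3 * l) * (s - c))))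
    (- (3 * l / 2)) (- (3 * l / 2) + 3 * l) = Re (fourier_mode c (Z.of_nat n)).
Proof.
  rewrite fourier_mode_eq. cbn [Re fst].
  rewrite <- (RInt_glue (fun s => cos (freq (Z.of_nat n) * (s - c)))) by apply continuous_cos_freq.
  apply RInt_ext. intros s _. unfold freq. rewrite <- INR_IZR_INZ.
  apply (f_equal (Rmult _)). f_equal. field. lra.
Qed.

(** The conjugate terms at n and - n add up to twice a real part, which is the step 2 cos(n x) of
    the Dirichlet kernel under the integral. *)
Lemma symmetric_sum_fourier_mode (c : R) (n : nat) :
  symmetric_sum (fourier_mode c) n = RtoC (partial_sum c n).
Proof.
  induction n as [|n IH].
  - cbn [symmetric_sum]. rewrite fourier_mode_eq. unfold partial_sum, RtoC. f_equal.
    + rewrite <- (RInt_glue (fun s => cos (freq 0 * (s - c)))) by apply continuous_cos_freq.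
      apply RInt_ext. intros s _. cbn [dirichlet_kernel]. f_equal. unfold freq.
      replace (2 * 0 * PI / (3 * l) * (s - c)) with 0 by (field; lra). apply cos_0.
    (* Writing the zero function as - 0 makes its integral equal to its own opposite, hence 0. *)
    + assert (E : glue_integral (fun s => sin (freq 0 * (s - c))) = glue_integral (fun _ => - 0)).
      { apply glue_integral_ext. intros s. unfold freq.
        replace (2 * 0 * PI / (3 * l) * (s - c)) with 0 by (field; lra). rewrite sin_0. ring. }
      assert (E0 : glue_integral (fun _ => - 0) = - glue_integral (fun _ => - 0)).
      { rewrite <- glue_integral_opp by (intros; apply continuous_const).
        apply glue_integral_ext. intros. ring. }
      lra.
  - cbn [symmetric_sum]. rewrite IH.
    pose proof (partial_sum_step glue (- (3 * l / 2)) (3 * l) c ex_RInt_glue n) as H.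
    rewrite RInt_glue_cos, Nat.add_1_r in H. fold (partial_sum c (S n)) (partial_sum c n) in H.
    replace (partial_sum c (S n)) with (partial_sum c n + 2 * Re (fourier_mode c (Z.of_nat (S n)))) by lra.
    rewrite fourier_mode_opp. destruct (fourier_mode c (Z.of_nat (S n))) as [x y].
    apply C_eq; cbn [Re Im fst snd Cconj RtoC Cplus]; ring.
Qed.

(** The sums over n are a subsequence of the Dirichlet partial sums plus the two leftover terms of
    [bilateral_sum_by_three], which tend to 0 by the decay bound. *)
Lemma glue_fourier_series (K M0 : R) (j : side) (s : R) : - (l / 2) < s < l / 2 ->
  (forall m : Z, M0 <= IZR m ->
     Cmod (neumann_transform l g (2 * Ci * IZR m * PI / (3 * l))) * IZR m <= K) ->
  let c := s + shift j in
  is_bilateral_sum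
    (fun n => fourier_mode c (3 * n)%Z + fourier_mode c (3 * n - 1)%Z + fourier_mode c (3 * n - 2)%Z)%C
    (RtoC (3 * l * g j s)).
Proof.
  intros Hs Hdecay c.
  destruct (nfloor_ex (Rabs M0) (Rabs_pos M0)) as [N0 [_ HN0]].
  assert (Hmode : forall n, (N0 <= n)%nat -> Cmod (fourier_mode c (Z.of_nat (S n))) <= K / INR (S n)).
  { intros n Hn. rewrite Cmod_fourier_mode. apply Rle_div_r; [apply lt_0_INR; lia|].
    rewrite INR_IZR_INZ. apply Hdecay. rewrite <- INR_IZR_INZ, S_INR.
    apply le_INR in Hn. pose proof (Rle_abs M0). lra. }
  destruct glue_bounded as [B HB].
  assert (Hlim : is_lim_seq (partial_sum c) (3 * l * g j s)).
  { rewrite <- (glue_shift j s Hs). fold c.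
    apply (fourier_series_converges glue (- (3 * l / 2)) (3 * l) c B) with (K := K) (N0 := N0); auto.
    - lra.
    - apply ex_RInt_glue.
    - unfold c, shift. destruct j; lra.
    - now apply continuous_glue.
    - intros n Hn. rewrite RInt_glue_cos. eapply Rle_trans; [|apply Hmode, Hn].
      eapply Rle_trans; [apply Rmax_l|apply Rmax_Cmod]. }
  unfold is_bilateral_sum.
  apply filterlim_ext with (fun N => (RtoC (partial_sum c (3 * N)) +
    (fourier_mode c (- Z.of_nat (3 * N + 1)) + fourier_mode c (- Z.of_nat (3 * N + 2))))%C).
  { intros N. rewrite <- symmetric_sum_fourier_mode, <- bilateral_sum_by_three. reflexivity. }
  assert (Hsub : is_lim_seq (fun N => partial_sum c (3 * N)) (3 * l * g j s)).
  { apply (is_lim_seq_subseq (partial_sum c)); auto.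
    apply eventually_subseq. intros n. lia. }
  assert (Htail : forall i, (0 < i)%nat ->
            is_lim_seq (fun N => Cmod (fourier_mode c (- Z.of_nat (3 * N + i)))) 0).
  { intros i Hi. apply is_lim_seq_le_le_loc with (fun _ => 0) (fun N => Rabs K * / INR (S N)).
    - exists (N0 + 1)%nat. intros N HN. split; [apply Cmod_ge_0|].
      rewrite fourier_mode_opp, Cmod_conj.
      replace (3 * N + i)%nat with (S (3 * N + i - 1)) by lia.
      eapply Rle_trans; [apply Hmode; lia|].
      unfold Rdiv. apply Rle_trans with (Rabs K * / INR (S (3 * N + i - 1))).
      + apply Rmult_le_compat_r; [left; apply Rinv_0_lt_compat, lt_0_INR; lia|apply Rle_abs].
      + apply Rmult_le_compat_l; [apply Rabs_pos|]. apply Rinv_le_contravar; [apply lt_0_INR; lia|].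
        apply le_INR. lia.
    - apply is_lim_seq_const.
    - replace (Finite 0) with (Rbar_mult (Rabs K) 0) by (simpl; apply f_equal; ring).
      apply is_lim_seq_scal_l.
      apply (is_lim_seq_incr_1 (fun n => / INR n)).
      replace (Finite 0) with (Rbar_inv p_infty) by reflexivity.
      apply is_lim_seq_inv; [apply is_lim_seq_INR|discriminate]. }
  pose proof (Htail 1%nat ltac:(lia)) as T1. pose proof (Htail 2%nat ltac:(lia)) as T2.
  assert (Herr : is_lim_seq (fun N => Rabs (partial_sum c (3 * N) - 3 * l * g j s)
     + (Cmod (fourier_mode c (- Z.of_nat (3 * N + 1))) + Cmod (fourier_mode c (- Z.of_nat (3 * N + 2))))) 0).
  { replace (Finite 0) with (Finite (Rabs (3 * l * g j s - 3 * l * g j s) + (0 + 0))).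
    2:{ apply f_equal. rewrite Rminus_diag, Rabs_R0. ring. }
    apply is_lim_seq_plus'; [|now apply is_lim_seq_plus'].
    apply (is_lim_seq_abs _ (Finite (3 * l * g j s - 3 * l * g j s))).
    apply is_lim_seq_minus'; auto. apply is_lim_seq_const. }
  apply filterlim_locally. intros eps. apply is_lim_seq_spec in Herr.
  destruct (Herr eps) as [N1 HN1]. exists N1. intros N HN.
  specialize (HN1 N HN). rewrite Rminus_0_r in HN1.
  set (x := partial_sum c (3 * N)) in *. set (e1 := fourier_mode c (- Z.of_nat (3 * N + 1))) in *.
  set (e2 := fourier_mode c (- Z.of_nat (3 * N + 2))) in *.
  assert (Hfin : Rabs (x - 3 * l * g j s) + (Cmod e1 + Cmod e2) < eps).
  { eapply Rle_lt_trans; [apply Rle_abs|exact HN1]. }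
  assert (R1 : Rabs (Re e1) <= Cmod e1) by (eapply Rle_trans; [apply Rmax_l|apply Rmax_Cmod]).
  assert (R2 : Rabs (Re e2) <= Cmod e2) by (eapply Rle_trans; [apply Rmax_l|apply Rmax_Cmod]).
  pose proof (Cmod_ge_Im e1) as I1. pose proof (Cmod_ge_Im e2) as I2.
  (* Balls in C are products of real balls, so real and imaginary parts are estimated separately. *)
  split.
  - change (Rabs (x + (Re e1 + Re e2) - 3 * l * g j s) < eps).
    replace (x + (Re e1 + Re e2) - 3 * l * g j s) with ((x - 3 * l * g j s) + (Re e1 + Re e2)) by ring.
    eapply Rle_lt_trans; [apply Rabs_triang|]. pose proof (Rabs_triang (Re e1) (Re e2)). lra.
  - change (Rabs (0 + (Im e1 + Im e2) - 0) < eps).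
    replace (0 + (Im e1 + Im e2) - 0) with (Im e1 + Im e2) by ring.
    pose proof (Rabs_triang (Im e1) (Im e2)). pose proof (Rabs_pos (x - 3 * l * g j s)). lra.
Qed.

End Glue.

Lemma Cexp_shift (z : C) (p : Z) : Cexp (z + 2 * Ci * PI * IZR p) = Cexp z.
Proof. rewrite Cexp_plus, Cexp_2PI. ring. Qed.

Lemma c1_Cexp (j : side) :
  Defs.c1 j = Cexp (match j with side1 => 0 | side2 => - (2 * Ci * PI) / 3 | side3 => 2 * Ci * PI / 3 end)%C.
Proof. destruct j; [symmetry; apply Cexp_0|reflexivity|reflexivity]. Qed.

Lemma c2_Cexp (j : side) :
  c2 j = Cexp (match j with side1 => 0 | side2 => 2 * Ci * PI / 3 | side3 => - (2 * Ci * PI) / 3 end)%C.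
Proof. destruct j; [symmetry; apply Cexp_0|reflexivity|reflexivity]. Qed.

(** Shifting the point by - l or l multiplies mode m by alpha^m or alphab^m. This is 1 for m = 3n,
    [c1] for m = 3n - 1 and [c2] for m = 3n - 2, which explains these constants. *)
Lemma fourier_term_modes (l lam : R) (f g : side -> R -> R) (k : Z -> C) (j : side) (s : R) (n : Z) :
  0 < l ->
  (forall m, Mfun l lam f m (k m) = neumann_transform l g (2 * Ci * IZR m * PI / (3 * l))%C) ->
  fourier_term l lam f k j s n =
  (fourier_mode l g (s + shift l j) (3 * n)%Z + fourier_mode l g (s + shift l j) (3 * n - 1)%Z
   + fourier_mode l g (s + shift l j) (3 * n - 2)%Z)%C.
Proof.
  intros Hl HM. unfold fourier_term, fourier_mode. rewrite !HM.
  assert (Hlc : RtoC l <> 0%C) by (intros H; injection H; lra).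
  set (P := fun m => neumann_transform l g (2 * Ci * IZR m * PI / (3 * l))%C).
  fold (P (3 * n)%Z) (P (3 * n - 1)%Z) (P (3 * n - 2)%Z).
  set (base := Cexp (- (2 * Ci * PI * IZR n * s) / l)).
  (* [d * n] is the number of full turns by which the two exponents differ. *)
  set (d := match j with side1 => 0 | side2 => -1 | side3 => 1 end%Z).
  assert (E0 : Cexp (- (2 * Ci * IZR (3 * n) * PI / (3 * l) * (s + shift l j)%R)) = base).
  { unfold base. rewrite <- (Cexp_shift _ (d * n)). f_equal. rewrite !mult_IZR.
    unfold d, shift. destruct j; rewrite ?RtoC_plus, ?RtoC_mult, ?RtoC_opp;
      try replace (RtoC (-1)) with (- (1))%C by (rewrite <- RtoC_opp; reflexivity); field; auto. }
  assert (E1 : Cexp (- (2 * Ci * IZR (3 * n - 1) * PI / (3 * l) * (s + shift l j)%R))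
               = (Defs.c1 j * Cexp (2 * Ci * PI * s / (3 * l)) * base)%C).
  { unfold base. rewrite c1_Cexp, <- !Cexp_plus, <- (Cexp_shift _ (d * n)). f_equal.
    rewrite minus_IZR, !mult_IZR, RtoC_minus.
    unfold d, shift. destruct j; rewrite ?RtoC_plus, ?RtoC_mult, ?RtoC_opp;
      try replace (RtoC (-1)) with (- (1))%C by (rewrite <- RtoC_opp; reflexivity); field; auto. }
  (* Compared with [d * n], the extra turn comes from alpha^(-2), produced by the shift, being
     written as alpha in [c2], and symmetrically for alphab. *)
  set (d' := match j with side1 => 0 | side2 => 1 - n | side3 => n - 1 end%Z).
  assert (E2 : Cexp (- (2 * Ci * IZR (3 * n - 2) * PI / (3 * l) * (s + shift l j)%R))
               = (c2 j * Cexp (4 * Ci * PI * s / (3 * l)) * base)%C).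
  { unfold base. rewrite c2_Cexp, <- !Cexp_plus, <- (Cexp_shift _ d'). f_equal.
    rewrite minus_IZR, !mult_IZR, RtoC_minus.
    unfold d', shift. destruct j; rewrite ?minus_IZR, ?RtoC_minus, ?RtoC_plus, ?RtoC_mult, ?RtoC_opp;
      field; auto. }
  rewrite E0, E1, E2. ring.
Qed.

(** Functions smooth on the whole line have derivatives at the ends of the segment too. Case
    analysis on the three sides selects the extensions without an appeal to choice. *)
Lemma C2_extension (l : R) (f : side -> R -> R) :
  (forall j, C2_on_segment (- (l / 2)) (l / 2) (f j)) ->
  exists fe : side -> R -> R,
    (forall j s, is_derive (fe j) s (Derive (fe j) s)) /\
    (forall j s, is_derive (Derive (fe j)) s (Derive (Derive (fe j)) s)) /\
    (forall j s, continuous (Derive (Derive (fe j))) s) /\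
    (forall j s, - (l / 2) <= s <= l / 2 -> f j s = fe j s).
Proof.
  intros Hf. destruct (Hf side1) as [f1 [A1 B1]]. destruct (Hf side2) as [f2 [A2 B2]].
  destruct (Hf side3) as [f3 [A3 B3]].
  exists (fun j => match j with side1 => f1 | side2 => f2 | side3 => f3 end).
  refine (conj _ (conj _ (conj _ _))); intros j s.
  - apply Derive_correct. destruct j; [apply A1|apply A2|apply A3].
  - apply Derive_correct. destruct j; [apply A1|apply A2|apply A3].
  - destruct j; [apply A1|apply A2|apply A3].
  - destruct j; auto.
Qed.

Theorem proposition3p2
  (l lam : R) (q : C -> R) (f : side -> R -> R) (k : Z -> C)
  (Hl : 0 < l)
  (Hq2 : C2_in (open_triangle l) q)
  (Hq1 : C1_up_to_boundary (open_triangle l) (closed_triangle l) q)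
  (Hpde : forall z : C, open_triangle l z ->
     partial_x (partial_x q) z + partial_y (partial_y q) z - 4 * lam * q z = 0)
  (Hbc : forall (j : side) (s : R), - (l / 2) <= s <= l / 2 ->
     q (side_point l j s) = f j s)
  (Hf : forall j : side, C2_on_segment (- (l / 2)) (l / 2) (f j))
  (Hv12 : f side1 (- (l / 2)) = f side2 (l / 2))
  (Hv23 : f side2 (- (l / 2)) = f side3 (l / 2))
  (Hv31 : f side3 (- (l / 2)) = f side1 (l / 2))
  (Hk : forall m : Z, ~ degenerate lam m ->
     k m <> RtoC 0 /\
     (k m + lam / k m = 2 * Ci * IZR m * PI / (3 * l))%C)
  (Hden : forall m : Z, ~ degenerate lam m -> Mden l lam m (k m) <> RtoC 0) :
  forall (j : side) (s : R), - (l / 2) < s < l / 2 ->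
    exists qN : R,
      is_normal_derivative l q j s qN /\
      exists S : C,
        is_bilateral_sum (fourier_term l lam f k j s) S /\
        RtoC qN = (1 / (3 * l) * S)%C.
Proof.
  destruct Hq1 as [Hqc (gx & gy & Hgx & Hgy & Hgrad)].
  destruct (C2_extension l f Hf) as (fe & Dfe & DDfe & Cfe & Efe).
  set (g := neumann l gx gy).
  assert (Hg : forall j s, continuous (g j) s) by (intros; now apply continuous_neumann).
  assert (Cfe' : forall j s, continuous (Derive (fe j)) s).
  { intros j s. apply (ex_derive_continuous (Derive (fe j))). eexists; apply DDfe. }
  assert (Cfe0 : forall j s, continuous (fe j) s).
  { intros j s. apply (ex_derive_continuous (fe j)). eexists; apply Dfe. }
  assert (Hffe : forall j s, - (l / 2) < s < l / 2 -> f j s = fe j s /\ Derive (f j) s = Derive (fe j) s).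
  { intros j s Hs. split; [apply Efe; lra|]. apply Derive_ext_loc.
    assert (Hloc : locally s (fun t => - (l / 2) < t < l / 2)).
    { apply locally_interval; lra. }
    revert Hloc. apply filter_imp. intros t Ht. apply Efe. lra. }
  rewrite !Efe in Hv12, Hv23, Hv31 by lra.
  assert (Hgreen := exp_green l lam q gx gy Hl Hq2 Hpde Hqc Hgx Hgy Hgrad fe Cfe0
            (fun j s Hs => eq_trans (Hbc j s Hs) (Efe j s Hs))).
  fold g in Hgreen.
  (* The identity is kept for every root, not only for [k m], because the decay estimate applies it
     at the larger root. *)
  assert (Hid : forall (m : Z) (k : C), k <> 0%C ->
     kfreq lam k = (2 * Ci * IZR m * PI / (3 * l))%C ->
     (neumann_transform l g (kfreq lam k) * Mden l lam m k = 2 * Ci * Xfun l lam f k)%C).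
  { intros m k0 Hk0 Ek0.
    rewrite <- (neumann_transform_identity l lam f g fe (fun j => Derive (fe j)) Hl Hg Dfe Cfe' Hffe
                  Hv12 Hv23 Hv31 Hgreen m k0 Hk0 Ek0).
    unfold neumann_transform, efun. rewrite kfreq_opp, !Cexp_pow by auto.
    replace (INR 2 * (- kfreq lam k0 * (l / 2)%R))%C with (- (kfreq lam k0 * l))%C.
    2:{ rewrite RtoC_div by lra. simpl INR. rewrite RtoC_plus. field. }
    replace (INR 2 * (kfreq lam k0 * (l / 2)%R))%C with (kfreq lam k0 * l)%C.
    2:{ rewrite RtoC_div by lra. simpl INR. rewrite RtoC_plus. field. }
    reflexivity. }
  assert (HM : forall m, Mfun l lam f m (k m) = neumann_transform l g (2 * Ci * IZR m * PI / (3 * l))%C).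
  { intros m.
    assert (Hreg : ~ degenerate lam m -> (2 * Ci * Xfun l lam f (k m) / Mden l lam m (k m))%C
                     = neumann_transform l g (2 * Ci * IZR m * PI / (3 * l))%C).
    { intros Hnd. destruct (Hk m Hnd) as [Hk0 Ekm]. pose proof (Hden m Hnd) as Hd.
      rewrite <- (Hid m (k m) Hk0 Ekm). unfold kfreq. rewrite Ekm. field. auto. }
    unfold Mfun. destruct (Req_EM_T lam 0) as [Elam|Nlam]; [destruct (Z.eq_dec m 0) as [Em|Nm]|].
    (* For lam = 0 and m = 0 the wave A = B = 0 is the constant 1, and Green's formula says that the
       total Neumann flux is 0. This is the value assigned to [Mfun] there. *)
    - subst m. replace (2 * Ci * 0 * PI / (3 * l))%C with (0 : C).
      2:{ apply C_eq; simpl; field; lra. }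
      assert (H0 : (0 * 0 + 0 * 0 = 4 * lam)%C) by (rewrite Elam; ring).
      pose proof (Hgreen 0%C 0%C H0) as G. cbv beta zeta in G.
      assert (Et : forall j, (Cexp (inradius l * (0 * normal_x j + 0 * normal_y j))
          * CInt (fun s => Cexp ((0 * normal_x j - 0 * normal_y j) * s)
               * (g j s - (0 * normal_x j + 0 * normal_y j) * fe j s)) (- (l / 2)) (l / 2))%C
          = transform l g j 0).
      { intros i. replace (inradius l * (0 * normal_x i + 0 * normal_y i))%C with (0 : C) by ring.
        rewrite Cexp_0, Cmult_1_l. apply CInt_ext. intros t _.
        replace ((0 * normal_x i - 0 * normal_y i) * t)%C with (0 * t)%C by ring. ring. }
      rewrite !Et in G. unfold neumann_transform.
      replace (- (0 * l))%C with (0 : C) by ring. replace (0 * l)%C with (0 : C) by ring.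
      rewrite Cexp_0, !Cmult_1_l. symmetry. exact G.
    - apply Hreg. intros [_ H]. contradiction.
    - apply Hreg. intros [H _]. contradiction. }
  destruct (neumann_transform_decay l lam f g fe (fun j => Derive (fe j)) (fun j => Derive (Derive (fe j)))
              Hl Dfe DDfe Cfe Hffe Hid) as [K [_ [M0 Hdecay]]].
  intros j s Hs. exists (g j s). split.
  - unfold g, neumann. rewrite clamp_id by lra. now apply normal_derivative_eq.
  - exists (RtoC (3 * l * g j s)). split.
    + pose proof (glue_fourier_series l g Hl Hg K M0 j s Hs Hdecay) as H. cbv zeta in H.
      unfold is_bilateral_sum in *. eapply filterlim_ext; [|exact H].
      intros N. apply sum_n_ext. intros i. cbv beta. symmetry. now apply fourier_term_modes.
    + rewrite !RtoC_mult. field. intros H; injection H; lra.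
Qed.
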